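(* Let $D$ be a smoothly bounded domain in $\mathbb{C}^n$. Then: (i) When $n=1$, $D$ is strictly super-pseudoconvex if and only if $D$ is strictly convex, and $D$ is super-pseudoconvex if and only if $D$ is convex. (ii) When $n>1$, if $D$ is convex and if there is a strictly plurisubharmonic defining function $r\in C^4(\overline D)$ for $D$ such that $$n-1+\frac{|\partial r|_r^2}{n}\,a^{k\bar\ell}[r]\Big[\tilde\Delta r_{k\bar\ell}-a^{i\bar q}[r]\,r^{p\bar j}\,r_{i\bar jk}\,r_{p\bar q\bar\ell}-(\tilde\Delta r_k)(\tilde\Delta r_{\bar\ell})\Big]-2\,\mathrm{Re}\,\big(r^k\tilde\Delta r_k\big)>0\quad\text{on }\partial D$$ (repeated indices summed from $1$ to $n$), then $D$ is strictly super-pseudoconvex. (iii) For $n>1$, neither of the properties convexity and super-pseudoconvexity implies the other: there is a smoothly bounded convex domain in $\mathbb{C}^n$ that is not super-pseudoconvex, and there is a smoothly bounded super-pseudoconvex domain in $\mathbb{C}^n$ that is not convex.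
   Context: Notation. Defining functions are negative: $r<0$ in $D$, $r=0$ and $dr\neq 0$ on $\partial D$. Subscripts denote derivatives: $r_i=\partial r/\partial z_i$, $r_{\bar j}=\partial r/\partial\bar z_j$, $r_{i\bar j}=\partial^2 r/\partial z_i\partial\bar z_j$, $r_{i\bar jk}=\partial^3r/\partial z_i\partial\bar z_j\partial z_k$, etc. $H(r)=[r_{i\bar j}]$ is the complex Hessian; $r\in C^4(\overline D)$ is strictly plurisubharmonic if $H(r)$ is positive definite on $\overline D$. Fefferman operator: $J(r)=-\det\begin{bmatrix} r&\bar\partial r\\ (\bar\partial r)^*&H(r)\end{bmatrix}$, where $\bar\partial r=(r_{\bar 1},\dots,r_{\bar n})$ and $(\bar\partial r)^*=(r_1,\dots,r_n)^t$. For a strictly plurisubharmonic defining function $r\in C^4(\overline D)$ let $[r^{i\bar j}]^t=H(r)^{-1}$, $r^i=\sum_j r^{i\bar j}r_{\bar j}$, $r^{\bar j}=\sum_i r^{i\bar j}r_i$, $|\partial r|_r^2=\sum_{i,j}r^{i\bar j}r_ir_{\bar j}$, $a^{i\bar j}[r]=r^{i\bar j}-\frac{r^ir^{\bar j}}{-r+|\partial r|_r^2}$, $\tilde\Delta=\sum_{i,j}a^{i\bar j}[r]\frac{\partial^2}{\partial z_i\partial\bar z_j}$, $R=\sum_j r^j\frac{\partial}{\partial z_j}$, $|\tilde\nabla f|^2=\sum_{i,j}a^{i\bar j}[r]\frac{\partial f}{\partial z_i}\frac{\partial f}{\partial\bar z_j}$ (for real-valued $f$), and $$\mathcal L_2[r]=1+\frac{|\partial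 r|_r^2}{n(n+1)}\tilde\Delta\log J(r)-\frac{2\,\mathrm{Re}\,R\log J(r)}{n+1}-\frac{|\partial r|_r^2}{(n+1)^2}|\tilde\nabla\log J(r)|^2 .$$ A smoothly bounded pseudoconvex domain $D$ in $\mathbb C^n$ is strictly super-pseudoconvex (respectively super-pseudoconvex) if there is a strictly plurisubharmonic defining function $r\in C^4(\overline D)$ for $D$ with $\mathcal L_2[r]>0$ (respectively $\mathcal L_2[r]\ge0$) on $\partial D$. Strictly convex means that, at each boundary point, the real Hessian of a defining function is positive definite on the real tangent space of $\partial D$ (for $n=1$: $\partial D$ has positive curvature). *)

(* Defs.v *)
From HB Require Import structures.
From mathcomp Require Import all_boot all_order all_algebra.
From mathcomp Require Import complex.
From mathcomp Require Import all_classical all_reals all_analysis.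

Set Implicit Arguments.
Unset Strict Implicit.
Unset Printing Implicit Defensive.

Import Order.TTheory GRing.Theory Num.Theory.
Import numFieldNormedType.Exports.

Local Open Scope classical_set_scope.
Local Open Scope complex_scope.
Local Open Scope ring_scope.

(* C^n as a real normed space: the pair (x, y) is the point z = x + i y. *)
Notation Cn R n := ('rV[R]_n * 'rV[R]_n)%type.

Section Smoothness.
Context {R : realType} {V : normedModType R}.
Implicit Types (U : set V) (f : V -> R).

(* f is of class C^k on the open set U; ranging over all directions v, rather
   than over a basis, gives the same class. *)
Fixpoint Ck (k : nat) (U : set V) (f : V -> R) : Prop :=
  {in U, continuous f} /\
  if k is k'.+1
  then forall v, {in U, forall z, derivable f z v} /\ Ck k' U ('D_v f)
  else True.

Definition Cinfty U f : Prop := forall k, Ck k U f.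

Definition boundary U : set V := closure U `\` U°.

(* The regularity class [reg] is required on an open neighbourhood of the
   closure of D, so that all derivatives make sense on the boundary. *)
Definition defining_function (reg : set V -> (V -> R) -> Prop)
    (D : set V) (r : V -> R) : Prop :=
  [/\ exists U, [/\ open U, closure D `<=` U & reg U r],
      forall z, D z -> r z < 0 &
      forall z, boundary D z -> r z = 0 /\ exists v, 'D_v r z != 0].

Definition smoothly_bounded_domain (D : set V) : Prop :=
  [/\ D !=set0, open D, connected D, bounded_set D &
      exists rho, defining_function Cinfty D rho].

(* The real tangent space of the boundary at z is the kernel of d rho; the sign
   of the Hessian on it does not depend on the defining function rho. *)
Definition strictly_convex (D : set V) : Prop :=
  exists rho, defining_function (Ck 2) D rho /\
    forall z v, boundary D z -> v != 0 -> 'D_v rho z = 0 ->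
      0 < 'D_v ('D_v rho) z.

End Smoothness.

Section Wirtinger.
Context {R : realType} {n : nat}.
Implicit Types (f : Cn R n -> R[i]) (z : Cn R n).

Definition Cderive (v : Cn R n) f z : R[i] :=
  'D_v (fun w => complex.Re (f w)) z +i* 'D_v (fun w => complex.Im (f w)) z.

Definition dx (j : 'I_n) f := Cderive (delta_mx 0 j, 0) f.
Definition dy (j : 'I_n) f := Cderive (0, delta_mx 0 j) f.

Definition dz (j : 'I_n) f z : R[i] := (dx j f z - 'i * dy j f z) / 2.
Definition dzb (j : 'I_n) f z : R[i] := (dx j f z + 'i * dy j f z) / 2.

End Wirtinger.

Section Fefferman.
Context {R : realType} {n : nat}.
Variable r : Cn R n -> R.
Implicit Types (i j k l p q : 'I_n) (z : Cn R n).

Local Notation rC := (fun z : Cn R n => (r z)%:C).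

(* In the names, b marks a barred index: r_ijbk i j k is r_{i \bar j k}. *)
Definition r_i i := dz i rC.
Definition r_jb j := dzb j rC.
Definition r_ijb i j := dzb j (r_i i).
Definition r_ijbk i j k := dz k (r_ijb i j).
Definition r_ijblb i j l := dzb l (r_ijb i j).

Definition hessian z : 'M[R[i]]_n := \matrix_(i, j) r_ijb i j z.

(* The determinant is real because the complex Hessian is Hermitian; the same
   remark applies to the other real quantities below defined through Re. *)
Definition feffermanJ z : R :=
  complex.Re (- \det (block_mx ((r z)%:C)%:M (\row_j r_jb j z)
                               (\col_i r_i i z) (hessian z))).

Definition log_J z : R[i] := (ln (feffermanJ z))%:C.

(* r^{i \bar j} is the (j, i) entry of H(r)^{-1}. *)
Definition rinv i j z : R[i] := (invmx (hessian z))^T i j.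
Definition rup i z : R[i] := \sum_j rinv i j z * r_jb j z.
Definition rupb j z : R[i] := \sum_i rinv i j z * r_i i z.

Definition dr_norm2 z : R :=
  complex.Re (\sum_i \sum_j rinv i j z * r_i i z * r_jb j z).

Definition acoef i j z : R[i] :=
  rinv i j z - rup i z * rupb j z / (- r z + dr_norm2 z)%:C.

Definition tlaplace (f : Cn R n -> R[i]) z : R[i] :=
  \sum_i \sum_j acoef i j z * dzb j (dz i f) z.

Definition Rfield (f : Cn R n -> R[i]) z : R[i] := \sum_j rup j z * dz j f z.

Definition tgrad_norm2 (f : Cn R n -> R[i]) z : R :=
  complex.Re (\sum_i \sum_j acoef i j z * dz i f z * dzb j f z).

Definition L2 z : R :=
  1 + dr_norm2 z / (n%:R * (n%:R + 1)) * complex.Re (tlaplace log_J z)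
    - 2 * complex.Re (Rfield log_J z) / (n%:R + 1)
    - dr_norm2 z / (n%:R + 1) ^+ 2 * tgrad_norm2 log_J z.

(* The left-hand side of the sufficient condition for convex domains. *)
Definition convex_criterion z : R :=
  n%:R - 1
  + dr_norm2 z / n%:R *
      complex.Re (\sum_k \sum_l acoef k l z *
        (tlaplace (r_ijb k l) z
         - (\sum_i \sum_q \sum_p \sum_j
              acoef i q z * rinv p j z * r_ijbk i j k z * r_ijblb p q l z)
         - tlaplace (r_i k) z * tlaplace (r_jb l) z))
  - 2 * complex.Re (\sum_k rup k z * tlaplace (r_i k) z).

End Fefferman.

Section Pseudoconvexity.
Context {R : realType} {n : nat}.
Implicit Types (D : set (Cn R n)) (r rho : Cn R n -> R).

Definition levi_form r z (w : 'I_n -> R[i]) : R[i] :=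
  \sum_i \sum_j r_ijb r i j z * w i * (w j)^*.

(* Levi pseudoconvexity: nonnegativity on the complex tangent space, a condition
   independent of the choice of the defining function. *)
Definition pseudoconvex D : Prop :=
  exists rho, defining_function (Ck 2) D rho /\
    forall (z : Cn R n) (w : 'I_n -> R[i]),
      boundary D z -> \sum_i r_i rho i z * w i = 0 ->
      0 <= levi_form rho z w.

Definition spsh_defining_function D r : Prop :=
  defining_function (Ck 4) D r /\
  forall (z : Cn R n) (w : 'I_n -> R[i]),
    closure D z -> (exists i, w i != 0) -> 0 < levi_form r z w.

Definition strictly_super_pseudoconvex D : Prop :=
  [/\ smoothly_bounded_domain D, pseudoconvex D &
      exists r, spsh_defining_function D r /\
        forall z : Cn R n, boundary D z -> 0 < L2 r z].

Definition super_pseudoconvex D : Prop :=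
  [/\ smoothly_bounded_domain D, pseudoconvex D &
      exists r, spsh_defining_function D r /\
        forall z : Cn R n, boundary D z -> 0 <= L2 r z].

End Pseudoconvexity.

(* Main.v *)
Require Import Defs.
From HB Require Import structures.
From mathcomp Require Import all_boot all_order all_algebra.
From mathcomp Require Import complex.
From mathcomp Require Import all_classical all_reals all_analysis.
From mathcomp Require Import perm ring lra spectral.

Import Order.TTheory GRing.Theory Num.Theory.
Import numFieldNormedType.Exports.

Local Open Scope classical_set_scope.
Local Open Scope ring_scope.

Set Implicit Arguments.
Unset Strict Implicit.
Unset Printing Implicit Defensive.

(* At a boundary point J(r) = N det H(r) with N = |dr|_r^2, and the derivatives
   of log J(r) are traces involving the inverse of the bordered matrix.  Writing
   S_{ik} = r_{ik} and S(R, R) = r^i r^k S_{ik}, s_k = r^i S_{ik}, and denoting by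
   |.|_a the seminorms given by a^{i \bar j}, one finds
     (n + 1) L_2 = criterion + 2 - 2 Re S(R, R) / N + |S - r_{i \bar j k} r^{\bar j}|_a^2 / n
       + (N / n) |\tilde\Delta r_k|_a^2 - (N / (n + 1)) |s / N + \tilde\Delta r_k|_a^2.
   The last two terms are at least - |s|_a^2 / N, and nonnegativity of the real
   Hessian on the real tangent space, tested on i (R + xi / 2) and xi with xi dual
   to s, gives |s|_a^2 <= 2 N - 2 Re S(R, R).  Hence (n + 1) L_2 >= criterion on a
   convex domain.

   For n = 1 all a^{i \bar j} vanish and L_2 = 1 - Re S(R, R) / N is a positive
   multiple of the real Hessian of r on the tangent line.  The sign of that
   Hessian does not depend on the defining function, and it is nonnegative exactly
   when D is convex.  A strictly plurisubharmonic defining function is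
   (exp (A rho) - 1) (M - |z|^2) with A large.

   For n > 1, the convex domain x_1^4 + y_1^4 + sum_{j >= 2} |z_j|^2 < 1 has no
   strictly plurisubharmonic defining function at all, and the preimage of the ball
   under z |-> (z_1, z_2 + 4 z_1^2, z_3, ...) is not convex although J = 1, hence
   L_2 = 1, for its natural defining function. *)

(** * Calculus of C^k functions *)

(** Class C^k is phrased through directional derivatives only, so additivity in the direction,
    second-order expansions and symmetry of second derivatives are all obtained by restricting to
    lines and applying the mean value theorem. A defining function carries no sign condition outside
    D; the local equality of D with the set where it is negative has to be recovered near each
    boundary point before two defining functions can be compared. A merely nonnegative tangential
    Hessian gives no strict local support, so convexity is derived from contact with strictly curved
    parabolas instead of a local normal form. In the lower bound for L_2, the last two terms are
    compared by a weighted Young inequality with weight n, the weight for which the terms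
    |\tilde\Delta r_k|_a^2 cancel exactly. The test vectors i (R + t xi) and t xi give 4 (t - t^2)
    |s|_a^2 <= 2 N - 2 Re S(R, R) for every real t, and t = 1/2 is the best choice. *)

Section CkCalculus.
Context {R : realType} {V : normedModType R}.
Implicit Types (U : set V) (f g : V -> R) (k : nat).

Lemma near_in U z : open U -> z \in U -> \forall w \near z, w \in U.
Proof.
move=> oU /set_mem Uz; apply: filterS (open_nbhs_nbhs (conj oU Uz)) => w.
exact: mem_set.
Qed.

Lemma Ck_continuous k U f : Ck k U f -> {in U, continuous f}.
Proof. by case: k => [|k] []. Qed.

Lemma Ck_cvg k U f z : Ck k U f -> z \in U -> f x @[x --> z] --> f z.
Proof. by move=> /Ck_continuous; apply. Qed.

Lemma Ck_derivable k U f z v : Ck k.+1 U f -> z \in U -> derivable f z v.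
Proof. by move=> [_ H] Uz; have [+ _] := H v; apply. Qed.

Lemma Ck_derive k U f v : Ck k.+1 U f -> Ck k U ('D_v f).
Proof. by move=> [_ H]; have [] := H v. Qed.

Lemma Ck_is_derive k U f z v : Ck k.+1 U f -> z \in U ->
  is_derive z v f ('D_v f z).
Proof. by move=> cf Uz; apply/derivableP; apply: Ck_derivable cf Uz. Qed.

Lemma CkW k U f : Ck k.+1 U f -> Ck k U f.
Proof.
elim: k f => [|k IH] f cf; first by split => //; exact: Ck_continuous cf.
split; first exact: Ck_continuous cf.
move=> v; split; last exact/IH/Ck_derive.
by move=> z Uz; exact: Ck_derivable cf Uz.
Qed.

Lemma Ck_le k m U f : (k <= m)%N -> Ck m U f -> Ck k U f.
Proof.
move=> /subnKC <-; elim: (m - k)%N => [|i IH]; first by rewrite addn0.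
by rewrite addnS => /CkW.
Qed.

Lemma Ck_subset k U W f : W `<=` U -> Ck k U f -> Ck k W f.
Proof.
move=> WU; elim: k f => [|k IH] f cf.
  by split => // z /set_mem/WU/mem_set; exact: Ck_cvg cf.
split; first by move=> z /set_mem/WU/mem_set; exact: Ck_cvg cf.
move=> v; split; last exact/IH/Ck_derive.
by move=> z /set_mem/WU/mem_set Uz; exact: Ck_derivable cf Uz.
Qed.

(** Derivatives at a point depend on the values nearby, hence the openness of [U]. *)
Lemma Ck_eq k U f g : open U -> {in U, f =1 g} -> Ck k U f -> Ck k U g.
Proof.
move=> oU; elim: k f g => [|k IH] f g fg cf.
  split => // z Uz; have cz := Ck_cvg cf Uz.
  rewrite /prop_for /continuous_at -(fg _ Uz); apply: cvg_trans cz.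
  apply: near_eq_cvg; near do apply: fg; exact: near_in.
split.
  move=> z Uz; have cz := Ck_cvg cf Uz.
  rewrite /prop_for /continuous_at -(fg _ Uz); apply: cvg_trans cz.
  apply: near_eq_cvg; near do apply: fg; exact: near_in.
move=> v; split.
  move=> z Uz; apply: (near_eq_derivable (f := f)).
    by near do apply: fg; exact: near_in.
  exact: Ck_derivable cf Uz.
apply: IH (Ck_derive v cf) => z Uz; apply: near_eq_derive.
by near do apply: fg; exact: near_in.
Unshelve. all: by end_near. Qed.

(** Regularity by exhibiting derivatives: each ['D_v f] need only be identified with an explicit [g]
    on [U]. The closure properties below are inductions through this step. *)
Lemma Ck_step k U f : open U -> {in U, continuous f} ->
  (forall v, exists g, {in U, forall z, is_derive z v f (g z)} /\ Ck k U g) ->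
  Ck k.+1 U f.
Proof.
move=> oU cf H; split=> // v; have [g [fg cg]] := H v; split.
  by move=> z /fg [].
by apply: Ck_eq cg => // z /fg [_ ->].
Qed.

Lemma Ck_cst k U (c : R) : open U -> Ck k U (cst c).
Proof.
move=> oU; elim: k c => [|k IH] c.
  by split => // z _; exact: cvg_cst.
apply: Ck_step => //; first by move=> z _; exact: cvg_cst.
by move=> v; exists (cst 0); split => // z _; exact: is_derive_cst.
Qed.

Lemma CkD k U f g : open U -> Ck k U f -> Ck k U g -> Ck k U (f \+ g).
Proof.
move=> oU; elim: k f g => [|k IH] f g cf cg.
  split=> // z Uz; apply: cvgD;
  [exact: Ck_cvg cf Uz|exact: Ck_cvg cg Uz].
apply: Ck_step => //.
  move=> z Uz; apply: cvgD;
  [exact: Ck_cvg cf Uz|exact: Ck_cvg cg Uz].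
move=> v; exists ('D_v f \+ 'D_v g); split; last by apply: IH; exact: Ck_derive.
by move=> z Uz; apply: is_deriveD; apply: Ck_is_derive Uz; eassumption.
Qed.

Lemma CkM k U f g : open U -> Ck k U f -> Ck k U g -> Ck k U (f \* g).
Proof.
move=> oU; elim: k f g => [|k IH] f g cf cg.
  split=> // z Uz; apply: cvgM;
  [exact: Ck_cvg cf Uz|exact: Ck_cvg cg Uz].
apply: Ck_step => //.
  move=> z Uz; apply: cvgM;
  [exact: Ck_cvg cf Uz|exact: Ck_cvg cg Uz].
move=> v; exists ((f \* 'D_v g) \+ (g \* 'D_v f)); split.
  move=> z Uz; apply: (@is_deriveM _ _ f g);
  [exact: Ck_is_derive cf Uz|exact: Ck_is_derive cg Uz].
apply: CkD => //; apply: IH; by [exact: CkW|exact: Ck_derive].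
Qed.

Lemma CkZ k U (c : R) f : open U -> Ck k U f -> Ck k U (fun z => c * f z).
Proof. by move=> oU cf; apply: (@CkM k U (cst c) f) => //; exact: Ck_cst. Qed.

Lemma CkN k U f : open U -> Ck k U f -> Ck k U (fun z => - f z).
Proof.
by move=> oU /(CkZ (-1) oU); apply: Ck_eq => // z _; rewrite mulN1r.
Qed.

Lemma CkB k U f g : open U -> Ck k U f -> Ck k U g -> Ck k U (f \- g).
Proof. by move=> oU cf cg; apply: (CkD oU cf); exact: CkN. Qed.

Lemma CkX k U f m : open U -> Ck k U f -> Ck k U (fun z => f z ^+ m).
Proof.
move=> oU cf; elim: m => [|m IH].
  by apply: Ck_eq (Ck_cst k 1 oU) => // z _; rewrite expr0.
by apply: Ck_eq (CkM oU cf IH) => // z _ /=; rewrite exprS.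
Qed.

Lemma Ck_sum k U (I : Type) (r : seq I) (P : pred I) (F : I -> V -> R) : open U ->
  (forall i, P i -> Ck k U (F i)) -> Ck k U (fun z => \sum_(i <- r | P i) F i z).
Proof.
move=> oU cF; elim: r => [|i r IH].
  by apply: Ck_eq (Ck_cst k 0 oU) => // z _; rewrite big_nil.
case Pi: (P i).
  by apply: Ck_eq (CkD oU (cF i Pi) IH) => // z _; rewrite big_cons Pi.
by apply: Ck_eq IH => // z _; rewrite big_cons Pi.
Qed.

Lemma CkV k U f : open U -> {in U, forall z, f z != 0} -> Ck k U f ->
  Ck k U (fun z => (f z)^-1).
Proof.
move=> oU nz; elim: k => [|k IH] cf.
  by split => // z Uz; apply: cvgV; [exact: nz|exact: Ck_cvg cf Uz].
apply: Ck_step => //.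
  by move=> z Uz; apply: cvgV; [exact: nz|exact: Ck_cvg cf Uz].
move=> v; exists (fun z => - ((f z)^-1 ^+ 2 * 'D_v f z)); split.
  move=> z Uz; have df := @Ck_derivable _ _ _ _ v cf Uz.
  split; first exact: derivableV (nz _ Uz) df.
  by rewrite deriveV ?nz // exprVn scaleNr.
apply: CkN => //; apply: CkM => //; last exact: Ck_derive.
by apply: CkX => //; exact/IH/CkW.
Qed.

(** The difference quotients are constant away from h = 0. Continuity is a hypothesis because [V]
    may be infinite-dimensional. *)
Lemma Ck_linear k U f : open U -> continuous f -> (forall a v w, f (a *: v + w) = a * f v + f w) ->
  Ck k U f.
Proof.
move=> oU cf lf; case: k => [|k]; first by split => // z _; exact: cf.
apply: (Ck_step oU); first by move=> z _; exact: cf.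
move=> v; exists (cst (f v)); split; last exact: (Ck_cst k (f v) oU).
move=> z _; apply: DeriveDef.
  apply/cvg_ex; exists (f v); apply: cvg_near_cst.
  near=> h; rewrite /= lf addrK scalerA mulVf ?scale1r//.
  by near: h; exact: nbhs_dnbhs_neq.
apply: cvg_lim => //; apply: cvg_near_cst.
near=> h; rewrite /= lf addrK scalerA mulVf ?scale1r//.
by near: h; exact: nbhs_dnbhs_neq.
Unshelve. all: by end_near. Qed.

Lemma derive_linear f z v : continuous f -> (forall a v w, f (a *: v + w) = a * f v + f w) ->
  'D_v f z = f v.
Proof.
move=> cf lf; apply: cvg_lim => //; apply: cvg_near_cst.
near=> h; rewrite /= lf addrK scalerA mulVf ?scale1r//.
by near: h; exact: nbhs_dnbhs_neq.
Unshelve. all: by end_near. Qed.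

(** Bridge to one-variable calculus: a directional difference quotient is that of the restriction to
    the line. *)
Lemma line_quotient f p v t (h : R) :
  h^-1 *: (((fun s : R => f (p + s *: v)) \o shift t) (h *: (1 : R)) - f (p + t *: v)) =
  h^-1 *: ((f \o shift (p + t *: v)) (h *: v) - f (p + t *: v)).
Proof.
congr (_ *: (f _ - _)); rewrite /= [h%:A](mulr1 h) scalerDl.
by rewrite addrCA.
Qed.

Lemma is_derive_line f p v (t : R) : derivable f (p + t *: v) v ->
  is_derive t 1 (fun s : R => f (p + s *: v)) ('D_v f (p + t *: v)).
Proof.
move=> df; split.
  by rewrite /derivable; under eq_fun do rewrite line_quotient.
by rewrite /derive; under eq_fun do rewrite line_quotient.
Qed.

Lemma derivable_line f p v : derivable f p v <-> derivable (fun s : R => f (p + s *: v)) 0 1.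
Proof.
have H h := line_quotient f p v 0 h; rewrite scale0r addr0 in H.
rewrite /derivable /= scale0r addr0; split => df.
  by under eq_fun do rewrite H.
by under eq_fun do rewrite -H.
Qed.

Lemma derive_line f p v : 'D_v f p = 'D_1 (fun s : R => f (p + s *: v)) 0.
Proof.
have H h := line_quotient f p v 0 h; rewrite scale0r addr0 in H.
rewrite /derive /= scale0r addr0.
by under eq_fun do rewrite -H.
Qed.

(** The chain rule holds for mere directional derivatives, since everything happens on the line
    through [z] along [v]. *)
Lemma is_derive_comp1 f (phi : R -> R) z v a df : is_derive (f z) 1 phi a ->
  is_derive z v f df -> is_derive z v (phi \o f) (a * df).
Proof.
move=> dphi [df1 df2].
have dl : is_derive (0 : R) (1 : R) (fun s : R => f (z + s *: v)) df.
  by split; [exact/derivable_line|rewrite -derive_line].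
have := @is_derive1_comp R phi (fun s : R => f (z + s *: v)) 0 a df.
rewrite scale0r addr0 => /(_ dphi dl) [H1 H2]; split.
  exact/derivable_line.
by rewrite derive_line.
Qed.

Lemma Ck_expR k U f : open U -> Ck k U f -> Ck k U (fun z => expR (f z)).
Proof.
move=> oU; elim: k => [|k IH] cf.
  split => // z Uz.
  by apply: continuous_comp; [exact: Ck_cvg cf Uz|exact: continuous_expR].
apply: Ck_step => //.
  move=> z Uz.
  by apply: continuous_comp; [exact: Ck_cvg cf Uz|exact: continuous_expR].
move=> v; exists (fun z => expR (f z) * 'D_v f z); split.
  by move=> z Uz; apply: is_derive_comp1; exact: Ck_is_derive cf Uz.
by apply: CkM => //; [exact/IH/CkW|exact: Ck_derive].
Qed.

Lemma Ck_ln k U f : open U -> {in U, forall z, 0 < f z} -> Ck k U f ->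
  Ck k U (fun z => ln (f z)).
Proof.
move=> oU f0; have cl g : {in U, forall z, 0 < g z} -> {in U, continuous g} ->
    {in U, continuous (fun z => ln (g z))}.
  move=> g0 cg z Uz; apply: continuous_comp; first exact: cg.
  by apply: continuous_ln; exact: g0.
case: k => [|k] cf.
  by split => //; apply: cl => //; exact: Ck_continuous cf.
apply: Ck_step => //; first by apply: cl => //; exact: Ck_continuous cf.
move=> v; exists (fun z => (f z)^-1 * 'D_v f z); split.
  move=> z Uz; apply: is_derive_comp1; last exact: Ck_is_derive cf Uz.
  by apply: is_derive1_ln; exact: f0.
apply: CkM => //; last exact: Ck_derive.
by apply: CkV => //; [move=> z Uz; rewrite gt_eqF// f0|exact: CkW].
Qed.

End CkCalculus.

(** * Increments, second-order expansions and symmetry of second derivatives *)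

Section Increments.
Context {R : realType} {V : normedModType R}.
Implicit Types (U : set V) (f g : V -> R) (k : nat) (p q v w : V).

Lemma is_derive_quad (a b u : R) :
  is_derive u (1 : R) (fun x => a * x + b * x ^+ 2) (a + b * u * 2).
Proof.
have d2 : is_derive u (1 : R) (cst b * (@id R * @id R)) (b * u * 2).
  by apply: is_derive_eq; rewrite /= !scaler0 !addr0 /cst /GRing.scale /=; ring.
have d1 : is_derive u (1 : R) (cst a * @id R) a.
  by apply: is_derive_eq; rewrite /= scaler0 addr0 /cst /GRing.scale /=; ring.
by have := is_deriveD d1 d2.
Qed.

Lemma is_derive_scale f q v (h : R) : derivable f q v ->
  is_derive q (h *: v) f (h * 'D_v f q).
Proof.
move=> df; have E : (fun s : R => f (q + s *: (h *: v))) =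
    (fun u : R => f (q + u *: v)) \o (fun s : R => s * h).
  by apply/funext => s /=; rewrite scalerA.
have d1 : is_derive (0 : R) (1 : R) (fun s : R => s * h) h.
  have := is_derive_quad h 0 0; rewrite mulr0 mul0r addr0.
  by congr is_derive; apply/funext => s; rewrite mul0r addr0 mulrC.
have d2 : is_derive (0 * h) (1 : R) (fun u : R => f (q + u *: v)) ('D_v f q).
  rewrite mul0r -[in 'D_v f q](addr0 q) -(scale0r v).
  by apply: is_derive_line; rewrite scale0r addr0.
have [e1 e2] := @is_derive1_comp R (fun u : R => f (q + u *: v)) (fun s : R => s * h) 0 _ _ d2 d1; rewrite -E in e1 e2.
by split; [exact/derivable_line|rewrite derive_line e2 mulrC].
Qed.

Lemma mvt_line f p v :
  (forall t : R, 0 <= t <= 1 -> derivable f (p + t *: v) v) ->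
  exists2 t : R, 0 <= t <= 1 & f (p + v) - f p = 'D_v f (p + t *: v).
Proof.
move=> df.
have [||t] := @MVT_segment R (fun s : R => f (p + s *: v))
    (fun s : R => 'D_v f (p + s *: v)) 0 1 ler01.
- move=> x; rewrite in_itv /= => /andP[x0 x1].
  by apply: is_derive_line; apply: df; rewrite !ltW.
- apply: derivable_within_continuous => x; rewrite in_itv /= => x01.
  by have [] := is_derive_line (df _ x01).
rewrite in_itv /= scale1r scale0r addr0 subr0 mulr1 => t01 E.
by exists t.
Qed.

Lemma Ck_ball k U f p (e : R) : open U -> Ck k U f -> p \in U -> 0 < e ->
  exists2 d : R, 0 < d & forall q, `|q - p| < d -> q \in U /\ `|f q - f p| < e.
Proof.
move=> oU cf Up e0; have := Ck_cvg cf Up => /cvgrPdist_lt /(_ e e0) H.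
have := near_in oU Up => H'.
have : \forall q \near p, q \in U /\ `|f p - f q| < e by near do split.
move=> /nbhs_ballP[d /= d0 Hd]; exists d => // q qp.
by have [] := Hd q; rewrite -?ball_normE /= distrC// => ?; rewrite distrC.
Unshelve. all: by end_near. Qed.

(** Mean value theorem plus continuity of ['D_w f] at [p]. The bound is uniform in the base point
    [q], which allows increments along different directions to be chained. *)
Lemma Ck1_increment U f p w (e : R) : open U -> Ck 1 U f -> p \in U -> 0 < e ->
  exists2 d : R, 0 < d & forall q (h : R), `|q - p| < d -> `|h| < d ->
    `|f (q + h *: w) - f q - h * 'D_w f p| <= e * `|h|.
Proof.
move=> oU cf Up e0; have cw := Ck_derive w cf.
have [d d0 Hd] := Ck_ball oU cw Up e0.
have w1 : 0 < 1 + `|w| by rewrite ltr_pwDl.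
(* Adding 1 keeps the divisor positive when [w = 0]; the offset of [q] and the move along [w]
   together fit into the radius [d]. *)
exists (d / (1 + `|w|)); first by rewrite divr_gt0.
move=> q h qp hd.
have H t : 0 <= t <= 1 -> `|q + t *: (h *: w) - p| < d.
  move=> /andP[t0 t1]; rewrite addrAC (le_lt_trans (ler_normD _ _))//.
  rewrite -[ltRHS](divfK (lt0r_neq0 w1)) mulrDr mulr1 ltr_leD//.
  rewrite !normrZ (ger0_norm t0) mulrA ler_wpM2r//.
  by rewrite (le_trans _ (ltW hd))// ler_piMl.
have dw t : 0 <= t <= 1 -> derivable f (q + t *: (h *: w)) w.
  by move=> t01; have [Ut _] := Hd _ (H t t01); exact: Ck_derivable cf Ut.
have [|t t01 ->] := @mvt_line f q (h *: w).
  by move=> t t01; have [] := is_derive_scale h (dw t t01).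
have [_ ->] := is_derive_scale h (dw t t01).
rewrite -mulrBr normrM mulrC ler_wpM2r//.
by have [_ /ltW] := Hd _ (H t t01).
Qed.

Lemma derive_of_bound f p v (a : R) :
  (forall e : R, 0 < e -> exists2 d : R, 0 < d & forall h : R, `|h| < d ->
    `|f (p + h *: v) - f p - h * a| <= e * `|h|) -> is_derive p v f a.
Proof.
move=> H; suff C : h^-1 *: ((f \o shift p) (h *: v) - f p) @[h --> 0^'] --> a.
  by split; [apply/cvg_ex; exists a|exact: cvg_lim C].
apply/cvgrPdist_le => e e0; have [d d0 Hd] := H e e0.
near=> h; have h0 : h != 0 by near: h; exact: nbhs_dnbhs_neq.
have hd : `|h| < d by near: h; apply: dnbhs0_lt.
have := Hd h hd; rewrite /= (addrC _ p) => {}Hd.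
have -> : a - h^-1 *: (f (p + h *: v) - f p) =
    - (h^-1 * (f (p + h *: v) - f p - h * a)).
  by rewrite [in RHS]mulrBr mulKf// opprB.
by rewrite normrN normrM normrV ?unitfE// mulrC ler_pdivrMr ?normr_gt0.
Unshelve. all: by end_near. Qed.

(** Additivity is not built into the definition of C^1: the increment along [v + w] is split into
    one along [v] from [p] and one along [w] from the moved point. *)
Lemma Ck1_deriveD U f p v w : open U -> Ck 1 U f -> p \in U ->
  'D_(v + w) f p = 'D_v f p + 'D_w f p.
Proof.
move=> oU cf Up; suff [] : is_derive p (v + w) f ('D_v f p + 'D_w f p) by [].
apply: derive_of_bound => e e0.
have e2 : 0 < e / 2 by rewrite divr_gt0.
have [d1 d10 H1] := Ck1_increment v oU cf Up e2.
have [d2 d20 H2] := Ck1_increment w oU cf Up e2.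
have v1 : 0 < 1 + `|v| by rewrite ltr_pwDl.
exists (Num.min d1 (Num.min d2 (d2 / (1 + `|v|)))); first by rewrite !lt_min d10 d20 divr_gt0.
move=> h; rewrite !lt_min => /and3P[h1 h2 h3].
have {}h3 : `|(p + h *: v) - p| < d2.
  rewrite addrC addKr normrZ; move: h3; rewrite ltr_pdivlMr// mulrDr mulr1.
  by apply: le_lt_trans; rewrite lerDr.
have := H1 p h; rewrite subrr normr0 => /(_ d10 h1) {}H1.
have {}H2 := H2 _ h h3 h2.
have -> : f (p + h *: (v + w)) - f p - h * ('D_v f p + 'D_w f p) =
  (f (p + h *: v) - f p - h * 'D_v f p) +
  (f (p + h *: v + h *: w) - f (p + h *: v) - h * 'D_w f p).
  by rewrite scalerDr addrA; ring.
rewrite (le_trans (ler_normD _ _))// [e in leRHS]splitr mulrDl lerD//.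
Qed.

Lemma Ck1_deriveZ U f p v (c : R) : Ck 1 U f -> p \in U ->
  'D_(c *: v) f p = c * 'D_v f p.
Proof. by move=> cf Up; have [] := is_derive_scale c (@Ck_derivable _ _ _ _ _ _ v cf Up). Qed.

Lemma Ck1_deriveN U f p v : Ck 1 U f -> p \in U -> 'D_(- v) f p = - 'D_v f p.
Proof. by move=> cf Up; rewrite -scaleN1r (Ck1_deriveZ _ _ cf Up) mulN1r. Qed.

(** Expansion along a parabolic arc: the coefficient of s^2 picks up a first derivative along [w].
    With [w] a normal, the choice of [k] bends the arc into or out of the domain. *)
Lemma Ck2_taylor U f p v w (k e : R) : open U -> Ck 2 U f -> p \in U -> 0 < e ->
  exists2 d : R, 0 < d & forall s : R, `|s| < d ->
    `|f (p + s *: v + (k * s ^+ 2) *: w) - f p - s * 'D_v f p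
      - s ^+ 2 * ('D_v ('D_v f) p / 2 + k * 'D_w f p)| <= e * s ^+ 2.
Proof.
move=> oU cf Up e0.
have e2 : 0 < e / 2 by rewrite divr_gt0.
have k1 : 0 < 1 + `|k| by rewrite ltr_pwDl.
have e3 : 0 < e / 2 / (1 + `|k|) by rewrite divr_gt0.
have [d1 d10 H1] := Ck1_increment w oU (CkW cf) Up e3.
have [d2 d20 H2] := Ck1_increment v oU (Ck_derive v cf) Up e2.
have [d3 d30 H3] := Ck_ball oU cf Up e0.
have v1 : 0 < 1 + `|v| by rewrite ltr_pwDl.
exists (Num.min 1 (Num.min (d1 / (1 + `|k|)) (Num.min d2 (Num.min (d1 / (1 + `|v|)) (d3 / (1 + `|v|)))))).
  by rewrite !lt_min ltr01 d20 !divr_gt0.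
move=> s; rewrite !lt_min => /and5P[s1 s2 s3 s4 s5].
have bnd (x : R) : `|s| < x / (1 + `|v|) -> forall t, 0 <= t <= 1 -> `|p + t *: (s *: v) - p| < x.
  move=> sx t /andP[t0 t1]; rewrite addrC addKr !normrZ (ger0_norm t0); move: sx.
  rewrite ltr_pdivlMr// mulrDr mulr1; apply: le_lt_trans.
  by rewrite (le_trans (ler_piMl _ t1)) ?mulr_ge0// lerDr.
have A : `|f (p + s *: v + (k * s ^+ 2) *: w) - f (p + s *: v) - k * s ^+ 2 * 'D_w f p| <= e / 2 * s ^+ 2.
  have ks : `|k * s ^+ 2| <= (1 + `|k|) * `|s| ^+ 2.
    by rewrite normrM normrX ler_wpM2r ?exprn_ge0// lerDr.
  have := H1 (p + s *: v) (k * s ^+ 2).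
  have := bnd _ s4 1; rewrite ler01 lexx scale1r => /(_ isT) H /(_ H) {}H1.
  have /H1 : `|k * s ^+ 2| < d1.
    rewrite (le_lt_trans ks)// mulrC -ltr_pdivlMr//; apply: le_lt_trans s2.
    by rewrite expr2 ler_piMl// ltW.
  move=> {}H1; apply: le_trans H1 _.
  apply: le_trans (ler_wpM2l (ltW e3) ks) _.
  by rewrite mulrA divfK ?gt_eqF// -normrX ger0_norm ?sqr_ge0.
have B : `|f (p + s *: v) - f p - s * 'D_v f p - s ^+ 2 * ('D_v ('D_v f) p / 2)| <= e / 2 * s ^+ 2.
  pose a := 'D_v f p; pose b := 'D_v ('D_v f) p.
  (* Once the nonconstant part of the quadratic Taylor polynomial is subtracted, a single use of the
     mean value theorem leaves a first-order increment of ['D_v f], which [H2] controls. *)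
  pose phi (u : R) := f (p + u *: (s *: v)) - (s * a * u + s ^+ 2 * b / 2 * u ^+ 2).
  have dphi (u : R) : 0 <= u <= 1 -> is_derive u (1 : R) phi
      (s * 'D_v f (p + u *: (s *: v)) - s * a - s ^+ 2 * b * u).
    move=> u01; have [Uu _] := H3 _ (bnd _ s5 u u01).
    have ds := is_derive_scale s (@Ck_derivable _ _ _ _ _ _ v cf Uu).
    have dl := @is_derive_line _ _ f p (s *: v) u (@ex_derive _ _ _ _ _ _ _ ds).
    have dq := is_derive_quad (s * a) (s ^+ 2 * b / 2) u.
    have := is_deriveB dl dq; have [_ ->] := ds.
    by congr is_derive; field.
  have [||u] := @MVT_segment R phi (fun u => s * 'D_v f (p + u *: (s *: v)) - s * a - s ^+ 2 * b * u) 0 1 ler01.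
  - by move=> u; rewrite in_itv /= => /andP[u0 u1]; apply: dphi; rewrite !ltW.
  - apply: derivable_within_continuous => x; rewrite in_itv /= => x01.
    by have [] := dphi _ x01.
  rewrite in_itv /= subr0 mulr1 => u01.
  have -> : phi 1 - phi 0 = f (p + s *: v) - f p - s * 'D_v f p - s ^+ 2 * ('D_v ('D_v f) p / 2).
    by rewrite /phi scale1r scale0r addr0 /a /b; field.
  move=> ->; have us : `|u * s| <= `|s|.
    by move: u01 => /andP[u0 u1]; rewrite normrM (ger0_norm u0) ler_piMl.
  have := H2 p (u * s); rewrite subrr normr0 => /(_ d20 (le_lt_trans us s3)).
  rewrite -scalerA => {}H2.
  have -> : s * 'D_v f (p + u *: (s *: v)) - s * a - s ^+ 2 * b * u =
    s * ('D_v f (p + u *: (s *: v)) - 'D_v f p - u * s * 'D_v ('D_v f) p).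
    by rewrite /a /b; ring.
  rewrite normrM -[s ^+ 2]ger0_norm ?sqr_ge0// normrX expr2 mulrCA ler_wpM2l//.
  by apply: le_trans H2 _; rewrite ler_wpM2l// ltW.
have -> : f (p + s *: v + (k * s ^+ 2) *: w) - f p - s * 'D_v f p
      - s ^+ 2 * ('D_v ('D_v f) p / 2 + k * 'D_w f p) =
   (f (p + s *: v + (k * s ^+ 2) *: w) - f (p + s *: v) - k * s ^+ 2 * 'D_w f p)
  + (f (p + s *: v) - f p - s * 'D_v f p - s ^+ 2 * ('D_v ('D_v f) p / 2)).
  by ring.
by rewrite (le_trans (ler_normD _ _))// [e in leRHS]splitr mulrDl lerD.
Qed.

(** The second difference over a parallelogram is the increment of [psi], the difference of [f]
    between two opposite sides; the mean value theorem turns it into an increment of ['D_v f] along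
    [w]. *)
Lemma Ck2_schwarz_bound U f p v w (e : R) : open U -> Ck 2 U f -> p \in U -> 0 < e ->
  exists2 d : R, 0 < d & forall s : R, `|s| < d ->
    `|f (p + s *: v + s *: w) - f (p + s *: v) - f (p + s *: w) + f p
      - s ^+ 2 * 'D_w ('D_v f) p| <= e * s ^+ 2.
Proof.
move=> oU cf Up e0.
have [d1 d10 H1] := Ck1_increment w oU (Ck_derive v cf) Up e0.
have [d2 d20 H2] := Ck_ball oU cf Up e0.
have v1 : 0 < 1 + (`|v| + `|w|) by rewrite ltr_pwDl.
exists (Num.min d1 (Num.min (d1 / (1 + (`|v| + `|w|))) (d2 / (1 + (`|v| + `|w|))))).
  by rewrite !lt_min d10 !divr_gt0.
move=> s; rewrite !lt_min => /and3P[s1 s2 s3].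
have bnd (x : R) : `|s| < x / (1 + (`|v| + `|w|)) -> forall t u, 0 <= t <= 1 -> 0 <= u <= 1 ->
    `|p + u *: (s *: w) + t *: (s *: v) - p| < x.
  move=> sx t u /andP[t0 t1] /andP[u0 u1]; rewrite -(addrA p) [X in `|X|]addrC addKr.
  apply: le_lt_trans (ler_normD _ _) _.
  rewrite !normrZ (ger0_norm t0) (ger0_norm u0); move: sx.
  rewrite ltr_pdivlMr// mulrDr mulr1; apply: le_lt_trans.
  have A : u * (`|s| * `|w|) <= `|s| * `|w| by rewrite ler_piMl// mulr_ge0.
  have B : t * (`|s| * `|v|) <= `|s| * `|v| by rewrite ler_piMl// mulr_ge0.
  by have := normr_ge0 s; rewrite mulrDr; lra.
have U01 (t u : R) : 0 <= t <= 1 -> 0 <= u <= 1 -> p + u *: (s *: w) + t *: (s *: v) \in U.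
  by move=> t01 u01; have [] := H2 _ (bnd _ s3 t u t01 u01).
pose psi (t : R) := f (p + s *: w + t *: (s *: v)) - f (p + t *: (s *: v)).
have i0 : 0 <= (0 : R) <= 1 by rewrite lexx ler01.
have i1 : 0 <= (1 : R) <= 1 by rewrite lexx ler01.
have dpsi (t : R) : 0 <= t <= 1 -> is_derive t (1 : R) psi
    (s * 'D_v f (p + s *: w + t *: (s *: v)) - s * 'D_v f (p + t *: (s *: v))).
  move=> t01; have u0 := U01 t 0 t01 i0; rewrite scale0r addr0 in u0.
  have u1 := U01 t 1 t01 i1; rewrite scale1r in u1.
  have ds0 := is_derive_scale s (@Ck_derivable _ _ _ _ _ _ v cf u0).
  have ds1 := is_derive_scale s (@Ck_derivable _ _ _ _ _ _ v cf u1).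
  have [_ <-] := ds0; have [_ <-] := ds1.
  have dl0 := @is_derive_line _ _ f p (s *: v) t (@ex_derive _ _ _ _ _ _ _ ds0).
  have dl1 := @is_derive_line _ _ f (p + s *: w) (s *: v) t (@ex_derive _ _ _ _ _ _ _ ds1).
  exact: (is_deriveB dl1 dl0).
have [||t] := @MVT_segment R psi (fun t => s * 'D_v f (p + s *: w + t *: (s *: v)) - s * 'D_v f (p + t *: (s *: v))) 0 1 ler01.
- by move=> u; rewrite in_itv /= => /andP[t0 t1]; apply: dpsi; rewrite !ltW.
- apply: derivable_within_continuous => x; rewrite in_itv /= => x01.
  by have [] := dpsi _ x01.
rewrite in_itv /= subr0 mulr1 => t01 E.
have -> : f (p + s *: v + s *: w) - f (p + s *: v) - f (p + s *: w) + f p = psi 1 - psi 0.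
  by rewrite /psi !scale1r !scale0r !addr0 [p + s *: w + _]addrAC; ring.
rewrite E -mulrBr expr2 -mulrA -mulrBr normrM -[s * s]ger0_norm -?expr2 ?sqr_ge0// normrX.
rewrite [_ ^+ 2]expr2 mulrCA ler_wpM2l//.
have := H1 (p + t *: (s *: v)) s; rewrite [p + _ + s *: w]addrAC; apply => //.
by have := bnd _ s2 t 0 t01 i0; rewrite scale0r addr0.
Qed.

Lemma dist_le_of_common (X a b e t : R) : 0 < t ->
  `|X - t * a| <= e * t -> `|X - t * b| <= e * t -> `|a - b| <= e * 2.
Proof.
move=> t0 H1 H2; rewrite -(ler_pM2l t0) -{1}(ger0_norm (ltW t0)) -normrM.
have -> : t * (a - b) = (X - t * b) - (X - t * a) by ring.
apply: le_trans (ler_normB _ _) _; apply: le_trans (lerD H2 H1) _.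
by rewrite le_eqVlt; apply/orP; left; apply/eqP; ring.
Qed.

Lemma le_two_thirds_le0 (e : R) : e <= e / 3 * 2 -> e <= 0.
Proof. lra. Qed.

(** The second difference is symmetric in [v] and [w], and approximates both mixed derivatives. *)
Lemma Ck2_schwarz U f p v w : open U -> Ck 2 U f -> p \in U ->
  'D_w ('D_v f) p = 'D_v ('D_w f) p.
Proof.
move=> oU cf Up; apply/eqP; rewrite -subr_eq0; apply: contraT => ne.
set e := `|'D_w ('D_v f) p - 'D_v ('D_w f) p|.
have e0 : 0 < e by rewrite normr_gt0.
(* With tolerance e / 3 for each approximation, the gap e would satisfy e <= 2 e / 3. *)
have e2 : 0 < e / 3 by rewrite divr_gt0.
have [d1 d10 H1] := Ck2_schwarz_bound v w oU cf Up e2.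
have [d2 d20 H2] := Ck2_schwarz_bound w v oU cf Up e2.
pose s := Num.min d1 d2 / 2.
have m0 : 0 < Num.min d1 d2 by rewrite lt_min d10.
have s0 : 0 < s by rewrite divr_gt0.
have : `|s| < Num.min d1 d2 by rewrite ger0_norm ?ltW// ltr_pdivrMr// ltr_pMr// ltr1n.
rewrite lt_min => /andP[/H1 {}H1 /H2]; rewrite (addrAC p) => {}H2.
have s20 : 0 < s ^+ 2 by rewrite exprn_gt0.
move: H1 H2; rewrite (addrAC (f _) (- f (p + s *: w))).
move=> H1 H2; have := dist_le_of_common s20 H1 H2.
move=> /le_two_thirds_le0; by rewrite leNgt e0.
Qed.
End Increments.

(** * Boundaries, real Hessians and convexity *)

Section DefiningFunctions.
Context {R : realType} {V : normedModType R}.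
Implicit Types (D U : set V) (f r rho : V -> R) (p q v w N : V).

Lemma convex_set_segmentP D : convex_set D <->
  forall x y (t : R), D x -> D y -> 0 <= t <= 1 -> D (x + t *: (y - x)).
Proof.
split=> [cD x y t Dx Dy t01|H].
  have := cD y x (Itv01 (andP t01).1 (andP t01).2) (mem_set Dy) (mem_set Dx).
  move/set_mem; rewrite /conv /= /unstable.onem.
  by rewrite scalerBl scale1r scalerBr addrCA addrC.
move=> x y l /set_mem Dx /set_mem Dy; apply/mem_set.
have := H y x l%:num Dy Dx; rewrite ge0 le1 => /(_ isT).
have -> // : y + l%:num *: (x - y) = conv l x y.
by rewrite [RHS]/conv /= /unstable.onem scalerBl scale1r scalerBr addrCA.
Qed.

Lemma boundaryE D p : open D -> boundary D p <-> closure D p /\ ~ D p.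
Proof. by move=> oD; rewrite /boundary (interior_id _).1. Qed.

Lemma line_continuous p v : continuous (fun t : R => p + t *: v).
Proof.
move=> t; apply: cvgD; first exact: cvg_cst.
by apply: cvgZ; [exact: cvg_id|exact: cvg_cst].
Qed.

(** On a segment without boundary points, the trace of [D] is open and closed, hence the whole
    segment as soon as it is nonempty. *)
Lemma segment_avoiding_boundary D x y : open D -> D x ->
  (forall t : R, 0 <= t <= 1 -> ~ boundary D (x + t *: (y - x))) -> D y.
Proof.
move=> oD Dx nb; pose g := fun t : R => x + t *: (y - x).
have cg : continuous g := @line_continuous x (y - x).
have cI : connected `[0%R, 1%R : R] by apply/connected_intervalP; exact: interval_is_interval.
suff : `[0%R, 1%R]%classic `&` g @^-1` D = `[0%R, 1%R]%classic.
  move/seteqP => [_ /(_ 1)] /=; rewrite in_itv /= ler01 lexx => /(_ isT) [_].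
  by rewrite /g scale1r addrC subrK.
apply: cI.
- by exists 0; split; rewrite /= ?in_itv /= ?lexx ?ler01// /g scale0r addr0.
- by exists (g @^-1` D) => //; apply: open_comp => // t _; exact: cg.
- exists (g @^-1` (closure D)).
    by apply: preimage_closed; [move=> t _; exact: cg|exact: closed_closure].
  apply/seteqP; split=> t [t01 Dt]; split => //; first exact: subset_closure.
  apply: contrapT => nD; apply: (nb t); first by move: t01; rewrite /= in_itv.
  exact/boundaryE.
Qed.

(** A defining function is not assumed positive outside [D], so describing [D] and its closure by
    the sign of [r] is a local statement, recorded here together with monotonicity along the normal
    [N]. *)
Definition boundary_chart D r U N p (d : R) :=
  forall q, `|q - p| < d ->
    [/\ q \in U, D q <-> r q < 0, closure D q <-> r q <= 0 & 0 < 'D_N r q].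

Lemma ball_segment p x y (d t : R) : `|x - p| < d -> `|y - p| < d -> 0 <= t <= 1 ->
  `|x + t *: (y - x) - p| < d.
Proof.
move=> xp yp /andP[t0 t1].
have -> : x + t *: (y - x) - p = (1 - t) *: (x - p) + t *: (y - p).
  rewrite -{1 2}(subrK p x) -{1}(subrK p y); move: (x - p) (y - p) => a b.
  rewrite opprD [b + p + _]addrACA subrr addr0 addrAC addrK.
  by rewrite scalerBl scale1r scalerBr addrA addrAC.
apply: le_lt_trans (ler_normD _ _) _; rewrite !normrZ (ger0_norm t0).
rewrite ger0_norm ?subr_ge0//.
have [->|tn0] := eqVneq t 0; first by rewrite mul0r subr0 mul1r addr0.
have -> : d = (1 - t) * d + t * d by rewrite mulrBl mul1r subrK.
apply: ler_ltD; first by rewrite ler_wpM2l ?subr_ge0// ltW.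
by rewrite ltr_pM2l// lt_neqAle eq_sym tn0.
Qed.

Lemma chart_increasing D r U N p (d t : R) q : Ck 1 U r -> boundary_chart D r U N p d ->
  `|q - p| < d -> `|q + t *: N - p| < d -> 0 < t -> r q < r (q + t *: N).
Proof.
move=> cr ch qd qtd t0; rewrite -subr_gt0.
have B (u : R) : 0 <= u <= 1 -> `|q + u *: (t *: N) - p| < d.
  move=> u01; have := ball_segment qd qtd u01.
  by rewrite [q + t *: N]addrC addrK.
have [|u u01 ->] := @mvt_line R V r q (t *: N).
  by move=> u u01; have [Uu _ _ _] := ch _ (B u u01); exact: Ck_derivable cr Uu.
have [Uu _ _ pos] := ch _ (B u u01).
by rewrite (Ck1_deriveZ _ _ cr Uu) mulr_gt0.
Qed.

Section Chart.
Variables (k : nat) (D : set V) (r : V -> R) (p N : V) (U : set V).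
Hypotheses (oD : open D) (oU : open U) (DU : closure D `<=` U) (cr : Ck k.+1 U r).
Hypotheses (rneg : forall z, D z -> r z < 0) (rbd : forall z, boundary D z -> r z = 0).

Lemma closure_le0 q : closure D q -> r q <= 0.
Proof.
have [Dq _|nD cq] := pselect (D q); first by rewrite ltW// rneg.
by rewrite rbd//; exact/boundaryE.
Qed.

(** To place a nearby [q] with r q < 0 in [D], start from a point [y] of [D] near [p], descend along
    [- N], cross at the depth of p - e N, where [r] is negative, and climb back to [q]. As [r] stays
    negative, the path never meets the boundary. *)
Lemma exists_chart : boundary D p -> 0 < 'D_N r p ->
  exists2 d : R, 0 < d & boundary_chart D r U N p d.
Proof.
move=> /(boundaryE _ oD)[cp nDp] DN.
have rp : r p = 0 by apply: rbd; exact/boundaryE.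
have cr1 : Ck 1 U r := @Ck_le _ _ _ _ _ _ (ltn0Sn k) cr.
have Up : p \in U by apply/mem_set/DU.
have [d1 d10 H1] := Ck_ball oU (Ck_derive N cr1) Up DN.
have pos q : `|q - p| < d1 -> 0 < 'D_N r q.
  by move=> /H1[_]; rewrite ltr_norml => /andP[+ _]; rewrite ltrBrDr addNr.
have N1 : 0 < 1 + `|N| by rewrite ltr_pwDl.
pose e := d1 / 2 / (1 + `|N|).
have e0 : 0 < e by rewrite !divr_gt0.
have near_shift q (t : R) : `|q - p| < d1 / 2 -> 0 <= t <= 1 -> `|q - (t * e) *: N - p| < d1.
  move=> qd /andP[t0 t1]; rewrite addrAC (le_lt_trans (ler_normB _ _))// [d1]splitr ltrD//.
  have te : 0 <= t * e by apply: mulr_ge0 => //; exact: ltW.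
  rewrite normrZ (ger0_norm te) /e.
  rewrite mulrA mulrAC ltr_pdivrMr//.
  apply: (@le_lt_trans _ _ (d1 / 2 * `|N|)).
    by apply: ler_wpM2r => //; apply: ler_piMl => //; apply: divr_ge0 => //; exact: ltW.
  by rewrite ltr_pM2l ?divr_gt0// ltrDr.
have decr q (t : R) : `|q - p| < d1 / 2 -> 0 <= t <= 1 -> r (q - (t * e) *: N) <= r q.
  move=> qd t01; have [t0 t1] := andP t01.
  have qd1 : `|q - p| < d1 by apply: lt_trans qd _; rewrite ltr_pdivrMr// ltr_pMr// ltr1n.
  have B (u : R) : 0 <= u <= 1 -> `|q - (t * e) *: N + u *: ((t * e) *: N) - p| < d1.
    move=> u01; have := ball_segment (near_shift _ _ qd t01) qd1 u01.
    by rewrite opprB [X in _ + _ *: X](_ : _ = (t * e) *: N)// addrC subrK.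
  rewrite -subr_ge0; have [|u u01] := @mvt_line R V r (q - (t * e) *: N) ((t * e) *: N).
    by move=> u u01; have [Uu _] := H1 _ (B u u01); exact: Ck_derivable cr1 Uu.
  rewrite subrK => ->; have [Uu _] := H1 _ (B u u01).
  rewrite (Ck1_deriveZ _ _ cr1 Uu) mulr_ge0//; first by rewrite mulr_ge0// ltW.
  by rewrite ltW// pos// B.
have decr_lt q (t : R) : `|q - p| < d1 / 2 -> 0 < t <= 1 -> r (q - (t * e) *: N) < r q.
  move=> qd /andP[t0 t1]; have t01 : 0 <= t <= 1 by rewrite (ltW t0).
  have qd1 : `|q - p| < d1 by apply: lt_trans qd _; rewrite ltr_pdivrMr// ltr_pMr// ltr1n.
  have B (u : R) : 0 <= u <= 1 -> `|q - (t * e) *: N + u *: ((t * e) *: N) - p| < d1.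
    move=> u01; have := ball_segment (near_shift _ _ qd t01) qd1 u01.
    by rewrite opprB [X in _ + _ *: X](_ : _ = (t * e) *: N)// addrC subrK.
  rewrite -subr_gt0; have [|u u01] := @mvt_line R V r (q - (t * e) *: N) ((t * e) *: N).
    by move=> u u01; have [Uu _] := H1 _ (B u u01); exact: Ck_derivable cr1 Uu.
  rewrite subrK => ->; have [Uu _] := H1 _ (B u u01).
  by rewrite (Ck1_deriveZ _ _ cr1 Uu) mulr_gt0 ?mulr_gt0// pos// B.
have d12 : 0 < d1 / 2 by rewrite divr_gt0.
have i1 : 0 < (1 : R) <= 1 by rewrite ltr01 lexx.
have pe : r (p - e *: N) < 0.
  by have := @decr_lt p 1; rewrite mul1r rp; apply => //; rewrite subrr normr0.
have Upe : p - e *: N \in U.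
  have := near_shift p 1; rewrite mul1r subrr normr0 ler01 lexx => /(_ d12 isT) /H1.
  by case.
have pe' : 0 < - r (p - e *: N) by rewrite oppr_gt0.
have [d2 d20 H2] := Ck_ball oU cr Upe pe'.
have below q : `|q - p| < d2 -> r (q - e *: N) < 0.
  move=> qd; have [|_] := H2 (q - e *: N).
    by rewrite opprB addrA subrK.
  by rewrite ltr_norml => /andP[_]; rewrite ltrBlDr addNr.
pose d := Num.min (d1 / 2) d2.
have d0 : 0 < d by rewrite lt_min d12.
have bdn0 z : r z < 0 -> ~ boundary D z by move=> rz /rbd E; rewrite E ltxx in rz.
have neg_in q : `|q - p| < d -> r q < 0 -> D q.
  move=> qd rq.
  have [y [Dy]] := cp _ (nbhsx_ballx p d d0).
  rewrite -ball_normE /= distrC => yd.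
  have [qd1 qd2] : `|q - p| < d1 / 2 /\ `|q - p| < d2 by apply/andP; rewrite -lt_min.
  have [yd1 yd2] : `|y - p| < d1 / 2 /\ `|y - p| < d2 by apply/andP; rewrite -lt_min.
  have D1 : D (y - e *: N).
    apply: (segment_avoiding_boundary oD Dy) => t t01; apply: bdn0.
    rewrite [_ - e *: N - y]addrAC subrr add0r scalerN scalerA.
    exact: le_lt_trans (decr _ _ yd1 t01) (rneg Dy).
  have D2 : D (q - e *: N).
    apply: (segment_avoiding_boundary oD D1) => t t01; apply: bdn0.
    rewrite opprB addrA subrK.
    rewrite [y - e *: N + _]addrAC; apply: below.
    exact: ball_segment yd2 qd2 t01.
  apply: (segment_avoiding_boundary oD D2) => t /andP[t0 t1]; apply: bdn0.
  have -> : q - e *: N + t *: (q - (q - e *: N)) = q - ((1 - t) * e) *: N.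
    by rewrite opprB [q + (_ - q)]addrC subrK -scalerA scalerBl scale1r opprB addrA addrAC.
  apply: le_lt_trans (decr _ _ qd1 _) rq.
  by rewrite subr_ge0 t1 gerBl.
exists d => // q qd.
have [qd1 qd2] : `|q - p| < d1 / 2 /\ `|q - p| < d2 by apply/andP; rewrite -lt_min.
have qd' : `|q - p| < d1 by apply: lt_trans qd1 _; rewrite ltr_pdivrMr// ltr_pMr// ltr1n.
have [Uq _] := H1 _ qd'.
split => //.
- by split; [exact: rneg|exact: neg_in].
(* Conversely, if r q <= 0, the points q - (t e) N with small t > 0 have [r] negative, so they lie
   in [D], and they converge to [q]. *)
- split; first exact: closure_le0.
  move=> rq B nB.
  have : \forall t \near 0^'+, B (q - (t * e) *: N) /\ `|q - (t * e) *: N - p| < d.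
    have C : (q - (t * e) *: N) @[t --> 0^'+] --> q.
      apply: cvg_at_right_filter; have := @line_continuous q (- (e *: N)) 0.
      rewrite /continuous_at scale0r addr0.
      by under eq_fun do rewrite scalerN scalerA.
    have nd : nbhs q [set z | `|z - p| < d].
      apply/nbhs_ballP; exists (d - `|q - p|); rewrite /= ?subr_gt0//.
      move=> z; rewrite -ball_normE /= => zq.
      rewrite -(subrK q z) -addrA (le_lt_trans (ler_normD _ _))//.
      by rewrite -ltrBrDr distrC.
    near=> t; split; first by near: t; exact: (C _ nB).
    by near: t; exact: (C _ nd).
  move=> H; have : \forall t \near 0^'+, 0 < t <= 1 /\ B (q - (t * e) *: N) /\ `|q - (t * e) *: N - p| < d.
    near=> t; split; last by near: t.
    by apply/andP; split; near: t; [exact: nbhs_right_gt|exact: nbhs_right_le].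
  move=> /filter_ex[t [t01 [Bt td]]]; exists (q - (t * e) *: N); split => //.
  apply: neg_in => //; exact: lt_le_trans (decr_lt _ _ qd1 t01) rq.
- exact: pos.
Unshelve. all: by end_near. Qed.

End Chart.
End DefiningFunctions.

(** * Signs of the coefficients of quadratic expansions in one variable *)

Section QuadraticExpansion.
Context {R : realType}.
Implicit Types (G : R -> R) (a b e d s : R).

(** G(s) = a s + b s^2 + o(s^2) at 0; the coefficient [b] is thus half of a second derivative. *)
Definition has_expansion G a b := forall e, 0 < e ->
  exists2 d, 0 < d & forall s, `|s| < d -> `|G s - s * a - s ^+ 2 * b| <= e * s ^+ 2.

Lemma has_expansionN G a b : has_expansion G a b -> has_expansion (fun s => - G s) (- a) (- b).
Proof.
move=> H e e0; have [d d0 Hd] := H e e0; exists d => // s sd.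
have -> : - G s - s * - a - s ^+ 2 * - b = - (G s - s * a - s ^+ 2 * b) by ring.
by rewrite normrN Hd.
Qed.

Lemma has_expansion_flip G a b : has_expansion G a b ->
  has_expansion (fun s => G (- s)) (- a) b.
Proof.
move=> H e e0; have [d d0 Hd] := H e e0; exists d => // s sd.
by have := Hd (- s); rewrite normrN sqrrN !mulrN !mulNr => /(_ sd).
Qed.

Lemma expansion_neg_aux G a b s : 0 < s -> s * (`|b| + 1) < - a ->
  `|G s - s * a - s ^+ 2 * b| <= 1 * s ^+ 2 -> G s < 0.
Proof.
move=> s0 sa; rewrite mul1r ler_norml => /andP[_ H].
have H2 : s ^+ 2 * b <= s ^+ 2 * `|b| by rewrite ler_wpM2l ?sqr_ge0// ler_norm.
have H3 : s * (s * (`|b| + 1)) < s * - a by rewrite ltr_pM2l.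
by clear -H H2 H3; lra.
Qed.

Lemma expansion_neg G a b : has_expansion G a b -> a < 0 ->
  exists2 d, 0 < d & forall s, 0 < s < d -> G s < 0.
Proof.
move=> H a0; have [d d0 Hd] := H 1 ltr01.
have b1 : 0 < `|b| + 1 by rewrite ltr_wpDl.
exists (Num.min d (- a / (`|b| + 1))); first by rewrite lt_min d0 divr_gt0// oppr_gt0.
move=> s /andP[s0]; rewrite lt_min => /andP[sd sa].
apply: (@expansion_neg_aux _ a b s s0); first by rewrite -ltr_pdivlMr.
by apply: Hd; rewrite gtr0_norm.
Qed.

Lemma expansion_le0 G a b d : has_expansion G a b -> 0 < d ->
  (forall s, 0 < s < d -> G s <= 0) -> a <= 0.
Proof.
move=> H d0 G0; rewrite leNgt; apply/negP => a0.
have [|d1 d10 H1] := expansion_neg (has_expansionN H); first by rewrite oppr_lt0.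
have m0 : 0 < Num.min d d1 by rewrite lt_min d0.
have : 0 < Num.min d d1 / 2 < Num.min d d1.
  by rewrite divr_gt0// ltr_pdivrMr// ltr_pMr// ltr1n.
set s := _ / 2; rewrite lt_min => /and3P[s0 sd sd1].
have := H1 s; rewrite s0 sd1 => /(_ isT); rewrite oppr_lt0 ltNge G0//.
by rewrite s0 sd.
Qed.

Lemma expansion2_neg_aux G b s : s != 0 -> b < 0 ->
  `|G s - s * 0 - s ^+ 2 * b| <= - b / 2 * s ^+ 2 -> G s < 0.
Proof.
move=> s0 b0; rewrite mulr0 subr0 ler_norml => /andP[_ H].
have H2 : s ^+ 2 * b < 0 by rewrite pmulr_rlt0// exprn_even_gt0.
by clear -H H2; lra.
Qed.

Lemma expansion2_neg G b : has_expansion G 0 b -> b < 0 ->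
  exists2 d, 0 < d & forall s, `|s| < d -> s != 0 -> G s < 0.
Proof.
move=> H b0; have b2 : 0 < - b / 2 by rewrite divr_gt0// oppr_gt0.
have [d d0 Hd] := H _ b2; exists d => // s sd s0.
exact: expansion2_neg_aux s0 b0 (Hd _ sd).
Qed.

Lemma expansion2_le0 G b d : has_expansion G 0 b -> 0 < d ->
  (forall s, `|s| < d -> s != 0 -> G s <= 0) -> b <= 0.
Proof.
move=> H d0 G0; rewrite leNgt; apply/negP => b0.
have H' : has_expansion (fun s => - G s) 0 (- b) by rewrite -oppr0; exact: has_expansionN.
have [|d1 d10 H1] := expansion2_neg H'; first by rewrite oppr_lt0.
have m0 : 0 < Num.min d d1 by rewrite lt_min d0.
have : 0 < Num.min d d1 / 2 < Num.min d d1.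
  by rewrite divr_gt0// ltr_pdivrMr// ltr_pMr// ltr1n.
set s := _ / 2; rewrite lt_min => /and3P[s0 sd sd1].
have := H1 s; rewrite (gtr0_norm s0) gt_eqF// => /(_ sd1 isT).
by rewrite oppr_lt0 ltNge G0 ?gt_eqF// gtr0_norm.
Qed.

Lemma expansion_max G a b d : has_expansion G a b -> 0 < d ->
  (forall s, `|s| < d -> G s <= 0) -> a = 0 /\ b <= 0.
Proof.
move=> H d0 G0.
have a0 : a = 0.
  apply/eqP; rewrite eq_le; apply/andP; split.
    apply: expansion_le0 H d0 _ => s /andP[s0 sd]; apply: G0.
    by rewrite gtr0_norm.
  rewrite -oppr_le0; apply: expansion_le0 (has_expansion_flip H) d0 _ => s /andP[s0 sd].
  by apply: G0; rewrite normrN gtr0_norm.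
split=> //; rewrite a0 in H; apply: expansion2_le0 H d0 _ => s sd _; exact: G0.
Qed.

End QuadraticExpansion.

(** * Tangential Hessians: change of defining function, and necessity for convexity *)

Section TangentialHessian.
Context {R : realType} {V : normedModType R}.
Implicit Types (D U : set V) (f r rho : V -> R) (p q v w N : V).

Lemma Ck2_expansion U f p v w (k : R) : open U -> Ck 2 U f -> p \in U ->
  has_expansion (fun s => f (p + s *: v + (k * s ^+ 2) *: w) - f p)
    ('D_v f p) ('D_v ('D_v f) p / 2 + k * 'D_w f p).
Proof. by move=> oU cf Up e e0; exact: Ck2_taylor oU cf Up e0. Qed.

Lemma Ck2_expansion1 U f p v : open U -> Ck 2 U f -> p \in U ->
  has_expansion (fun s => f (p + s *: v) - f p) ('D_v f p) ('D_v ('D_v f) p / 2).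
Proof.
move=> oU cf Up; have := Ck2_expansion v 0 0 oU cf Up; rewrite mul0r addr0.
by under eq_fun do rewrite mul0r scaler0 addr0.
Qed.

Lemma exists_normal r p (P : (forall v, 'D_(- v) r p = - 'D_v r p)) :
  (exists v, 'D_v r p != 0) -> exists N, 0 < 'D_N r p.
Proof.
case=> v; have [v0 _|v0 _|_ //] := ltgtP 0 ('D_v r p).
  by exists v.
by exists (- v); rewrite P oppr_gt0.
Qed.

Lemma defining_normal k D r p : defining_function (Ck k.+1) D r -> boundary D p ->
  exists N, 0 < 'D_N r p.
Proof.
case=> -[U [oU DU cr]] _ bd bp; have [_] := bd p bp.
apply: exists_normal => v; apply: (@Ck1_deriveN _ _ U); first exact: Ck_le cr.
by apply/mem_set/DU; case: bp.
Qed.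

Lemma defining_chart k D r p N : open D -> defining_function (Ck k.+1) D r ->
  boundary D p -> 0 < 'D_N r p -> exists U d, [/\ open U, closure D `<=` U,
    Ck k.+1 U r, 0 < d & boundary_chart D r U N p d].
Proof.
move=> oD [[U [oU DU cr]] neg bd] bp DN.
have [|d d0 ch] := exists_chart oD oU DU cr neg _ bp DN; first by move=> z /bd[].
by exists U, d.
Qed.

Lemma small_arc p v w (c d : R) : 0 < d -> exists2 e : R, 0 < e &
  forall s : R, `|s| < e -> `|p + s *: v + (c * s ^+ 2) *: w - p| < d.
Proof.
move=> d0; have a1 : 0 < 1 + (`|v| + `|c| * `|w|) by rewrite ltr_pwDl// addr_ge0// mulr_ge0.
exists (Num.min 1 (d / (1 + (`|v| + `|c| * `|w|)))); first by rewrite lt_min ltr01 divr_gt0.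
move=> s; rewrite lt_min => /andP[s1 sd].
rewrite -(addrA p) [X in `|X|]addrC addKr (le_lt_trans (ler_normD _ _))//.
rewrite [X in X + _]normrZ [X in _ + X]normrZ [X in _ + X * _]normrM [X in _ + _ * X * _]normrX.
move: sd; rewrite ltr_pdivlMr// mulrDr mulr1 => sd.
apply: le_lt_trans sd; rewrite mulrDr addrA lerD ?lerDr//.
rewrite (mulrCA `|s|) -mulrA; apply: ler_wpM2l => //; apply: ler_wpM2r => //.
by rewrite expr2 ler_piMl// ltW.
Qed.

(** Near [p], arcs on which [rho] is negative lie in [D], where [r] is negative too. Comparing the
    two expansions along such arcs transfers tangency and bounds the second derivative; the factor
    is the ratio of the normal derivatives. *)
Lemma tangent_transfer D r rho p : open D ->
  defining_function (Ck 2) D r -> defining_function (Ck 2) D rho -> boundary D p ->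
  exists2 c : R, 0 < c & forall v, 'D_v rho p = 0 ->
    'D_v r p = 0 /\ 'D_v ('D_v r) p <= c * 'D_v ('D_v rho) p.
Proof.
move=> oD dr drho bp.
have [N DN] := defining_normal drho bp.
have [Urho [drh [oUrho DUrho crho drh0 chrho]]] := defining_chart oD drho bp DN.
have [[U [oU DU cr]] neg bd] := dr; have [_ _ bdrho] := drho.
have rp : r p = 0 by case: (bd p bp).
have rhop : rho p = 0 by case: (bdrho p bp).
have Up : p \in U by apply/mem_set/DU; case: bp.
have Urhop : p \in Urho by apply/mem_set/DUrho; case: bp.
have cr1 : Ck 1 U r by exact: CkW. have crho1 : Ck 1 Urho rho by exact: CkW.
have H1 w : 'D_w rho p < 0 -> 'D_w r p <= 0.
  move=> Dw; have [d1 d10 Hd1] := expansion_neg (Ck2_expansion1 w oUrho crho Urhop) Dw.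
  have [d2 d20 Hd2] := small_arc p w 0 0 drh0.
  apply: (@expansion_le0 _ _ _ _ (Num.min d1 d2) (Ck2_expansion1 w oU cr Up)).
    by rewrite lt_min d10.
  move=> s /andP[s0]; rewrite lt_min => /andP[sd1 sd2]; rewrite rp subr0.
  apply/ltW/neg.
  have := Hd2 s; rewrite mul0r scale0r addr0 gtr0_norm// => /(_ sd2) /chrho [_ -> _ _].
  by have := Hd1 s; rewrite s0 sd1 rhop subr0; exact.
(* Tilting a tangent vector slightly by a multiple of [- N] makes the derivative of [rho] negative,
   so that [H1] applies; the tilt costs at most [e]. *)
have H2 w : 'D_w rho p = 0 -> 'D_w r p <= 0.
  move=> Dw; apply/ler_addgt0Pl => e e0.
  pose a := e / (1 + `|'D_N r p|).
  have a1 : 0 < 1 + `|'D_N r p| by rewrite ltr_pwDl.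
  have a0 : 0 < a by rewrite divr_gt0.
  have : 'D_(w + (- a) *: N) r p <= 0.
    apply: H1; rewrite (Ck1_deriveD _ _ oUrho crho1 Urhop) (Ck1_deriveZ _ _ crho1 Urhop) Dw add0r.
    by rewrite mulNr oppr_lt0 mulr_gt0.
  rewrite (Ck1_deriveD _ _ oU cr1 Up) (Ck1_deriveZ _ _ cr1 Up) mulNr subr_le0 => H.
  rewrite addr0; apply: le_trans H _.
  apply: (@le_trans _ _ (a * `|'D_N r p|)); first by rewrite ler_pM2l// ler_norm.
  rewrite /a mulrAC ler_pdivrMr// ler_pM2l//.
  by rewrite lerDr.
have H3 w : 'D_w rho p = 0 -> 'D_w r p = 0.
  move=> Dw; apply/eqP; rewrite eq_le H2//= -oppr_le0 -(Ck1_deriveN _ cr1 Up) H2//.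
  by rewrite (Ck1_deriveN _ crho1 Urhop) Dw oppr0.
have rN : 0 < 'D_N r p.
  rewrite lt_neqAle; apply/andP; split; last first.
    rewrite -oppr_le0 -(Ck1_deriveN _ cr1 Up); apply: H1.
    by rewrite (Ck1_deriveN _ crho1 Urhop) oppr_lt0.
  (* Every direction is tangent up to a multiple of [N], so a vanishing normal derivative would make
     dr vanish at [p]. *)
  apply/negP => /eqP rN; have [_ [u]] := bd p bp; case/negP; apply/eqP.
  have E : u = (u + (- ('D_u rho p / 'D_N rho p)) *: N) + ('D_u rho p / 'D_N rho p) *: N.
    by rewrite scaleNr subrK.
  rewrite E (Ck1_deriveD _ _ oU cr1 Up) [X in _ + X](Ck1_deriveZ _ _ cr1 Up) -rN mulr0 addr0.
  apply: H3; rewrite (Ck1_deriveD _ _ oUrho crho1 Urhop) (Ck1_deriveZ _ _ crho1 Urhop).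
  by rewrite mulNr divfK ?gt_eqF// subrr.
exists ('D_N r p / 'D_N rho p); first by rewrite divr_gt0.
move=> v Dv; split; first exact: H3.
rewrite -mulrAC ler_pdivlMr//.
apply/ler_addgt0Pl => e e0.
(* This curvature makes the s^2 coefficient of [rho] equal to - e / (2 'D_N r p), just below
   zero. *)
pose k := - ('D_v ('D_v rho) p + e / 'D_N r p) / 2 / 'D_N rho p.
have kneg : 'D_v ('D_v rho) p / 2 + k * 'D_N rho p < 0.
  rewrite /k divfK ?gt_eqF// -mulrDl pmulr_llt0// opprD addrA subrr add0r oppr_lt0.
  by rewrite divr_gt0.
have E1 := Ck2_expansion v N k oUrho crho Urhop; rewrite Dv in E1.
have E2 := Ck2_expansion v N k oU cr Up; rewrite (H3 _ Dv) in E2.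
have [d1 d10 Hd1] := expansion2_neg E1 kneg.
have [d2 d20 Hd2] := small_arc p v N k drh0.
have : 'D_v ('D_v r) p / 2 + k * 'D_N r p <= 0.
  apply: (@expansion2_le0 _ _ _ (Num.min d1 d2) E2); first by rewrite lt_min d10.
  move=> s; rewrite lt_min => /andP[sd1 sd2] s0; rewrite rp subr0.
  apply/ltW/neg; have /chrho [_ -> _ _] := Hd2 s sd2.
  by have := Hd1 s sd1 s0; rewrite rhop subr0.
rewrite /k; move: ('D_v ('D_v r) p) ('D_v ('D_v rho) p) ('D_N r p) ('D_N rho p) rN DN => A B C E C0 E0.
rewrite -(ler_pM2r (mulr_gt0 (ltr0Sn R 1) E0)) mul0r => H.
have -> : A * E = (A / 2 + - (B + e / C) / 2 / E * C) * (2 * E) + (C * B + e).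
  by field; rewrite !gt_eqF.
by rewrite [e + _]addrC gerDr.
Qed.

Lemma half_neg_double v (s : R) : 2^-1 *: (- s *: v - s *: v) = - s *: v.
Proof. by rewrite -scalerBl scalerA; congr (_ *: _); field. Qed.

(** If the Hessian were negative along [v], an arc could be bent outwards and still have both ends
    in [D]; the midpoint of the ends lies on the outward normal at [p], outside [D]. *)
Lemma convex_hessian_ge0 D r p v : open D -> convex_set D ->
  defining_function (Ck 2) D r -> boundary D p -> 'D_v r p = 0 ->
  0 <= 'D_v ('D_v r) p.
Proof.
move=> oD /convex_set_segmentP cD dr bp Dv; rewrite leNgt; apply/negP => Dvv.
have [N DN] := defining_normal dr bp.
have [U [d [oU DU cr d0 ch]]] := defining_chart oD dr bp DN.
have [_ _ bd] := dr; have rp : r p = 0 by case: (bd p bp).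
have Up : p \in U by apply/mem_set/DU; case: bp.
(* Half of the critical curvature: the s^2 coefficient of [r] along the arc becomes a quarter of the
   second derivative, still negative. *)
pose k := - 'D_v ('D_v r) p / 4 / 'D_N r p.
have k0 : 0 < k by rewrite !divr_gt0// oppr_gt0.
have kneg : 'D_v ('D_v r) p / 2 + k * 'D_N r p < 0.
  rewrite /k divfK ?gt_eqF//; move: Dvv; move: ('D_v _ _) => x x0.
  by clear -x0; lra.
have E := Ck2_expansion v N k oU cr Up; rewrite Dv in E.
have [d1 d10 Hd1] := expansion2_neg E kneg.
have [d2 d20 Hd2] := small_arc p v N k d0.
have [d3 d30 Hd3] := small_arc p 0 N k d0.
pose s : R := Num.min d1 (Num.min d2 d3) / 2.
have m0 : 0 < Num.min d1 (Num.min d2 d3) by rewrite !lt_min d10 d20.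
have s0 : 0 < s by rewrite divr_gt0.
have : s < Num.min d1 (Num.min d2 d3) by rewrite ltr_pdivrMr// ltr_pMr// ltr1n.
rewrite !lt_min => /and3P[sd1 sd2 sd3].
have inD (t : R) : `|t| = s -> D (p + t *: v + (k * t ^+ 2) *: N).
  move=> ts; have := Hd2 t; rewrite ts => /(_ sd2) /ch [_ -> _ _].
  have := Hd1 t; rewrite ts rp subr0; apply => //.
  by rewrite -normr_gt0 ts.
have D1 := inD s (gtr0_norm s0); have D2 := inD (- s); rewrite normrN gtr0_norm// in D2.
have := cD _ _ (2^-1) D1 (D2 erefl).
have -> : p + s *: v + (k * s ^+ 2) *: N + 2^-1 *: (p + - s *: v + (k * (- s) ^+ 2) *: N - (p + s *: v + (k * s ^+ 2) *: N)) = p + (k * s ^+ 2) *: N.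
  rewrite sqrrN opprD addrACA subrr addr0 opprD addrACA subrr add0r.
  rewrite half_neg_double.
  by rewrite scaleNr addrAC addrK.
rewrite invr_ge0 invf_le1// ler1n ler0n => /(_ isT) Dm.
have := Hd3 s; rewrite gtr0_norm// scaler0 addr0 => /(_ sd3) md.
have ks : 0 < k * s ^+ 2 by rewrite mulr_gt0// exprn_gt0.
have := chart_increasing (CkW cr) ch _ md ks; rewrite subrr normr0 => /(_ d0).
have [_ [+ _] _ _] := ch _ md; move=> /(_ Dm) H; by rewrite rp ltNge ltW.
Qed.

End TangentialHessian.

(** * From a nonnegative tangential Hessian to convexity *)

Section NumericFacts.
Context {R : realType}.
Implicit Types (b d s t x y h : R).

Fact double_bound b d x : b * x + b * x < d -> 2 * b * x < d.
Proof. lra. Qed.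

Fact double_bound_shift b d x y : 0 <= y -> b * x + b * x < d - 2 * y -> y + 2 * b * x < d.
Proof. lra. Qed.

(** On [-1, 1] the parabola decreases from b at s = -1, through b / 8 at s = 0, to - b / 2 at s =
    1. *)
Fact parabola_bound b s t : 0 < b -> -1 <= s <= 1 -> 0 <= t <= b ->
  `|b / 8 * (s ^+ 2 - 6 * s + 1) - t| <= 2 * b.
Proof.
move=> b0 /andP[s0 s1] /andP[t0 t1]; have b8 : 0 <= b / 8 by rewrite divr_ge0// ltW.
have h1 : 0 <= b / 8 * ((1 - s) * (5 - s)).
  by rewrite mulr_ge0// mulr_ge0//; lra.
have h2 : 0 <= b / 8 * ((1 + s) * (7 - s)).
  by rewrite mulr_ge0// mulr_ge0//; lra.
by rewrite ler_norml; apply/andP; split; lra.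
Qed.

Fact parabola_lt b s : 0 < b -> -1 < s -> s <= 1 -> b / 8 * (s ^+ 2 - 6 * s + 1) < b.
Proof.
move=> b0 s0 s1; have b8 : 0 < b / 8 by rewrite divr_gt0.
have h2 : 0 < b / 8 * ((1 + s) * (7 - s)).
  by rewrite mulr_gt0// mulr_gt0//; lra.
by lra.
Qed.

Fact norm_sub_bound b t : 0 <= t -> t <= b -> b - t <= 2 * b.
Proof. lra. Qed.

Fact parabola_at1 b t : 0 < b -> 0 <= t -> b / 8 * (1 - 6 * 1 + 1) < t.
Proof. lra. Qed.

Fact shifted_itv s h : -1 < s -> s < 1 -> `|h| < 1 - s -> `|h| < 1 + s -> -1 <= s + h <= 1.
Proof. by rewrite !ltr_norml => s0 s1 /andP[h1 h1'] /andP[h2 h2']; lra. Qed.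

End NumericFacts.

Section LocalConvexity.
Context {R : realType} {V : normedModType R}.
Variables (D : set V) (r : V -> R).
Hypotheses (oD : open D) (dr : defining_function (Ck 2) D r).
Hypothesis hess : forall p v, boundary D p -> 'D_v r p = 0 -> 0 <= 'D_v ('D_v r) p.
Implicit Types (p q v w N x y : V).

Lemma small_pair (a b d : R) : 0 <= a -> 0 <= b -> 0 < d ->
  exists2 e : R, 0 < e <= 1 & e * a + e * b < d.
Proof.
move=> a0 b0 d0; have c0 : 0 < 1 + (a + b) by rewrite ltr_pwDl// addr_ge0.
exists (Num.min 1 (d / (1 + (a + b)))).
  by rewrite lt_min ltr01 divr_gt0//= ge_min lexx.
rewrite -mulrDr; apply: (@le_lt_trans _ _ (d / (1 + (a + b)) * (a + b))).
  by rewrite ler_wpM2r ?addr_ge0// ge_min lexx orbT.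
by rewrite mulrAC ltr_pdivrMr// ltr_pM2l// ltrDr.
Qed.

(* The segment p + [-1,1] v is bent into the parabola of height
   b (s^2 - 6 s + 1) / 8 above it: at s = 0 it leaves D through p, at the two
   ends it stays in D.  The last parabola touching the boundary when it is
   pushed down has positive curvature, against the sign of the Hessian. *)
Lemma no_interior_touching p v : boundary D p ->
  (forall s : R, 0 < s <= 1 -> D (p - s *: v)) ->
  (forall s : R, 0 <= s <= 1 -> closure D (p + s *: v)) -> False.
Proof.
move=> bp inD clD.
have [N DN] := defining_normal dr bp.
have [U [d [oU DU cr d0 ch]]] := defining_chart oD dr bp DN.
have cr1 := CkW cr.
have [_ _ bd] := dr; have rp : r p = 0 by case: (bd p bp).
have [eta /andP[eta0 eta1] etad] := small_pair (normr_ge0 v) (normr_ge0 v) d0.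
pose v1 := eta *: v.
have inD1 (s : R) : 0 < s <= 1 -> D (p - s *: v1).
  move=> /andP[s0 s1]; rewrite scalerA; apply: inD.
  by rewrite mulr_gt0// mulr_ile1// ltW.
have clD1 (s : R) : 0 <= s <= 1 -> closure D (p + s *: v1).
  move=> /andP[s0 s1]; rewrite scalerA; apply: clD.
  by rewrite mulr_ge0 ?(ltW eta0)//= mulr_ile1// ltW.
have D1 : D (p - v1) by have := inD1 1; rewrite scale1r ltr01 lexx; exact.
have [d' /= d'0 Hd'] : exists2 d' : R, 0 < d' & forall q, `|q - (p - v1)| < d' -> D q.
  have /nbhs_ballP[d' /= d'0 H] := open_nbhs_nbhs (conj oD D1).
  by exists d' => // q qd; apply: H; rewrite -ball_normE /= distrC.
have dm0 : 0 < Num.min d' (d - 2 * `|v1|).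
  rewrite lt_min d'0 subr_gt0 mulr2n mulrDl mul1r /v1 normrZ (gtr0_norm eta0).
  exact: etad.
have [b /andP[b0 b1] bm] := small_pair (normr_ge0 N) (normr_ge0 N) dm0.
have {bm} [bd' bdd] : 2 * b * `|N| < d' /\ `|v1| + 2 * b * `|N| < d.
  move: bm; rewrite lt_min => /andP[H1 H2]; split; first exact: double_bound.
  exact: double_bound_shift.
pose q (s : R) := b / 8 * (s ^+ 2 - 6 * s + 1).
(* The parameter [s] runs along the segment and [t] lowers the parabola; [K] below collects the
   parameters whose point is outside [D]. *)
pose c (u : R * R) := p + u.1 *: v1 + (q u.1 - u.2) *: N.
have qb (s t : R) : -1 <= s <= 1 -> 0 <= t <= b -> `|q s - t| <= 2 * b.
  exact: parabola_bound.
have inch (s t : R) : -1 <= s <= 1 -> 0 <= t <= b -> `|c (s, t) - p| < d.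
  move=> s01 t01; rewrite /c /= -(addrA p) [X in `|X|]addrC addKr.
  apply: le_lt_trans (ler_normD _ _) _; apply: le_lt_trans bdd.
  rewrite !normrZ lerD//; first by rewrite ler_piMl// ler_norml.
  by rewrite ler_wpM2r// qb.
have cc : continuous c.
  move=> u; apply: cvgD; first apply: cvgD; first exact: cvg_cst.
    by apply: cvgZ; [exact: cvg_fst|exact: cvg_cst].
  apply: cvgZ; last exact: cvg_cst.
  apply: cvgB; last exact: cvg_snd.
  apply: cvgM; first exact: cvg_cst.
  apply: cvgD; last exact: cvg_cst.
  apply: cvgB; first by apply: cvgM; exact: cvg_fst.
  by apply: cvgM; [exact: cvg_cst|exact: cvg_fst].
pose I1 : set R := `[-1, 1]%classic.
pose I2 : set R := `[0, b]%classic.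
pose K : set (R * R) := (I1 `*` I2) `&` (c @^-1` (~` D)).
have cK : compact K.
  apply: (@subclosed_compact _ _ (I1 `*` I2)).
  - apply: closedI.
      by apply: closedI; apply: preimage_closed => [u _|]; [exact: cvg_fst|exact: itv_closed|exact: cvg_snd|exact: itv_closed].
    by apply: preimage_closed; [move=> u _; exact: cc|exact: open_closedC].
  - by apply: compact_setX; exact: segment_compact.
  - by move=> u [].
have b8 : 0 < b / 8 by rewrite divr_gt0.
(* At (0, 0) the parabola is at height b / 8 > 0 over [p], hence outside [D]. *)
have K0 : K (0, 0).
  split; first by split; rewrite /I1 /I2 /= in_itv /= ?lexx ?(ltW b0) ?lerN10 ?ler01.
  have c00 : c (0, 0) = p + (b / 8) *: N.
    by rewrite /c /= scale0r addr0; congr (p + _ *: N); rewrite /q; ring.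
  rewrite /= c00 => DD.
  have pd : `|p + (b / 8) *: N - p| < d by rewrite -c00 inch ?lerN10 ?ler01 ?lexx ?(ltW b0).
  have := chart_increasing cr1 ch _ pd b8; rewrite subrr normr0 => /(_ d0).
  by have [_ [+ _] _ _] := ch _ pd; move=> /(_ DD) H; rewrite rp ltNge (ltW H).
have [|[s t] /set_mem[[/=]]] := @compact_EVT_max _ R (fun u : R * R => u.2) K (ex_intro _ _ K0) cK.
  by apply: continuous_subspaceT => u; exact: cvg_snd.
rewrite /I1 /I2 /= !in_itv /= => s01 t01 nD tmax.
have [t0 tb] := andP t01; have [s0 s1] := andP s01.
have above (s' t' : R) : -1 <= s' <= 1 -> t < t' <= b -> D (c (s', t')).
  move=> s'01 /andP[tt' t'b]; apply: contrapT => nDc.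
  have : (s', t') \in K.
    apply/mem_set; split=> //; split; rewrite /I1 /I2 /= in_itv//= t'b (ltW (le_lt_trans t0 tt'))//.
  by move=> /tmax /=; rewrite leNgt tt'.
have ccd (s' : R) : -1 <= s' <= 1 -> `|p + s' *: v1 - p| < d.
  move=> /andP[a1 a2]; rewrite [p + _]addrC addrK normrZ; apply: le_lt_trans bdd.
  apply: (@le_trans _ _ `|v1|); first by rewrite ler_piMl// ler_norml a1.
  by rewrite lerDl mulr_ge0// mulr_ge0// ltW.
have push (s' t' : R) : -1 <= s' <= 1 -> 0 <= t' <= b -> q s' < t' -> r (p + s' *: v1) <= 0 -> D (c (s', t')).
  move=> s'01 t'01 qt rs; have [_ -> _ _] := ch _ (inch _ _ s'01 t'01).
  apply: lt_le_trans rs; have tq : 0 < t' - q s' by rewrite subr_gt0.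
  have := chart_increasing cr1 ch (inch _ _ s'01 t'01) _ tq.
  rewrite /c /= -[q s' - t']opprB scaleNr subrK; apply; exact: ccd.
have rcl (s' : R) : -1 <= s' <= 1 -> r (p + s' *: v1) <= 0.
  move=> s'01; have [_ _ <- _] := ch _ (ccd _ s'01).
  have [a1 a2] := andP s'01; have [a0|a0] := leP 0 s'; first by apply: clD1; rewrite a0.
  apply: subset_closure; have := inD1 (- s'); rewrite scaleNr opprK; apply.
  by rewrite oppr_gt0 a0 lerNl.
(* At t = b the parabola lies below the segment except at s = -1, where it meets it at p - v1, a
   point of [D]. *)
have tltb : t < b.
  rewrite lt_neqAle tb andbT; apply/eqP => tE; apply: nD; rewrite tE.
  have [sN1|sN1] := eqVneq s (-1).
    apply: Hd'; rewrite sN1 /c /= scaleN1r [X in `|X|]addrC addKr.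
    have -> : q (-1) = b by rewrite /q sqrrN expr1n; field.
    by rewrite subrr scale0r normr0.
  apply: push => //; first by rewrite (ltW b0) lexx.
    by apply: parabola_lt; rewrite // lt_neqAle eq_sym sN1.
  exact: rcl.
(* A whole ball around p - v1 lies in [D], so no contact occurs at this end. *)
have sgtN1 : -1 < s.
  rewrite lt_neqAle s0 andbT eq_sym; apply/eqP => sE; apply: nD; rewrite sE.
  apply: Hd'; rewrite /c /= scaleN1r [X in `|X|]addrC addKr.
  have -> : q (-1) = b by rewrite /q sqrrN expr1n; field.
  rewrite normrZ; apply: le_lt_trans bd'; rewrite ler_wpM2r// ger0_norm ?subr_ge0//.
  exact: norm_sub_bound.
(* Since q(1) = - b / 2, the other end is always strictly below the segment. *)
have slt1 : s < 1.
  rewrite lt_neqAle s1 andbT; apply/eqP => sE; apply: nD; rewrite sE.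
  have i1 : -1 <= (1 : R) <= 1 by rewrite lexx (le_trans (lerN10 R) ler01).
  by apply: push => //; [rewrite /q expr1n; exact: parabola_at1|exact: rcl].
have Pd := inch _ _ s01 t01.
(* By maximality of [t], every parabola lowered a little further lies in [D]; letting the extra
   amount tend to 0 places the contact parabola in the closure. *)
have clc (s' : R) : -1 <= s' <= 1 -> r (c (s', t)) <= 0.
  move=> s'01; rewrite leNgt; apply/negP => rc.
  have [Uc _ _ _] := ch _ (inch _ _ s'01 t01).
  have [d2 d20 H2] := Ck_ball oU cr1 Uc rc.
  have [e /andP[e0 e1] ed] := small_pair (normr_ge0 N) (lexx 0) d20.
  pose t' := Num.min b (t + e).
  have t'b : t < t' <= b by rewrite lt_min tltb ltrDl e0 ge_min lexx.
  have := above s' t' s'01 t'b.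
  have t'01 : 0 <= t' <= b by case/andP: t'b => H ->; rewrite (ltW (le_lt_trans t0 H)).
  have [Ut' -> _ _] := ch _ (inch _ _ s'01 t'01).
  have [|_] := H2 (c (s', t')).
    rewrite /c /= opprD addrACA subrr add0r -scalerBl normrZ.
    have -> : q s' - t' - (q s' - t) = t - t' by rewrite opprB addrC addrA subrK.
    move: ed; rewrite mulr0 addr0; apply: le_lt_trans.
    rewrite ler_wpM2r// distrC ger0_norm ?subr_ge0; last by case/andP: t'b => /ltW.
    by rewrite lerBlDl ge_min lexx orbT.
  rewrite ltr_norml => /andP[+ _]; rewrite ltrBrDr addNr => /ltW.
  by rewrite leNgt => /negP.
have rP : r (c (s, t)) = 0.
  apply/eqP; rewrite eq_le clc//= leNgt; apply/negP => rP.
  by apply: nD; have [_ -> _ _] := ch _ Pd.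
have bP : boundary D (c (s, t)).
  by apply/boundaryE => //; split => //; have [_ _ -> _] := ch _ Pd; rewrite rP.
have [UP _ _ NP] := ch _ Pd.
(* [w] is the velocity of the parabola at the contact point, and its acceleration b / 4 along [N]
   points strictly outwards. Along the parabola [r] has a maximum there, which would force a
   negative second derivative along the tangent vector [w]. *)
pose w := v1 + (b / 8 * (2 * s - 6)) *: N.
have := Ck2_expansion w N (b / 8) oU cr UP.
rewrite rP; under eq_fun do rewrite subr0.
have arc (h : R) : c (s, t) + h *: w + (b / 8 * h ^+ 2) *: N = c (s + h, t).
  have Eq : (q (s + h) - t) *: N =
      (q s - t) *: N + (h * (b / 8 * (2 * s - 6))) *: N + (b / 8 * h ^+ 2) *: N.
    by rewrite -!scalerDl; congr (_ *: _); rewrite /q; ring.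
  rewrite /c /w /= Eq (scalerDl v1 s h) scalerDr scalerA !addrA.
  by congr (_ + _ + _); rewrite addrAC.
under eq_fun do rewrite arc.
move=> E.
have m0 : 0 < Num.min (1 - s) (1 + s) by rewrite lt_min subr_gt0 slt1 -ltrBlDl sub0r.
have [h|Dw] := expansion_max E m0.
  rewrite lt_min => /andP[h1 h2]; apply: clc.
  exact: shifted_itv.
have := hess bP Dw; move=> Dww; apply/negP; rewrite -ltNge.
by rewrite ltr_wpDl ?divr_ge0// mulr_gt0.
Qed.

(** The points visible from [x] inside [D] form a relatively open and closed subset of the connected
    set [D]. *)
Lemma convex_of_hessian : connected D -> convex_set D.
Proof.
move=> coD; apply/convex_set_segmentP => x y t Dx Dy.
pose S := [set y | forall t : R, 0 <= t <= 1 -> D (x + t *: (y - x))].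
suff : D `&` S = D by move=> /seteqP[_ /(_ y Dy)[_]]; exact.
have xx (z : V) (s : R) : z + s *: (z - z) = z by rewrite subrr scaler0 addr0.
(* Tube argument: compactness of [0, 1] yields one neighbourhood of [z] that works for all
   parameters. *)
have oS : open S.
  rewrite openE => z Sz; rewrite /interior.
  have /compact_near_coveringP/(_ _ (nbhs z) (fun (z' : V) (s : R) => D (x + s *: (z' - x))) (nbhs_filter z)) nc :=
    @segment_compact R 0 1.
  have {nc} : \forall z' \near z, `[0%R, 1%R]%classic `<=` (fun s : R => D (x + s *: (z' - x))).
    apply: nc.
    move=> s; rewrite /= in_itv /= => s01.
    have cf : {for (s, z), continuous (fun u : R * V => x + u.1 *: (u.2 - x))}.
      apply: cvgD; first exact: cvg_cst.
      apply: cvgZ; first exact: cvg_fst.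
      by apply: cvgB; [exact: cvg_snd|exact: cvg_cst].
    have nD : nbhs (x + s *: (z - x)) D by apply: open_nbhs_nbhs; split => //; exact: Sz.
    exact: (cf _ nD).
  apply: filterS => z' H s s01; apply: H.
  by rewrite /= in_itv.
apply: coD.
- by exists x; split => // s s01; rewrite xx.
- by exists S.
- exists (closure S); first exact: closed_closure.
  apply/seteqP; split=> z [Dz Sz]; split => //; first exact: subset_closure.
  have clS (s : R) : 0 <= s <= 1 -> closure D (x + s *: (z - x)).
    move=> s01 B nB.
    have cf : {for z, continuous (fun u : V => x + s *: (u - x))}.
      apply: cvgD; first exact: cvg_cst.
      by apply: cvgZr; apply: cvgB; [exact: cvg_id|exact: cvg_cst].
    have [z' [Sz' Bz']] := Sz _ (cf _ nB).
    by exists (x + s *: (z' - x)); split => //; exact: Sz'.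
  pose I01 : set R := `[0%R, 1%R]%classic.
  pose T : set R := I01 `&` (fun s : R => x + s *: (z - x)) @^-1` (~` D).
  (* If the limiting segment leaves [D], its first exit point contradicts [no_interior_touching]:
     before that point the segment is in [D], after it in the closure. *)
  have [[s0 Ts0]|T0] := pselect (T !=set0); last first.
    move=> s s01; apply: contrapT => nDs; apply: T0; exists s.
    by split; [rewrite /I01 /= in_itv|exact: nDs].
  have cT : compact T.
    apply: (@subclosed_compact _ _ I01).
    - apply: closedI; first exact: itv_closed.
      apply: preimage_closed; last exact: open_closedC.
      by move=> u _; exact: line_continuous.
    - exact: segment_compact.
    - by move=> u [].
  have [|s /set_mem[/=]] := @compact_EVT_min _ R id T (ex_intro _ _ Ts0) cT.
    by apply: continuous_subspaceT => u; exact: cvg_id.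
  rewrite /I01 /= in_itv /= => /andP[s0' s1] nDs smin.
  have sgt0 : 0 < s.
    by rewrite lt_neqAle s0' andbT eq_sym; apply/eqP => sE; apply: nDs; rewrite sE scale0r addr0.
  have slt1 : s < 1.
    by rewrite lt_neqAle s1 andbT; apply/eqP => sE; apply: nDs; rewrite sE scale1r addrC subrK.
  have before (s' : R) : 0 <= s' < s -> D (x + s' *: (z - x)).
    move=> /andP[a0 a1]; apply: contrapT => nD.
    have : s' \in T by apply/mem_set; split => //=; rewrite /I01 /= in_itv /= a0 (ltW (lt_trans a1 slt1)).
    by move=> /smin; rewrite leNgt a1.
  exfalso; pose eta := Num.min s (1 - s).
  have eta0 : 0 < eta by rewrite lt_min sgt0 subr_gt0.
  have etas : eta <= s by rewrite ge_min lexx.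
  have eta1 : eta <= 1 - s by rewrite ge_min lexx orbT.
  apply: (@no_interior_touching (x + s *: (z - x)) (eta *: (z - x))).
  - by apply/boundaryE => //; split => //; apply: clS; rewrite s0'.
  - move=> u /andP[u0 u1]; rewrite scalerA -addrA -scalerBl; apply: before.
    have ue : u * eta <= eta by rewrite ler_piMl// ltW.
    by rewrite subr_ge0 (le_trans ue etas)/= gtrBl mulr_gt0.
  - move=> u /andP[u0 u1]; rewrite scalerA -addrA -scalerDl; apply: clS.
    have ue : u * eta <= eta by rewrite ler_piMl// ltW.
    rewrite addr_ge0 ?mulr_ge0 ?(ltW eta0)//=.
    by rewrite -lerBrDl (le_trans ue eta1).
Qed.

End LocalConvexity.

(** * Linear algebra of the bordered matrix *)

Lemma col_mulmx (K : pzSemiRingType) m n q (X : 'M[K]_(m, n)) (Y : 'M[K]_(n, q)) l :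
  col l (X *m Y) = X *m col l Y.
Proof. by rewrite !colE mulmxA. Qed.

Lemma mxtraceB (K : pzRingType) n (X Y : 'M[K]_n) : \tr (X - Y) = \tr X - \tr Y.
Proof. exact: raddfB. Qed.

(* For H = [r_{i \bar j}], p = (r_i) and p' = (r_{\bar j}) at a boundary point,
   bnorm is |dr|_r^2, bup is (r^i), bdown is (r^{\bar j}), and the (j, i) entry of
   bcoef is a^{i \bar j}; bordered_inv is the inverse of the matrix in J(r). *)
Section BorderedTrace.
Context {F : fieldType} {n : nat}.
Variables (H G : 'M[F]_n) (p : 'cV[F]_n) (p' : 'rV[F]_n).
Hypotheses (GH : G *m H = 1%:M) (HG : H *m G = 1%:M).

Definition bnorm : F := \tr (p' *m G *m p).
Local Notation N := bnorm.
Hypothesis N0 : N != 0.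

Definition bup : 'rV[F]_n := p' *m G.
Definition bdown : 'cV[F]_n := G *m p.
Definition bcoef : 'M[F]_n := G - N^-1 *: (bdown *m bup).
Local Notation u := bup.
Local Notation w := bdown.
Local Notation A := bcoef.

Definition bordered_inv : 'M[F]_(1 + n) :=
  block_mx (- N^-1)%:M (N^-1 *: u) (N^-1 *: w) A.

(** Scalar products are kept as traces of 1 x 1 matrices, so that cyclicity of the trace applies to
    them. *)
Lemma mx11E (X : 'M[F]_1) : X = (\tr X)%:M.
Proof. by rewrite /mxtrace big_ord1 -mx11_scalar. Qed.

Lemma p'_bdown : p' *m w = N%:M.
Proof. by rewrite [LHS]mx11E mulmxA. Qed.

Lemma bup_p : u *m p = N%:M.
Proof. by rewrite [LHS]mx11E. Qed.

Lemma mul_bdown : H *m w = p. Proof. by rewrite mulmxA HG mul1mx. Qed.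
Lemma bup_mul : u *m H = p'. Proof. by rewrite -mulmxA GH mulmx1. Qed.

Lemma bcoef_p : A *m p = 0.
Proof.
by rewrite mulmxBl -scalemxAl -mulmxA bup_p mul_mx_scalar scalerA mulVf// scale1r subrr.
Qed.

Lemma p'_bcoef : p' *m A = 0.
Proof.
by rewrite mulmxBr -scalemxAr mulmxA p'_bdown mul_scalar_mx scalerA mulVf// scale1r subrr.
Qed.

Lemma bcoef_H : A *m H = 1%:M - N^-1 *: (w *m p').
Proof. by rewrite mulmxBl GH -scalemxAl -mulmxA bup_mul. Qed.

Lemma H_bcoef : H *m A = 1%:M - N^-1 *: (p *m u).
Proof. by rewrite mulmxBr HG -scalemxAr mulmxA mul_bdown. Qed.

Lemma bcoef_H_bcoef : A *m H *m A = A.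
Proof. by rewrite bcoef_H mulmxBl mul1mx -scalemxAl -mulmxA p'_bcoef mulmx0 scaler0 subr0. Qed.

Lemma mul_bordered_inv : block_mx 0 p' p H *m bordered_inv = 1%:M.
Proof.
rewrite mulmx_block !mul0mx !add0r -!scalemxAr p'_bdown p'_bcoef H_bcoef mul_bdown mul_mx_scalar.
by rewrite scaleNr addNr [X in block_mx _ _ _ X]addrC subrK scale_scalar_mx mulVf// -scalar_mx_block.
Qed.

(** Shape of the first derivative of log det of the bordered matrix, and of the linear part of the
    second one. *)
Lemma trace_bordered_inv a (b : 'rV[F]_n) (c : 'cV[F]_n) (M : 'M[F]_n) :
  \tr (bordered_inv *m block_mx a%:M b c M) =
  N^-1 * (\tr (u *m c) + \tr (b *m w) - a) + \tr (A *m M).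
Proof.
rewrite mulmx_block mxtrace_block mxtraceD -scalar_mxM mxtrace_scalar mxtraceD.
rewrite -!scalemxAl !mxtraceZ (mxtrace_mulC w b) mulr1n; ring.
Qed.

Lemma trace_bcoef (X : 'M[F]_n) : \tr (A *m X) = \tr (G *m X) - N^-1 * \tr (u *m X *m w).
Proof.
rewrite mulmxBl mxtraceB -scalemxAl mxtraceZ; congr (_ - _ * _).
by rewrite -(mulmxA w) (mxtrace_mulC w).
Qed.

(** The quadratic part of the second derivative of log det. The first block column of one factor is
    column [l] of the bordered matrix itself, and the first block row of the other is its row [k];
    multiplied by the inverse they become unit vectors, which is why so few terms survive. *)
Lemma trace_bordered_inv2 k l (s : 'cV[F]_n) (s' : 'rV[F]_n) (M M' : 'M[F]_n) :
  \tr (bordered_inv *m block_mx (p' 0 l)%:M s' (col l H) M' *m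
       (bordered_inv *m block_mx (p k 0)%:M (row k H) s M)) =
  N^-1 * ((u *m M) 0 l + (M' *m w) k 0 - H k l) + \tr (G *m M' *m A *m M)
  - N^-1 * \tr ((s' - u *m M') *m A *m (s - M *m w)).
Proof.
have Y11 : (- N^-1)%:M *m (p' 0 l)%:M + N^-1 *: u *m col l H = 0.
  rewrite -scalar_mxM -scalemxAl -col_mulmx bup_mul.
  have -> : col l p' = (p' 0 l)%:M by rewrite [LHS]mx11_scalar mxE.
  by rewrite scale_scalar_mx -raddfD /= mulNr addNr raddf0.
have Y21 : N^-1 *: w *m (p' 0 l)%:M + A *m col l H = col l 1%:M.
  rewrite -col_mulmx bcoef_H linearB /= linearZ /= col_mulmx.
  have -> : col l p' = (p' 0 l)%:M by rewrite [LHS]mx11_scalar mxE.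
  by rewrite -scalemxAl addrC subrK.
have hw : row k H *m w = (p k 0)%:M by rewrite -row_mul mul_bdown [LHS]mx11_scalar mxE.
have hA : row k H *m A = row k 1%:M - (N^-1 * p k 0) *: u.
  rewrite -row_mul H_bcoef linearB /= linearZ /= row_mul.
  have -> : row k p = (p k 0)%:M by rewrite [LHS]mx11_scalar mxE.
  by rewrite mul_scalar_mx scalerA.
rewrite /bordered_inv; have trA X := trace_bcoef X; move: trA Y11 Y21 hw hA.
move: A u w => A1 u1 w1 trA Y11 Y21 hw hA.
rewrite !mulmx_block Y11 Y21 mul0mx add0r mxtrace_block.
set X21 := N^-1 *: w1 *m (p k 0)%:M + A1 *m s.
set X12 := (- N^-1)%:M *m row k H + N^-1 *: u1 *m M.
set X22 := N^-1 *: w1 *m row k H + A1 *m M.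
set Y12 := (- N^-1)%:M *m s' + N^-1 *: u1 *m M'.
set Y22 := N^-1 *: w1 *m s' + A1 *m M'.
have EY12 : Y12 = N^-1 *: (u1 *m M' - s').
  by rewrite /Y12 mul_scalar_mx -scalemxAl scaleNr addrC -scalerBr.
have EX12 : X12 = N^-1 *: (u1 *m M - row k H).
  by rewrite /X12 mul_scalar_mx -scalemxAl scaleNr addrC -scalerBr.
have T1 : \tr (Y12 *m X21) = N^-1 * (N^-1 * p k 0 * \tr ((u1 *m M' - s') *m w1) +
    \tr ((u1 *m M' - s') *m A1 *m s)).
  rewrite EY12 -scalemxAl mxtraceZ /X21 mulmxDr mxtraceD; congr (_ * (_ + _)).
    by rewrite mul_mx_scalar -!scalemxAr !mxtraceZ; ring.
  by rewrite mulmxA.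
have T2 : \tr (col l 1%:M *m X12) = N^-1 * ((u1 *m M) 0 l - H k l).
  rewrite EX12 mxtrace_mulC -scalemxAl mxtraceZ; congr (_ * _).
  rewrite -col_mulmx mulmx1 /mxtrace big_ord1 !mxE //.
have T3 : \tr (Y22 *m X22) = N^-1 * (N^-1 * p k 0 * \tr (s' *m w1) + \tr (s' *m A1 *m (M *m w1))
   + (M' *m w1) k 0 - N^-1 * p k 0 * \tr (u1 *m M' *m w1)) + \tr (A1 *m M' *m A1 *m M).
  rewrite /Y22 /X22 mulmxDl !mulmxDr !mxtraceD.
  have -> : \tr (N^-1 *: w1 *m s' *m (N^-1 *: w1 *m row k H)) = N^-1 * (N^-1 * p k 0 * \tr (s' *m w1)).
    rewrite -!scalemxAl -!scalemxAr !mxtraceZ mulmxA mxtrace_mulC.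
    by rewrite -(mulmxA w1 s') (mulmxA (row k H)) hw mul_scalar_mx mxtraceZ; ring.
  have -> : \tr (N^-1 *: w1 *m s' *m (A1 *m M)) = N^-1 * \tr (s' *m A1 *m (M *m w1)).
    by rewrite -!scalemxAl mxtraceZ -[w1 *m s' *m _]mulmxA (mxtrace_mulC w1) !mulmxA.
  have -> : \tr (A1 *m M' *m (N^-1 *: w1 *m row k H)) = N^-1 * ((M' *m w1) k 0 - N^-1 * p k 0 * \tr (u1 *m M' *m w1)).
    rewrite -scalemxAl -scalemxAr mxtraceZ mulmxA (mxtrace_mulC _ (row k H)) !mulmxA hA.
    rewrite !mulmxBl linearB /= -!row_mul mul1mx -!scalemxAl mxtraceZ.
    by congr (_ * (_ - _)); rewrite /mxtrace big_ord1 mxE.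
  by rewrite !mulmxA; ring.
have T4 : \tr (A1 *m M' *m A1 *m M) = \tr (G *m M' *m A1 *m M) - N^-1 * \tr (u1 *m M' *m A1 *m (M *m w1)).
  by rewrite -!(mulmxA A1) trA !mulmxA.
rewrite T1 mxtraceD T2 T3 T4.
rewrite !(mulmxBl, mulmxBr) !mxtraceB !mulmxA.
move: (\tr _) (\tr _) (\tr _) (\tr _) (\tr _) (\tr _) (\tr _) => a b c d e f g.
by ring.
Qed.

End BorderedTrace.

(** * Hermitian positive matrices and the convexity inequality *)

Section PositiveDefinite.
Context {C : numClosedFieldType} {n : nat}.
Implicit Types (H A S : 'M[C]_n) (v y : 'rV[C]_n).

Definition adjmx m q (M : 'M[C]_(m, q)) : 'M[C]_(q, m) := map_mx Num.conj M^T.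

Lemma adjmxK m q (M : 'M[C]_(m, q)) : adjmx (adjmx M) = M.
Proof. by apply/matrixP => i j; rewrite !mxE conjCK. Qed.

Lemma adjmxM m q s (M : 'M[C]_(m, q)) (L : 'M[C]_(q, s)) :
  adjmx (M *m L) = adjmx L *m adjmx M.
Proof. by rewrite /adjmx trmx_mul map_mxM. Qed.

Lemma adjmxD m q (M L : 'M[C]_(m, q)) : adjmx (M + L) = adjmx M + adjmx L.
Proof. by apply/matrixP => i j; rewrite !mxE rmorphD. Qed.

Lemma adjmxB m q (M L : 'M[C]_(m, q)) : adjmx (M - L) = adjmx M - adjmx L.
Proof. by apply/matrixP => i j; rewrite !mxE rmorphB. Qed.

Lemma adjmxZ m q c (M : 'M[C]_(m, q)) : adjmx (c *: M) = c^* *: adjmx M.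
Proof. by apply/matrixP => i j; rewrite !mxE rmorphM. Qed.

Lemma adjmx1 m : adjmx (1%:M : 'M[C]_m) = 1%:M.
Proof. by rewrite /adjmx trmx1 map_mx1. Qed.

Lemma trace_adjmx m (M : 'M[C]_m) : \tr (adjmx M) = (\tr M)^*.
Proof. by rewrite rmorph_sum; apply: eq_bigr => i _; rewrite !mxE. Qed.

Definition psd A := adjmx A = A /\ forall v, 0 <= \tr (v *m A *m adjmx v).
Definition posdef A := adjmx A = A /\ forall v, v != 0 -> 0 < \tr (v *m A *m adjmx v).

Lemma posdef_psd A : posdef A -> psd A.
Proof.
move=> [hA pA]; split=> // v; have [->|v0] := eqVneq v 0; last exact/ltW/pA.
by rewrite !mul0mx mxtrace0.
Qed.

Lemma psd_spectral A : psd A -> exists (P : 'M[C]_n) (d : 'rV[C]_n), [/\ P \in unitmx, (forall i, 0 <= d 0 i),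
  A = adjmx P *m diag_mx d *m P & \det A = \prod_i d 0 i].
Proof.
move=> [hA pA]; have hA' : A \is hermsymmx.
  by apply/is_hermitianmxP; rewrite scale1r [RHS]hA.
have /orthomx_spectralP := hermitian_normalmx hA'.
set P := spectralmx A; set d := spectral_diag A => AE.
have uP : P \is unitarymx := spectral_unitarymx A.
have PP : P *m adjmx P = 1%:M by apply/unitarymxP.
have iP : invmx P = adjmx P by rewrite (invmx_unitary uP).
have Pu : P \in unitmx by exact: spectral_unit.
rewrite iP in AE; exists P, d; split => //.
  (* The eigenvalue is the value of the form on the corresponding row of the unitary matrix. *)
  move=> i; have := pA (row i P).
  have -> : row i P *m A *m adjmx (row i P) = (d 0 i)%:M.
    rewrite -!row_mul AE !mulmxA PP mul1mx -[_ *m _ *m adjmx _]mulmxA.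
    have -> : P *m adjmx (row i P) = col i 1%:M.
      rewrite -PP col_mulmx; congr (_ *m _); by apply/matrixP => a b; rewrite !mxE.
    by apply/matrixP => a b; rewrite !ord1 -col_mulmx mulmx1 !mxE eqxx mulr1n.
  by rewrite mxtrace_scalar mulr1n.
rewrite AE !det_mulmx det_diag mulrAC -det_mulmx.
by rewrite (mulmx1C PP) det1 mul1r.
Qed.

Lemma posdef_unit A : posdef A -> A \in unitmx.
Proof.
move=> [hA pA]; rewrite unitmxE unitfE; apply/negP => /det0P[v v0 vA].
by have := pA v v0; rewrite vA mul0mx mxtrace0 ltxx.
Qed.

Lemma posdef_det_gt0 A : posdef A -> 0 < \det A.
Proof.
move=> pA; have [P [d [_ d0 _ dE]]] := psd_spectral (posdef_psd pA).
rewrite lt_neqAle eq_sym -unitfE -unitmxE posdef_unit//= dE.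
by apply: prodr_ge0 => i _.
Qed.

(** Diagonalizing [B] writes the trace as a sum of values of the form of [A], weighted by the
    nonnegative eigenvalues of [B]. *)
Lemma psd_trace_ge0 A B (X : 'M[C]_n) : psd A -> psd B -> 0 <= \tr (B *m (adjmx X *m A *m X)).
Proof.
move=> [hA pA] /psd_spectral[P [d [_ d0 -> _]]].
rewrite -!mulmxA mxtrace_mulC -!mulmxA mulmxA.
have -> : X *m adjmx P = adjmx (P *m adjmx X) by rewrite adjmxM adjmxK.
rewrite -(mulmxA _ P) (mulmxA P).
set Y := P *m adjmx X; rewrite (mulmxA Y) mulmxA /mxtrace; apply: sumr_ge0 => i _.
have -> : (diag_mx d *m (Y *m A) *m adjmx Y) i i = d 0 i * \tr (row i Y *m A *m adjmx (row i Y)).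
  rewrite -mulmxA mul_diag_mx mxE; congr (_ * _).
  rewrite -row_mul /mxtrace big_ord1 !mxE.
  by apply: eq_bigr => j _; rewrite !mxE.
exact: mulr_ge0.
Qed.

Lemma psd_trmx A : psd A -> psd A^T.
Proof.
move=> [hA pA]; split.
  rewrite -{2}hA; by apply/matrixP => i j; rewrite !mxE.
move=> v; have := pA (map_mx Num.conj v).
rewrite -mxtrace_tr !trmx_mul mulmxA; congr (0 <= \tr (_ *m _ *m _)).
  by apply/matrixP => i j; rewrite !mxE conjCK.
by apply/matrixP => i j; rewrite !mxE.
Qed.

Lemma mxtraceN m (M : 'M[C]_m) : \tr (- M) = - \tr M.
Proof. exact: raddfN. Qed.

(** Positivity of the form at m a - b, divided by [m]. *)
Lemma psd_split A (a b : 'rV[C]_n) (m : C) : psd A -> 0 < m ->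
  \tr ((a + b) *m A *m adjmx (a + b)) <=
  (m + 1) * \tr (a *m A *m adjmx a) + (m + 1) / m * \tr (b *m A *m adjmx b).
Proof.
move=> [hA pA] m0; have := pA (m *: a - b).
have mc : m^* = m by apply: CrealP; rewrite realE (ltW m0).
rewrite adjmxB adjmxZ adjmxD mc.
rewrite !(mulmxBl, mulmxBr, mulmxDl, mulmxDr, mulNmx, mulmxN) -!scalemxAl -!scalemxAr ?scalerN.
rewrite !(mxtraceB, mxtraceD, mxtraceN, mxtraceZ).
move: (\tr _) (\tr _) (\tr _) (\tr _) => aa ba ab bb H.
rewrite -subr_ge0 -(pmulr_rge0 _ m0); apply: le_trans H _.
rewrite le_eqVlt; apply/orP; left; apply/eqP.
by field; rewrite gt_eqF.
Qed.

Lemma trmx_scale_add (c e : C) v y : (c *: (v + e *: y))^T = c *: (v^T + e *: y^T).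
Proof. by apply/matrixP => i j; rewrite !mxE. Qed.

End PositiveDefinite.

(** The first hypothesis is the form at i (u + xi / 2), the second the form at xi. Adding a quarter
    of the second removes [c] and [c'], the terms quadratic in xi coming from S, and the multiples
    of [b] sum to - b. *)
Fact test_vectors_sum (C : numClosedFieldType) (a b c a' c' N : C) :
  0 <= - (a + b + 4^-1 * c) - (a' + b + 4^-1 * c') + (N + 4^-1 * b) *+ 2 ->
  0 <= c + c' + b *+ 2 -> b <= N *+ 2 - a - a'.
Proof.
move=> h1 h2.
have h3 : 0 <= 4^-1 * (c + c' + b *+ 2) by rewrite mulr_ge0// invr_ge0 ler0n.
rewrite -subr_ge0; apply: le_trans (addr_ge0 h1 h3) _.
by rewrite le_eqVlt; apply/orP; left; apply/eqP; field.
Qed.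

Section BorderedPositive.
Context {C : numClosedFieldType} {n : nat}.
Variables (H : 'M[C]_n) (p : 'cV[C]_n).
Hypotheses (pH : posdef H) (p0 : p != 0).
Local Notation G := (invmx H).
Local Notation p' := (adjmx p).
Local Notation N := (bnorm G p p').
Local Notation u := (bup G p').
Local Notation w := (bdown G p).
Local Notation A := (bcoef G p p').

Let HG : H *m G = 1%:M. Proof. by rewrite mulmxV// posdef_unit. Qed.
Let GH : G *m H = 1%:M. Proof. by rewrite mulVmx// posdef_unit. Qed.
Let hH : adjmx H = H. Proof. by case: pH. Qed.

Lemma adj_inv : adjmx G = G.
Proof.
have := congr1 (fun X => adjmx X *m G) GH; rewrite adjmxM hH adjmx1 mul1mx.
have := congr1 (fun X => adjmx X) HG; rewrite adjmxM hH adjmx1 => E _.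
by rewrite -[RHS]mul1mx -E -mulmxA HG mulmx1.
Qed.

Lemma adj_bup : adjmx u = w.
Proof. by rewrite adjmxM adjmxK adj_inv. Qed.

Lemma adj_bdown : adjmx w = u.
Proof. by rewrite -adj_bup adjmxK. Qed.

Lemma bnorm_gt0 : 0 < N.
Proof.
have -> : N = \tr (u *m H *m adjmx u).
  by rewrite adj_bup (bup_mul p' GH) /bnorm mulmxA.
apply: pH.2; apply/eqP => u0; case/eqP: p0.
by rewrite -[p]adjmxK -(bup_mul p' GH) u0 mul0mx /adjmx trmx0 map_mx0.
Qed.

Lemma bnorm_neq0 : N != 0. Proof. by rewrite gt_eqF// bnorm_gt0. Qed.

Lemma bnorm_conj : N^* = N.
Proof. by apply: CrealP; rewrite realE (ltW bnorm_gt0). Qed.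

Lemma adj_bcoef : adjmx A = A.
Proof. have c : (N^-1)^* = N^-1 by apply: CrealP; rewrite realV realE (ltW bnorm_gt0).
by rewrite adjmxB adj_inv adjmxZ adjmxM adj_bup adj_bdown c. Qed.

(** A = A H A with A Hermitian, so the form of A is that of H pulled back. *)
Lemma bcoef_psd : psd A.
Proof.
split=> [|v]; first exact: adj_bcoef.
rewrite -(bcoef_H_bcoef GH bnorm_neq0) !mulmxA -[X in _ *m X *m _]adj_bcoef.
rewrite -(mulmxA _ (adjmx A)) -adjmxM.
exact: (posdef_psd pH).2.
Qed.

Variable S : 'M[C]_n.
Hypothesis symS : S^T = S.

(* With S = [r_{ik}], the second derivative of r in the direction v. *)
Definition tangential_form (v : 'rV[C]_n) : C :=
  \tr (v *m S *m v^T) + (\tr (v *m S *m v^T))^* + \tr (v *m H *m adjmx v) *+ 2.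

(* The test vectors are i (u + xi / 2) and xi, where xi = A applied to the
   conjugate of u S. *)
Lemma convexity_inequality :
  (forall v, \tr (v *m p) + (\tr (v *m p))^* = 0 -> 0 <= tangential_form v) ->
  \tr (u *m S *m A^T *m adjmx (u *m S)) <= N *+ 2 - \tr (u *m S *m u^T) - (\tr (u *m S *m u^T))^*.
Proof.
move=> tan; pose s' := map_mx Num.conj (u *m S); pose xi : 'rV_n := s' *m A.
have Ap := bcoef_p (G := G) (p := p) (p' := p') bnorm_neq0.
have p'A := p'_bcoef (G := G) (p := p) (p' := p') bnorm_neq0.
have xip : xi *m p = 0 by rewrite -mulmxA Ap mulmx0.
set us := \tr (u *m S *m u^T).
set ss := \tr (u *m S *m A^T *m _).
have uSxi : \tr (u *m S *m xi^T) = ss.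
  rewrite /ss trmx_mul mulmxA; congr (\tr (_ *m _)).
  by apply/matrixP => i j; rewrite !mxE.
have xiSu : \tr (xi *m S *m u^T) = ss.
  by rewrite -uSxi -[LHS]mxtrace_tr (trmx_mul (xi *m S)) trmxK (trmx_mul xi) symS mulmxA.
have adjs : adjmx s' = (u *m S)^T by apply/matrixP => i j; rewrite !mxE conjCK.
have xiHxi : \tr (xi *m H *m adjmx xi) = ss.
  rewrite adjmxM adj_bcoef -!mulmxA (mulmxA H) (mulmxA A) (mulmxA A H) (bcoef_H_bcoef GH bnorm_neq0).
  by rewrite adjs -[LHS]mxtrace_tr (trmx_mul s') (trmx_mul A) trmxK -uSxi /xi (trmx_mul s' A) !mulmxA.
have ssr : ss^* = ss.
  by rewrite -xiHxi -trace_adjmx (adjmxM (xi *m H)) (adjmxM xi) adjmxK hH mulmxA.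
have uHu : \tr (u *m H *m adjmx u) = N by rewrite (bup_mul _ GH) adj_bup /bnorm mulmxA.
have uHxi : u *m H *m adjmx xi = 0 by rewrite (bup_mul _ GH) adjmxM adj_bcoef mulmxA p'A mul0mx.
have xiHu : xi *m H *m adjmx u = 0 by rewrite adj_bup -mulmxA (mul_bdown _ HG) xip.
(* Tangency: xi p = 0 and u p = N is real, so the pairing of this vector with [p] is purely
   imaginary. *)
have h1 : 0 <= tangential_form ('i *: (u + 2^-1 *: xi)).
  apply: tan; rewrite -scalemxAl mulmxDl -scalemxAl xip scaler0 addr0 linearZ /=.
  have -> : \tr (u *m p) = N by [].
  by rewrite rmorphM /= conjCi bnorm_conj mulNr subrr.
have h2 : 0 <= tangential_form xi by apply: tan; rewrite xip mxtrace0 rmorph0 addr0.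
move: h1 h2; rewrite /tangential_form.
have c2 : (2^-1 : C)^* = 2^-1 by rewrite fmorphV rmorph_nat.
set x := \tr (xi *m S *m xi^T).
have -> : \tr ('i *: (u + 2^-1 *: xi) *m S *m ('i *: (u + 2^-1 *: xi))^T) =
    - (us + ss + 4^-1 * x).
  rewrite trmx_scale_add.
  rewrite -!scalemxAl -scalemxAr scalerA -expr2 sqrCi scaleN1r mxtraceN.
  rewrite !(mulmxDl, mulmxDr) -!scalemxAl -!scalemxAr !mxtraceD !mxtraceZ uSxi xiSu -/us -/x.
  by congr (- _); field.
have -> : \tr ('i *: (u + 2^-1 *: xi) *m H *m adjmx ('i *: (u + 2^-1 *: xi))) = N + 4^-1 * ss.
  rewrite adjmxZ adjmxD adjmxZ c2 -!scalemxAl -scalemxAr scalerA conjCi mulrN -expr2 sqrCi opprK scale1r.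
  rewrite !(mulmxDl, mulmxDr) -!scalemxAl -!scalemxAr uHxi xiHu !mxtraceD !mxtraceZ mxtrace0 uHu xiHxi.
  by field.
rewrite xiHxi !rmorphN !rmorphD /= rmorphM /= fmorphV rmorph_nat ssr.
exact: test_vectors_sum.
Qed.

End BorderedPositive.

(** * Wirtinger calculus *)

Section ComplexCalculus.
Context {R : realType} {V : normedModType R}.
Implicit Types (U : set V) (F K : V -> R[i]) (v w : V) (c d : R[i]) (k : nat).
Local Notation C := R[i].

Lemma ReD (x y : C) : complex.Re (x + y) = complex.Re x + complex.Re y.
Proof. by case: x; case: y. Qed.
Lemma ImD (x y : C) : complex.Im (x + y) = complex.Im x + complex.Im y.
Proof. by case: x; case: y. Qed.
Lemma ReN (x : C) : complex.Re (- x) = - complex.Re x. Proof. by case: x. Qed.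
Lemma ImN (x : C) : complex.Im (- x) = - complex.Im x. Proof. by case: x. Qed.
Lemma ReM (x y : C) : complex.Re (x * y) =
  complex.Re x * complex.Re y - complex.Im x * complex.Im y.
Proof. by case: x; case: y. Qed.
Lemma ImM (x y : C) : complex.Im (x * y) =
  complex.Re x * complex.Im y + complex.Im x * complex.Re y.
Proof. by case: x; case: y. Qed.
Lemma ReJ (x : C) : complex.Re (Num.conj x) = complex.Re x.
Proof. by case: x. Qed.
Lemma ImJ (x : C) : complex.Im (Num.conj x) = - complex.Im x.
Proof. by case: x. Qed.
Lemma complexE (x : C) : x = (complex.Re x +i* complex.Im x)%C.
Proof. by case: x. Qed.
Lemma complex_eq (x y : C) : complex.Re x = complex.Re y -> complex.Im x = complex.Im y -> x = y.
Proof. by case: x; case: y => a b c d /= -> ->. Qed.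

Definition CCk k U F := Ck k U (fun z => complex.Re (F z)) /\ Ck k U (fun z => complex.Im (F z)).

Definition Cder v F z : C :=
  ('D_v (fun w => complex.Re (F w)) z +i* 'D_v (fun w => complex.Im (F w)) z)%C.

Definition is_cder F z v d := is_derive z v (fun z => complex.Re (F z)) (complex.Re d) /\
  is_derive z v (fun z => complex.Im (F z)) (complex.Im d).

Lemma is_cderE F z v d : is_cder F z v d -> Cder v F z = d.
Proof. by case=> -[_ h1] [_ h2]; rewrite /Cder h1 h2 -complexE. Qed.

Lemma CCk_is_cder k U F z v : CCk k.+1 U F -> z \in U -> is_cder F z v (Cder v F z).
Proof. by case=> c1 c2 Uz; split; [exact: Ck_is_derive c1 Uz|exact: Ck_is_derive c2 Uz]. Qed.

Lemma CCkW k U F : CCk k.+1 U F -> CCk k U F.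
Proof. by case=> /CkW ? /CkW. Qed.

Lemma CCk_le k m U F : (k <= m)%N -> CCk m U F -> CCk k U F.
Proof. by move=> km [? ?]; split; apply: Ck_le km _. Qed.

Lemma CCk_subset k U W F : W `<=` U -> CCk k U F -> CCk k W F.
Proof. by move=> WU [? ?]; split; apply: Ck_subset WU _. Qed.

Lemma CCk_eq k U F K : open U -> {in U, F =1 K} -> CCk k U F -> CCk k U K.
Proof.
by move=> oU e [? ?]; split; [apply: (Ck_eq (f := fun z => complex.Re (F z)))|
  apply: (Ck_eq (f := fun z => complex.Im (F z)))] => // z Uz; rewrite e.
Qed.

Lemma CCk_Cder k U F v : CCk k.+1 U F -> CCk k U (Cder v F).
Proof. by case=> /(Ck_derive v) ? /(Ck_derive v). Qed.

Lemma Cder_near v F K z : (\forall w \near z, F w = K w) -> Cder v F z = Cder v K z.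
Proof.
by move=> e; congr (_ +i* _)%C; apply: near_eq_derive; apply: filterS e => w ->.
Qed.

Lemma CCk_cst k U c : open U -> CCk k U (cst c).
Proof. by move=> oU; split; exact: Ck_cst. Qed.

Lemma CCkD k U F K : open U -> CCk k U F -> CCk k U K -> CCk k U (fun z => F z + K z).
Proof.
move=> oU [f1 f2] [g1 g2]; split.
  by apply: Ck_eq (CkD oU f1 g1) => // z _; rewrite ReD.
by apply: Ck_eq (CkD oU f2 g2) => // z _; rewrite ImD.
Qed.

Lemma CCkN k U F : open U -> CCk k U F -> CCk k U (fun z => - F z).
Proof.
move=> oU [f1 f2]; split.
  by apply: Ck_eq (CkN oU f1) => // z _; rewrite ReN.
by apply: Ck_eq (CkN oU f2) => // z _; rewrite ImN.
Qed.

Lemma CCkM k U F K : open U -> CCk k U F -> CCk k U K -> CCk k U (fun z => F z * K z).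
Proof.
move=> oU [f1 f2] [g1 g2]; split.
  by apply: Ck_eq (CkB oU (CkM oU f1 g1) (CkM oU f2 g2)) => // z _; rewrite ReM.
by apply: Ck_eq (CkD oU (CkM oU f1 g2) (CkM oU f2 g1)) => // z _; rewrite ImM.
Qed.

Lemma CCkZ k U c F : open U -> CCk k U F -> CCk k U (fun z => c * F z).
Proof. by move=> oU; apply: CCkM => //; exact: CCk_cst. Qed.

Lemma CCkJ k U F : open U -> CCk k U F -> CCk k U (fun z => Num.conj (F z)).
Proof.
move=> oU [f1 f2]; split; first by apply: Ck_eq f1 => // z _; rewrite ReJ.
by apply: Ck_eq (CkN oU f2) => // z _; rewrite ImJ.
Qed.

Lemma CCk_sum k U (I : Type) (s : seq I) (P : pred I) (F : I -> V -> C) : open U ->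
  (forall i, P i -> CCk k U (F i)) -> CCk k U (fun z => \sum_(i <- s | P i) F i z).
Proof.
move=> oU cF; elim: s => [|i s IH].
  by apply: CCk_eq (CCk_cst k 0 oU) => // z _; rewrite big_nil.
case Pi: (P i).
  by apply: CCk_eq (CCkD oU (cF i Pi) IH) => // z _; rewrite big_cons Pi.
by apply: CCk_eq IH => // z _; rewrite big_cons Pi.
Qed.

Lemma CCk_prod k U (I : Type) (s : seq I) (P : pred I) (F : I -> V -> C) : open U ->
  (forall i, P i -> CCk k U (F i)) -> CCk k U (fun z => \prod_(i <- s | P i) F i z).
Proof.
move=> oU cF; elim: s => [|i s IH].
  by apply: CCk_eq (CCk_cst k 1 oU) => // z _; rewrite big_nil.
case Pi: (P i).
  by apply: CCk_eq (CCkM oU (cF i Pi) IH) => // z _; rewrite big_cons Pi.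
by apply: CCk_eq IH => // z _; rewrite big_cons Pi.
Qed.

Lemma CCk_real k U (f : V -> R) : open U -> Ck k U f -> CCk k U (fun z => (f z)%:C%C).
Proof. by move=> oU cf; split => //; exact: (Ck_cst k 0 oU). Qed.

Lemma complex_inv (x : C) : x^-1 = Num.conj x *
  ((complex.Re x ^+ 2 + complex.Im x ^+ 2)^-1)%:C%C.
Proof.
case: x => a b; apply: complex_eq; rewrite ?ReM ?ImM /=.
  by rewrite mulr0 subr0.
by rewrite mulr0 add0r mulNr.
Qed.

Lemma CCkV k U F : open U -> {in U, forall z, F z != 0} -> CCk k U F ->
  CCk k U (fun z => (F z)^-1).
Proof.
move=> oU nz cF; have [f1 f2] := cF.
apply: (@CCk_eq _ _ (fun z => Num.conj (F z) *
  ((complex.Re (F z) ^+ 2 + complex.Im (F z) ^+ 2)^-1)%:C%C)) => //.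
  by move=> z _; rewrite -complex_inv.
apply: CCkM => //; first exact: CCkJ.
apply: CCk_real => //; apply: CkV => //; last by apply: CkD => //; exact: CkX.
move=> z Uz; have := nz z Uz; apply: contra.
rewrite paddr_eq0 ?sqr_ge0// !sqrf_eq0 => /andP[/eqP h1 /eqP h2].
by apply/eqP; apply: complex_eq.
Qed.

Lemma is_cder_cst c z v : is_cder (cst c) z v 0.
Proof. by split; exact: is_derive_cst. Qed.

Lemma is_cderD F K z v d e : is_cder F z v d -> is_cder K z v e ->
  is_cder (fun z => F z + K z) z v (d + e).
Proof.
case=> f1 f2 [g1 g2]; split.
  have := is_deriveD f1 g1; rewrite ReD; congr is_derive.
  by apply/funext => x /=; rewrite ReD.
have := is_deriveD f2 g2; rewrite ImD; congr is_derive.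
by apply/funext => x /=; rewrite ImD.
Qed.

Lemma is_cderM F K z v d e : is_cder F z v d -> is_cder K z v e ->
  is_cder (fun z => F z * K z) z v (d * K z + F z * e).
Proof.
case=> f1 f2 [g1 g2]; split.
  have := is_deriveB (is_deriveM f1 g1) (is_deriveM f2 g2); congr is_derive.
    by apply/funext => x /=; rewrite ReM.
  rewrite ReD !ReM /GRing.scale /=.
  move: (complex.Re _) (complex.Re _) (complex.Re _) (complex.Re _) => a1 a2 a3 a4.
  move: (complex.Im _) (complex.Im _) (complex.Im _) (complex.Im _) => b1 b2 b3 b4.
  by ring.
have := is_deriveD (is_deriveM f1 g2) (is_deriveM f2 g1); congr is_derive.
  by apply/funext => x /=; rewrite ImM.
rewrite ImD !ImM /GRing.scale /=.
move: (complex.Re _) (complex.Re _) (complex.Re _) (complex.Re _) => a1 a2 a3 a4.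
move: (complex.Im _) (complex.Im _) (complex.Im _) (complex.Im _) => b1 b2 b3 b4.
by ring.
Qed.

Lemma is_cderJ F z v d : is_cder F z v d -> is_cder (fun z => Num.conj (F z)) z v (Num.conj d).
Proof.
case=> f1 f2; split.
  by rewrite ReJ; under eq_fun do rewrite ReJ.
have := is_deriveN f2; rewrite ImJ; congr is_derive.
by apply/funext => x /=; rewrite ImJ.
Qed.

Lemma is_cderZ c F z v d : is_cder F z v d -> is_cder (fun z => c * F z) z v (c * d).
Proof. by move=> /(is_cderM (is_cder_cst c z v)); rewrite mul0r add0r. Qed.

Lemma is_cder_divr e F z v d : is_cder F z v d -> is_cder (fun z => F z / e) z v (d / e).
Proof. by move=> h; have := is_cderM h (is_cder_cst e^-1 z v); rewrite mulr0 addr0. Qed.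

Lemma Cder_schwarz U F z v w : open U -> CCk 2 U F -> z \in U ->
  Cder v (Cder w F) z = Cder w (Cder v F) z.
Proof.
move=> oU [f1 f2] Uz; apply: complex_eq.
  exact: (Ck2_schwarz w v oU f1 Uz).
exact: (Ck2_schwarz w v oU f2 Uz).
Qed.

Section Wirt.
Variables (v w : V) (c : C).

(* d/dz_j and d/d\bar z_j are the cases c = -i and c = i. *)
Definition wirt F z : C := (Cder v F z + c * Cder w F z) / 2.

(** Records that both directional derivatives exist, which the value of [wirt] alone does not; the
    sum and product rules need it. *)
Definition is_wirt F z d := exists dv dw, [/\ is_cder F z v dv, is_cder F z w dw &
  d = (dv + c * dw) / 2].

Lemma is_wirtE F z d : is_wirt F z d -> wirt F z = d.
Proof. by case=> dv [dw [h1 h2 ->]]; rewrite /wirt (is_cderE h1) (is_cderE h2). Qed.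

Lemma CCk_is_wirt k U F z : CCk k.+1 U F -> z \in U -> is_wirt F z (wirt F z).
Proof.
move=> cF Uz; exists (Cder v F z), (Cder w F z).
by split => //; exact: CCk_is_cder cF Uz.
Qed.

Lemma wirt_near F K z : (\forall w \near z, F w = K w) -> wirt F z = wirt K z.
Proof. by move=> e; rewrite /wirt (Cder_near v e) (Cder_near w e). Qed.

Lemma CCk_wirt k U F : open U -> CCk k.+1 U F -> CCk k U (wirt F).
Proof.
move=> oU cF; have := CCkD oU (CCk_Cder v cF) (CCkZ c oU (CCk_Cder w cF)).
move=> /(CCkZ (2^-1) oU); apply: CCk_eq => // z _.
by rewrite /wirt mulrC.
Qed.

Lemma is_wirt_cst d z : is_wirt (cst d) z 0.
Proof.
exists 0, 0; split; [exact: is_cder_cst|exact: is_cder_cst|].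
by rewrite mulr0 addr0 mul0r.
Qed.

Lemma is_wirtD F K z d e : is_wirt F z d -> is_wirt K z e ->
  is_wirt (fun z => F z + K z) z (d + e).
Proof.
case=> dv [dw [h1 h2 ->]] [ev [ew [g1 g2 ->]]].
exists (dv + ev), (dw + ew); split; [exact: is_cderD|exact: is_cderD|].
by rewrite -mulrDl mulrDr addrACA.
Qed.

Lemma is_wirtM F K z d e : is_wirt F z d -> is_wirt K z e ->
  is_wirt (fun z => F z * K z) z (d * K z + F z * e).
Proof.
case=> dv [dw [h1 h2 ->]] [ev [ew [g1 g2 ->]]].
exists (dv * K z + F z * ev), (dw * K z + F z * ew).
split; [exact: is_cderM|exact: is_cderM|].
rewrite [in RHS]mulrDr [in RHS]addrACA [in RHS]mulrDl; congr (_ + _).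
  by rewrite mulrA -mulrDl mulrAC.
by rewrite mulrA mulrDr (mulrCA c).
Qed.

Lemma is_wirtN F z d : is_wirt F z d -> is_wirt (fun z => - F z) z (- d).
Proof.
move=> h; have := is_wirtM (is_wirt_cst (-1) z) h; rewrite mul0r add0r mulN1r.
by under eq_fun do rewrite /cst mulN1r.
Qed.

Lemma is_wirtZ a F z d : is_wirt F z d -> is_wirt (fun z => a * F z) z (a * d).
Proof. by move=> h; have := is_wirtM (is_wirt_cst a z) h; rewrite mul0r add0r. Qed.

Lemma is_wirt_sum (I : Type) (s : seq I) (P : pred I) (F : I -> V -> C) z (d : I -> C) :
  (forall i, P i -> is_wirt (F i) z (d i)) ->
  is_wirt (fun z => \sum_(i <- s | P i) F i z) z (\sum_(i <- s | P i) d i).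
Proof.
move=> h; elim: s => [|i s IH].
  by rewrite big_nil; under eq_fun do rewrite big_nil; exact: is_wirt_cst.
rewrite big_cons; under eq_fun do rewrite big_cons.
by case Pi: (P i) => //; apply: is_wirtD IH; exact: h.
Qed.

Lemma is_wirt_prod (I : eqType) (s : seq I) (F : I -> V -> C) z (d : I -> C) : uniq s ->
  (forall i, is_wirt (F i) z (d i)) ->
  is_wirt (fun z => \prod_(i <- s) F i z) z
    (\sum_(i <- s) \prod_(j <- s) (if j == i then d j else F j z)).
Proof.
move=> + h; elim: s => [|i s IH] /=.
  by rewrite big_nil; under eq_fun do rewrite big_nil; move=> _; exact: is_wirt_cst.
move=> /andP[nis us]; under eq_fun do rewrite big_cons.
have := is_wirtM (h i) (IH us); congr is_wirt.
rewrite big_cons !big_cons eqxx; congr (_ * _ + _).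
  apply: eq_big_seq => j js; case: eqP => // ji.
  by rewrite -ji js in nis.
rewrite mulr_sumr; apply: eq_big_seq => j js.
by rewrite big_cons; case: eqP => // ij; rewrite ij js in nis.
Qed.

Lemma wirtJ F U z : CCk 1 U F -> z \in U ->
  wirt (fun z => Num.conj (F z)) z =
  Num.conj ((Cder v F z + Num.conj c * Cder w F z) / 2).
Proof.
move=> cF Uz; rewrite /wirt (is_cderE (is_cderJ (CCk_is_cder v cF Uz))).
rewrite (is_cderE (is_cderJ (CCk_is_cder w cF Uz))).
by rewrite rmorphM rmorphD /= rmorphM /= conjCK fmorphV rmorph_nat.
Qed.

End Wirt.

Fact wirt_comm_algebra (K : fieldType) (a b c d e f : K) :
  ((a + e * b) / 2 + f * ((c + e * d) / 2)) / 2 =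
  ((a + f * c) / 2 + e * ((b + f * d) / 2)) / 2.
Proof.
by rewrite !mulrA -!mulrDl; congr (_ / _ / _); ring.
Qed.

Lemma Cder_wirt U v w c x F z : CCk 2 U F -> open U -> z \in U ->
  Cder x (wirt v w c F) z = (Cder x (Cder v F) z + c * Cder x (Cder w F) z) / 2.
Proof.
move=> cF oU Uz.
have h1 := CCk_is_cder x (CCk_Cder v cF) Uz.
have h2 := CCk_is_cder x (CCk_Cder w cF) Uz.
exact: (is_cderE (is_cder_divr 2 (is_cderD h1 (is_cderZ c h2)))).
Qed.

(** Symmetry of second derivatives for the four pairs of directions; as [c] and [c'] are arbitrary,
    barred and unbarred derivatives are treated at once. *)
Lemma wirt_comm U v w c v' w' c' F z : open U -> CCk 2 U F -> z \in U ->
  wirt v w c (wirt v' w' c' F) z = wirt v' w' c' (wirt v w c F) z.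
Proof.
move=> oU cF Uz; rewrite [LHS]/wirt [RHS]/wirt !(Cder_wirt _ _ _ _ cF oU Uz).
rewrite (Cder_schwarz v v' oU cF Uz) (Cder_schwarz v w' oU cF Uz).
rewrite (Cder_schwarz w v' oU cF Uz) (Cder_schwarz w w' oU cF Uz).
exact: wirt_comm_algebra.
Qed.

End ComplexCalculus.

(** * Derivatives of determinants and of inverse matrices *)

Section MatrixCalculus.
Context {R : realType} {V : normedModType R}.
Implicit Types (U : set V) (z v w : V) (k : nat).
Local Notation C := R[i].

Definition CMk k U m q (M : V -> 'M[C]_(m, q)) := forall i j, CCk k U (fun z => M z i j).

Lemma CCk_det k U m (M : V -> 'M[C]_m) : open U -> CMk k U M -> CCk k U (fun z => \det (M z)).
Proof.
move=> oU cM; apply: CCk_sum => // s _; apply: CCkZ => //.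
by apply: CCk_prod => // i _; exact: cM.
Qed.

Lemma CMk_adj k U m (M : V -> 'M[C]_m) : open U -> CMk k U M -> CMk k U (fun z => \adj (M z)).
Proof.
move=> oU cM i j; apply: (@CCk_eq _ _ _ _ (fun z => cofactor (M z) j i)) => //.
  by move=> z _; rewrite mxE.
apply: CCkZ => //; apply: CCk_det => // a b.
apply: CCk_eq (cM (lift j a) (lift i b)) => // z _.
by rewrite !mxE.
Qed.

Lemma CMk_invmx k U m (M : V -> 'M[C]_m) : open U -> {in U, forall z, \det (M z) != 0} ->
  CMk k U M -> CMk k U (fun z => invmx (M z)).
Proof.
move=> oU nz cM i j.
have := CCkM oU (CCkV oU nz (CCk_det oU cM)) (CMk_adj oU cM i j).
by apply: (CCk_eq oU) => z Uz; rewrite /invmx unitmxE unitfE (nz z Uz) [RHS]mxE.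
Qed.

Section WirtMatrix.
Variables (v w : V) (c : C).

Definition is_mwirt m q (M : V -> 'M[C]_(m, q)) z (dM : 'M[C]_(m, q)) :=
  forall i j, is_wirt v w c (fun z => M z i j) z (dM i j).

(** Jacobi's formula: for fixed [i], the Leibniz sum is the determinant with row [i] taken from
    [dM], which is expanded along that row. *)
Lemma det_row_derivation m (M dM : 'M[C]_m) :
  \sum_(s : 'S_m) (-1) ^+ s *
    (\sum_i \prod_j (if j == i then dM j (s j) else M j (s j))) = \tr (\adj M *m dM).
Proof.
under eq_bigr do rewrite mulr_sumr.
rewrite exchange_big /= /mxtrace.
under [RHS]eq_bigr do rewrite mxE.
rewrite [RHS]exchange_big /=; apply: eq_bigr => i _.
pose M' := \matrix_(a, b) (if a == i then dM a b else M a b).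
transitivity (\det M').
  by apply: eq_bigr => s _; congr (_ * _); apply: eq_bigr => j _; rewrite mxE.
rewrite (expand_det_row _ i); apply: eq_bigr => j _.
rewrite !mxE eqxx mulrC; congr (_ * _); rewrite /cofactor; congr (_ * \det _).
by apply/matrixP => a b; rewrite !mxE eq_sym (negbTE (neq_lift _ _)).
Qed.

Lemma is_wirt_det m (M : V -> 'M[C]_m) z (dM : 'M[C]_m) : is_mwirt M z dM ->
  is_wirt v w c (fun z => \det (M z)) z (\tr (\adj (M z) *m dM)).
Proof.
move=> h; rewrite -det_row_derivation; apply: is_wirt_sum => s _; apply: is_wirtZ.
apply: (@is_wirt_prod _ _ v w c _ _ (fun i z => M z i (s i)) z (fun i => dM i (s i))).
  exact: index_enum_uniq.
by move=> i; exact: h.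
Qed.

Lemma is_mwirtM m q s (M : V -> 'M[C]_(m, q)) (L : V -> 'M[C]_(q, s)) z dM dL :
  is_mwirt M z dM -> is_mwirt L z dL ->
  is_mwirt (fun z => M z *m L z) z (dM *m L z + M z *m dL).
Proof.
move=> hM hL i j; rewrite !mxE -big_split /=; under eq_fun do rewrite mxE.
by apply: is_wirt_sum => a _; exact: is_wirtM.
Qed.

Lemma is_wirt_trace m (M : V -> 'M[C]_m) z dM : is_mwirt M z dM ->
  is_wirt v w c (fun z => \tr (M z)) z (\tr dM).
Proof. by move=> h; apply: is_wirt_sum => i _; exact: h. Qed.

Lemma is_wirt_near (F K : V -> C) z d : (\forall y \near z, F y = K y) ->
  is_wirt v w c F z d -> is_wirt v w c K z d.
Proof.
move=> e [dv [dw [[h1 h2] [h3 h4] ->]]]; exists dv, dw; split => //.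
  split; [have := h1|have := h2]; apply: near_eq_is_derive; apply: filterS e => y ->//.
split; [have := h3|have := h4]; apply: near_eq_is_derive; apply: filterS e => y ->//.
Qed.

Lemma is_wirt_uniq (F : V -> C) z d e : is_wirt v w c F z d -> is_wirt v w c F z e -> d = e.
Proof. by move=> /is_wirtE <- /is_wirtE <-. Qed.

(** Obtained by differentiating M M^-1 = 1; that the inverse is differentiable at all comes from the
    cofactor formula, through [CMk_invmx]. *)
Lemma is_mwirt_invmx U m (M : V -> 'M[C]_m) z dM : open U -> z \in U ->
  {in U, forall z, \det (M z) != 0} -> CMk 1 U M -> is_mwirt M z dM ->
  is_mwirt (fun z => invmx (M z)) z (- (invmx (M z) *m dM *m invmx (M z))).
Proof.
move=> oU Uz nz cM hM; have cI := CMk_invmx oU nz cM.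
pose X := \matrix_(i, j) wirt v w c (fun z => invmx (M z) i j) z.
have hX : is_mwirt (fun z => invmx (M z)) z X.
  by move=> i j; rewrite mxE; exact: CCk_is_wirt (cI i j) Uz.
have uM y : y \in U -> M y \in unitmx by move=> Uy; rewrite unitmxE unitfE nz.
have E : dM *m invmx (M z) + M z *m X = 0.
  apply/matrixP => i j; rewrite [RHS]mxE.
  apply: (is_wirt_uniq (is_mwirtM hM hX i j)).
  apply: (is_wirt_near (F := cst ((1%:M : 'M[C]_m) i j))); last exact: is_wirt_cst.
  by apply: filterS (near_in oU Uz) => y Uy; rewrite mulmxV ?uM.
suff -> : - (invmx (M z) *m dM *m invmx (M z)) = X by [].
rewrite -[RHS]mul1mx -(mulVmx (uM z Uz)) -[RHS]mulmxA.
have -> : M z *m X = - (dM *m invmx (M z)).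
  by apply/eqP; rewrite -addr_eq0 addrC E.
by rewrite mulmxN mulmxA.
Qed.

Lemma is_wirt_trace_inv U m (M L : V -> 'M[C]_m) z dM dL : open U -> z \in U ->
  {in U, forall z, \det (M z) != 0} -> CMk 1 U M -> is_mwirt M z dM -> is_mwirt L z dL ->
  is_wirt v w c (fun z => \tr (invmx (M z) *m L z)) z
    (\tr (invmx (M z) *m dL) - \tr (invmx (M z) *m dM *m (invmx (M z) *m L z))).
Proof.
move=> oU Uz nz cM hM hL.
have := is_wirt_trace (is_mwirtM (is_mwirt_invmx oU Uz nz cM hM) hL).
by rewrite mxtraceD mulNmx mxtraceN addrC !mulmxA.
Qed.

Lemma wirt_ln U (f : V -> R) z : open U -> Ck 1 U f -> z \in U -> 0 < f z ->
  wirt v w c (fun z => (ln (f z))%:C%C) z = wirt v w c (fun z => (f z)%:C%C) z / ((f z)%:C)%C.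
Proof.
move=> oU cf Uz fz.
have H x : Cder x (fun z => (ln (f z))%:C%C) z = Cder x (fun z => (f z)%:C%C) z / ((f z)%:C)%C.
  have d1 : is_derive z x (fun z => ln (f z)) ((f z)^-1 * 'D_x f z).
    apply: is_derive_comp1; last exact: Ck_is_derive cf Uz.
    exact: is_derive1_ln.
  have -> : Cder x (fun z => (f z)%:C%C) z = ('D_x f z)%:C%C.
    by rewrite /Cder; congr (_ +i* _)%C; exact: (derive_cst 0).
  have -> : ('D_x f z)%:C%C / ((f z)%:C)%C = ((f z)^-1 * 'D_x f z)%:C%C :> C.
    by rewrite mulrC rmorphM fmorphV.
  by apply: is_cderE; split => //=; exact: is_derive_cst.
by rewrite /wirt !H mulrA -mulrDl mulrAC.
Qed.

Lemma is_mwirt_block m1 m2 q1 q2 (M11 : V -> 'M[C]_(m1, q1)) (M12 : V -> 'M[C]_(m1, q2))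
    (M21 : V -> 'M[C]_(m2, q1)) (M22 : V -> 'M[C]_(m2, q2)) z d11 d12 d21 d22 :
  is_mwirt M11 z d11 -> is_mwirt M12 z d12 -> is_mwirt M21 z d21 -> is_mwirt M22 z d22 ->
  is_mwirt (fun z => block_mx (M11 z) (M12 z) (M21 z) (M22 z)) z (block_mx d11 d12 d21 d22).
Proof.
move=> h11 h12 h21 h22 i j; rewrite !mxE; under eq_fun do rewrite mxE.
case: (fintype.split i) => a; rewrite !mxE; under eq_fun do rewrite mxE.
  by case: (fintype.split j) => b.
by case: (fintype.split j) => b.
Qed.

Lemma is_mwirt_scalar (f : V -> C) z d : is_wirt v w c f z d ->
  is_mwirt (fun z => (f z)%:M : 'M[C]_1) z d%:M.
Proof.
by move=> h i j; rewrite !ord1 mxE; under eq_fun do rewrite mxE.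
Qed.

End WirtMatrix.

Lemma CMk_block k U m1 m2 q1 q2 (M11 : V -> 'M[C]_(m1, q1)) (M12 : V -> 'M[C]_(m1, q2))
    (M21 : V -> 'M[C]_(m2, q1)) (M22 : V -> 'M[C]_(m2, q2)) :
  CMk k U M11 -> CMk k U M12 -> CMk k U M21 -> CMk k U M22 ->
  CMk k U (fun z => block_mx (M11 z) (M12 z) (M21 z) (M22 z)).
Proof.
move=> h11 h12 h21 h22 i j; under eq_fun do rewrite mxE.
case: (fintype.split i) => a; under eq_fun do rewrite mxE.
  by case: (fintype.split j) => b.
by case: (fintype.split j) => b.
Qed.

End MatrixCalculus.

(** * The operator L_2 at a boundary point *)

Lemma trace_trmx_mul (K : pzSemiRingType) n (X Y : 'M[K]_n) :
  \tr (X^T *m Y) = \sum_k \sum_l X l k * Y l k.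
Proof.
by apply: eq_bigr => k _; rewrite mxE; apply: eq_bigr => l _; rewrite mxE.
Qed.

Lemma trace_row_col (K : pzSemiRingType) n (X Y : 'M[K]_n) k l :
  \tr (row l Y *m col k X) = (Y *m X) l k.
Proof. by rewrite /mxtrace big_ord1 -col_mulmx -row_mul !mxE. Qed.

Lemma trace_conj_form (K : numClosedFieldType) n (y : 'rV[K]_n) (X : 'M[K]_n) :
  \tr (y *m X^T *m adjmx y) = \tr (map_mx Num.conj y *m X *m adjmx (map_mx Num.conj y)).
Proof.
rewrite -mxtrace_tr !trmx_mul trmxK mulmxA; congr (\tr (_ *m _ *m _)).
  by apply/matrixP => i j; rewrite !mxE.
by apply/matrixP => i j; rewrite !mxE conjCK.
Qed.

Lemma trace_mul_trmx1 (K : pzSemiRingType) (a b : 'rV[K]_1) : \tr (a *m b^T) = a 0 0 * b 0 0.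
Proof. by rewrite /mxtrace big_ord1 mxE big_ord1 mxE. Qed.

Lemma Re_i (K : rcfType) : complex.Re ('i : K[i]) = 0.
Proof. by []. Qed.

Lemma Im_i (K : rcfType) : complex.Im ('i : K[i]) = 1.
Proof. by []. Qed.

Lemma conj_real (K : rcfType) (a : K) : Num.conj (a%:C%C) = a%:C%C.
Proof. by apply/eqP; rewrite eq_complex /= oppr0 !eqxx. Qed.

(** * Comparison of L_2 with the criterion as pure linear algebra *)

Section TensorInequality.
Context {R : realType} {n : nat}.
Local Notation C := R[i].
Variables (H S : 'M[C]_n) (p : 'cV[C]_n) (M : 'I_n -> 'M[C]_n) (F : 'I_n -> 'I_n -> 'M[C]_n).
Hypotheses (pH : posdef H) (p0 : p != 0) (symS : S^T = S).
Local Notation G := (invmx H).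
Local Notation p' := (adjmx p).
Local Notation N := (bnorm G p p').
Local Notation u := (bup G p').
Local Notation w := (bdown G p).
Local Notation A := (bcoef G p p').
Local Notation Nr := (complex.Re N).
Local Notation Re := complex.Re.

(* At a boundary point tensor_T k is the operator \tilde\Delta applied to r_k,
   tensor_L k is the k-th derivative of log J, and tensor_D k l its mixed second
   derivative in z_k and \bar z_l. *)
Definition tensor_T k : C := \tr (A *m M k).
Definition tensor_L k : C := N^-1 * (u *m S) 0 k + tensor_T k.
Definition tensor_Q k l : C :=
  \tr (A *m F k l) - \tr (G *m adjmx (M l) *m A *m M k).
Definition tensor_D k l : C := tensor_Q k l +
  N^-1 * \tr ((adjmx (col l S) - u *m adjmx (M l)) *m A *m (col k S - M k *m w)).

(** The derivatives of [r] at the point enter as free parameters: [p], [H] and [S] for orders one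
    and two, [M k] for r_{i \bar j k} and [F k l] for r_{i \bar j k \bar l}. *)
Definition L2_tensor : R :=
  1 + Nr / (n%:R * (n%:R + 1)) * Re (\sum_k \sum_l A l k * tensor_D k l)
    - 2 * Re (\sum_k u 0 k * tensor_L k) / (n%:R + 1)
    - Nr / (n%:R + 1) ^+ 2 * Re (\sum_k \sum_l A l k * tensor_L k * Num.conj (tensor_L l)).

Definition criterion_tensor : R :=
  n%:R - 1
  + Nr / n%:R * Re (\sum_k \sum_l A l k * (tensor_Q k l - tensor_T k * Num.conj (tensor_T l)))
  - 2 * Re (\sum_k u 0 k * tensor_T k).

Lemma real_of_pos (z : C) : 0 <= z -> z = (Re z)%:C%C.
Proof. by case: z => a b; rewrite lecE /= => /andP[/eqP -> _]. Qed.

Lemma Re_ge0 (z : C) : 0 <= z -> 0 <= Re z.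
Proof. by case: z => a b; rewrite lecE /= => /andP[_]. Qed.

Lemma Re_le (x y : C) : x <= y -> Re x <= Re y.
Proof. by case: x => a b; case: y => c d; rewrite lecE /= => /andP[_]. Qed.

Lemma Re_gt0 (z : C) : 0 < z -> 0 < Re z.
Proof. by case: z => a b; rewrite ltcE /= => /andP[_]. Qed.

Lemma Re_realM (a : R) (z : C) : Re (a%:C%C * z) = a * Re z.
Proof. by rewrite ReM /= mul0r subr0. Qed.

Lemma bnormE : N = Nr%:C%C.
Proof. exact/real_of_pos/ltW/bnorm_gt0. Qed.

Lemma Nr_gt0 : 0 < Nr. Proof. exact/Re_gt0/bnorm_gt0. Qed.

Lemma bnormVE : N^-1 = (Nr^-1)%:C%C. Proof. by rewrite {1}bnormE -fmorphV. Qed.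

Lemma bcoef_form (x : 'I_n -> C) :
  \sum_k \sum_l A l k * x k * Num.conj (x l) =
  \tr ((\row_l Num.conj (x l)) *m A *m adjmx (\row_l Num.conj (x l))).
Proof.
rewrite /mxtrace big_ord1 mxE; apply: eq_bigr => k _.
rewrite !mxE conjCK mulr_suml; apply: eq_bigr => l _; rewrite !mxE.
by rewrite mulrC mulrA.
Qed.

(** The sum is tr(A^T X^H A X), where X^H is the conjugate transpose and the columns of X are the
    vectors [col k S - M k *m w]; both A^T and A are semidefinite. *)
Lemma sqr_term_ge0 :
  0 <= \sum_k \sum_l A l k * \tr ((adjmx (col l S) - u *m adjmx (M l)) *m A *m (col k S - M k *m w)).
Proof.
pose X : 'M[C]_n := \matrix_(i, k) (col k S - M k *m w) i 0.
have cX k : col k X = col k S - M k *m w.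
  by apply/matrixP => i j; rewrite ord1 mxE mxE.
have rX l : row l (adjmx X) = adjmx (col l S) - u *m adjmx (M l).
  have -> : row l (adjmx X) = adjmx (col l X) by apply/matrixP => i j; rewrite !mxE.
  by rewrite cX adjmxB adjmxM (adj_bdown p pH).
have -> : \sum_k \sum_l A l k * \tr ((adjmx (col l S) - u *m adjmx (M l)) *m A *m (col k S - M k *m w)) =
    \tr (A^T *m (adjmx X *m A *m X)).
  rewrite trace_trmx_mul; apply: eq_bigr => k _; apply: eq_bigr => l _.
  by rewrite -rX -cX -row_mul trace_row_col.
apply: psd_trace_ge0; first exact: bcoef_psd.
by apply: psd_trmx; exact: bcoef_psd.
Qed.

(** The skeleton in real numbers: [q4] is the sum of the terms [tensor_Q], [tt], [ll] and [ss] are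
    the squared seminorms of [tensor_T], [tensor_L] and s, [us] is Re S(R, R), [ut] the linear term
    and [qst] the square. The bounds on [ll] and [ss] are [psd_split] and [convexity_inequality]. *)
Fact tensor_inequality_real (N0 n0 q4 tt ll ss us ut qst : R) : 0 < N0 -> 0 < n0 -> 0 <= qst ->
  ll <= (n0 + 1) * (N0^-1 ^+ 2 * ss) + (n0 + 1) / n0 * tt -> ss <= 2 * N0 - 2 * us ->
  n0 - 1 + N0 / n0 * (q4 - tt) - 2 * ut <=
  (n0 + 1) * (1 + N0 / (n0 * (n0 + 1)) * (q4 + N0^-1 * qst) - 2 * (N0^-1 * us + ut) / (n0 + 1)
    - N0 / (n0 + 1) ^+ 2 * ll).
Proof.
move=> N00 n00 q0 hl hs.
have n1 : 0 < n0 + 1 by rewrite ltr_wpDr// ltW.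
have -> : (n0 + 1) * (1 + N0 / (n0 * (n0 + 1)) * (q4 + N0^-1 * qst) - 2 * (N0^-1 * us + ut) / (n0 + 1)
    - N0 / (n0 + 1) ^+ 2 * ll) = n0 + 1 + N0 / n0 * q4 + qst / n0 - 2 * us / N0 - 2 * ut - N0 / (n0 + 1) * ll.
  by field; rewrite !gt_eqF.
have q1 : 0 <= qst / n0 by rewrite divr_ge0// ltW.
have hl' : N0 / (n0 + 1) * ll <= ss / N0 + N0 / n0 * tt.
  have c0 : 0 <= N0 / (n0 + 1) by rewrite divr_ge0// ltW.
  have := ler_wpM2l c0 hl.
  suff -> : N0 / (n0 + 1) * ((n0 + 1) * (N0^-1 ^+ 2 * ss) + (n0 + 1) / n0 * tt) = ss / N0 + N0 / n0 * tt by [].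
  by field; rewrite !gt_eqF.
have hs' : ss / N0 <= 2 - 2 * us / N0.
  by rewrite ler_pdivrMr// mulrBl -!mulrA mulVf ?gt_eqF// mulr1.
by move: (ss / N0) (2 * us / N0) hl' hs' => a b hl' hs'; lra.
Qed.

Hypothesis convex : forall v : 'rV[C]_n, \tr (v *m p) + Num.conj (\tr (v *m p)) = 0 ->
  0 <= tangential_form H S v.

Lemma criterion_le_L2_tensor : (0 < n)%N -> criterion_tensor <= (n%:R + 1) * L2_tensor.
Proof.
move=> n0.
pose t : 'rV[C]_n := \row_l Num.conj (tensor_T l).
pose s' : 'rV[C]_n := map_mx Num.conj (u *m S).
have Lrow : \row_l Num.conj (tensor_L l) = N^-1 *: s' + t.
  apply/matrixP => i j; rewrite [LHS]mxE rmorphD rmorphM /= [RHS]mxE [in RHS]mxE [t _ _]mxE.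
  by rewrite [s' _ _]mxE (ord1 i) bnormVE conj_real.
have n0R : 0 < n%:R :> C by rewrite ltr0n.
(* With weight n, the coefficient (n + 1) / n times N / (n + 1) equals N / n, the coefficient of the
   squared norm of [tensor_T] that has to be absorbed. *)
have := psd_split (N^-1 *: s') t (bcoef_psd pH p0) n0R.
rewrite -Lrow -bcoef_form => /Re_le; rewrite ReD.
set ss := \tr (s' *m A *m adjmx s').
have -> : \tr (N^-1 *: s' *m A *m adjmx (N^-1 *: s')) = ((Nr^-1) ^+ 2)%:C%C * ss.
  rewrite bnormVE adjmxZ -!scalemxAl -scalemxAr !mxtraceZ mulrA; congr (_ * _).
  by rewrite conj_real rmorphXn /= expr2.
rewrite -bcoef_form.
have cn : n%:R + 1 = (n%:R + 1)%:C%C :> C by rewrite rmorphD rmorph1 rmorph_nat.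
have cn2 : (n%:R + 1) / n%:R = ((n%:R + 1) / n%:R)%:C%C :> C.
  by rewrite rmorphM fmorphV rmorphD rmorph1 rmorph_nat.
rewrite cn2 cn !Re_realM => hl.
have hs : Re ss <= 2 * Nr - 2 * Re (\tr (u *m S *m u^T)).
  have := Re_le (convexity_inequality pH p0 symS convex).
  rewrite trace_conj_form -/ss.
  by rewrite !ReD !ReN ReJ mulr2n !mulrDl !mul1r opprD addrA.
have us : \sum_k u 0 k * (N^-1 * (u *m S) 0 k) = (Nr^-1)%:C%C * \tr (u *m S *m u^T).
  rewrite bnormVE /mxtrace big_ord1 mxE mulr_sumr; apply: eq_bigr => k _.
  by rewrite mulrCA [u^T _ _]mxE (mulrC (u 0 k)).
have EL : Re (\sum_k u 0 k * tensor_L k) = Nr^-1 * Re (\tr (u *m S *m u^T)) + Re (\sum_k u 0 k * tensor_T k).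
  by rewrite -Re_realM -us -ReD -big_split /=; congr Re; apply: eq_bigr => k _; rewrite mulrDr.
pose Qsum := \sum_k \sum_l A l k * tensor_Q k l.
have ED : Re (\sum_k \sum_l A l k * tensor_D k l) = Re Qsum + Nr^-1 * Re
  (\sum_k \sum_l A l k * \tr ((adjmx (col l S) - u *m adjmx (M l)) *m A *m (col k S - M k *m w))).
  rewrite -Re_realM -ReD mulr_sumr -big_split /=; congr Re; apply: eq_bigr => k _.
  rewrite mulr_sumr -big_split /=; apply: eq_bigr => l _.
  by rewrite /tensor_D mulrDr bnormVE (mulrCA _ (A l k)).
have EC : Re (\sum_k \sum_l A l k * (tensor_Q k l - tensor_T k * Num.conj (tensor_T l))) =
  Re Qsum - Re (\sum_k \sum_l A l k * tensor_T k * Num.conj (tensor_T l)).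
  rewrite -ReN -ReD -sumrN -big_split /=; congr Re; apply: eq_bigr => k _.
  by rewrite -sumrN -big_split /=; apply: eq_bigr => l _; rewrite mulrBr mulrA.
rewrite /criterion_tensor /L2_tensor EL ED EC.
apply: tensor_inequality_real hl hs; [exact: Nr_gt0|by rewrite ltr0n|].
exact/Re_ge0/sqr_term_ge0.
Qed.

End TensorInequality.

Section TensorDim1.
Context {R : realType}.
Local Notation C := R[i].
Variables (H S : 'M[C]_1) (p : 'cV[C]_1) (M : 'I_1 -> 'M[C]_1) (F : 'I_1 -> 'I_1 -> 'M[C]_1).
Hypotheses (pH : posdef H) (p0 : p != 0).
Local Notation G := (invmx H).
Local Notation p' := (adjmx p).
Local Notation u := (bup G p').
Local Notation Nr := (complex.Re (bnorm G p p')).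

(** A annihilates [p], which is here a nonzero scalar. *)
Lemma bcoef_dim1 : bcoef G p p' = 0.
Proof.
have := bcoef_p (G := G) (p := p) (p' := p') (bnorm_neq0 pH p0) => E.
have pE : p = (p 0 0)%:M by rewrite [LHS]mx11_scalar.
have p00 : p 0 0 != 0 by apply: contra_neq p0 => E0; rewrite pE E0 raddf0.
move: (bcoef G p p') E => X E; rewrite pE mul_mx_scalar in E; apply/eqP.
by move/eqP: E; rewrite scaler_eq0 (negbTE p00).
Qed.

Lemma L2_tensor_dim1 :
  L2_tensor H S p M F = 1 - complex.Re (\tr (u *m S *m u^T)) / Nr.
Proof.
rewrite /L2_tensor bcoef_dim1.
have -> : \sum_k \sum_l (0 : 'M[C]_1) l k * tensor_D H S p M F k l = 0.
  by rewrite big1// => k _; rewrite big1// => l _; rewrite mxE mul0r.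
have -> : \sum_k \sum_l (0 : 'M[C]_1) l k * tensor_L H S p M k * Num.conj (tensor_L H S p M l) = 0.
  by rewrite big1// => k _; rewrite big1// => l _; rewrite mxE !mul0r.
rewrite !mulr0 addr0 subr0 big_ord1 /tensor_L /tensor_T bcoef_dim1 mul0mx mxtrace0 addr0.
rewrite mulrCA (bnormVE pH p0) Re_realM (trace_mul_trmx1 (u *m S) u) (mulrC (u 0 0)).
by congr (1 - _); field; rewrite gt_eqF// (Nr_gt0 pH p0).
Qed.

(** The tangent line is the real line spanned by i u, because u p = N is real and positive. *)
Lemma tangential_form_dim1 (v : 'rV[C]_1) : \tr (v *m p) + Num.conj (\tr (v *m p)) = 0 ->
  exists t : R, v = (t%:C%C * 'i) *: u /\
   tangential_form H S v = (t ^+ 2 * (2 * Nr - 2 * complex.Re (\tr (u *m S *m u^T))))%:C%C.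
Proof.
move=> vp; pose y := complex.Im (\tr (v *m p)); exists (y / Nr).
have vpE : \tr (v *m p) = y%:C%C * 'i.
  apply: complex_eq; rewrite ?ReM ?ImM Re_i Im_i /= ?mulr0 ?mul0r ?mulr1 ?subr0 ?addr0 //.
  have := congr1 (fun x => complex.Re x) vp; rewrite ReD ReJ /= -mulr2n => /eqP.
  by rewrite mulrn_eq0 /= => /eqP.
have vE : v = ((y / Nr)%:C%C * 'i) *: u.
  have pE : p = (p 0 0)%:M by rewrite [LHS]mx11_scalar.
  have p00 : p 0 0 != 0 by apply: contra_neq p0 => E0; rewrite pE E0 raddf0.
  have h1 : v 0 0 * p 0 0 = y%:C%C * 'i by rewrite -vpE /mxtrace big_ord1 mxE big_ord1.
  have h2 : u 0 0 * p 0 0 = bnorm G p p'.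
    by rewrite /bnorm /mxtrace big_ord1 [RHS]mxE big_ord1.
  apply/matrixP => i j; rewrite !ord1 mxE; apply: (mulIf p00).
  rewrite h1 -[RHS]mulrA h2 (bnormE pH p0) [RHS]mulrAC -rmorphM /= divfK// gt_eqF//.
  exact: Nr_gt0 pH p0.
split=> //; rewrite /tangential_form vE; move: (y / Nr) => t.
have trZ (c : C) : \tr (c *: u *m S *m (c *: u)^T) = c ^+ 2 * \tr (u *m S *m u^T).
  have -> : (c *: u)^T = c *: u^T by apply/matrixP => i j; rewrite !mxE.
  by rewrite -!scalemxAl -scalemxAr !mxtraceZ mulrA.
rewrite trZ exprMn sqrCi mulrN1 -rmorphXn /= adjmxZ -!scalemxAl -scalemxAr !mxtraceZ.
have -> : \tr (u *m H *m adjmx u) = bnorm G p p'.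
  by rewrite (adj_bup p pH) (bup_mul p' (mulVmx (posdef_unit pH))) /bnorm mulmxA.
rewrite (bnormE pH p0) mulr2n; move: (\tr _) Nr => x N0.
by apply: complex_eq; rewrite !(ReD, ImD, ReN, ImN, ReM, ImM, ReJ, ImJ) Re_i Im_i /=; ring.
Qed.

End TensorDim1.

(** * Wirtinger derivatives of a defining function and its bordered matrix *)

Section WirtingerDerivatives.
Context {R : realType} {n : nat}.
Local Notation V := (Cn R n).
Local Notation C := R[i].
Implicit Types (U : set V) (F K : V -> C) (z : V) (i j k l : 'I_n).

Definition ex i : V := (delta_mx 0 i, 0).
Definition ey i : V := (0, delta_mx 0 i).

Lemma dzE i F : dz i F = wirt (ex i) (ey i) (- 'i) F.
Proof. by apply/funext => z; rewrite /dz /wirt mulNr. Qed.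

Lemma dzbE i F : dzb i F = wirt (ex i) (ey i) 'i F.
Proof. by []. Qed.

Lemma CCk_dz m U i F : open U -> CCk m.+1 U F -> CCk m U (dz i F).
Proof. by move=> oU cF; rewrite dzE; exact: CCk_wirt. Qed.

Lemma CCk_dzb m U i F : open U -> CCk m.+1 U F -> CCk m U (dzb i F).
Proof. by move=> oU cF; rewrite dzbE; exact: CCk_wirt. Qed.

Lemma dz_in U i F K z : open U -> {in U, F =1 K} -> z \in U -> dz i F z = dz i K z.
Proof.
move=> oU e Uz; rewrite !dzE; apply: wirt_near; apply: filterS (near_in oU Uz) => y.
exact: e.
Qed.

Lemma dzb_in U i F K z : open U -> {in U, F =1 K} -> z \in U -> dzb i F z = dzb i K z.
Proof.
move=> oU e Uz; rewrite !dzbE; apply: wirt_near; apply: filterS (near_in oU Uz) => y.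
exact: e.
Qed.

Lemma dz_dzb U i j F z : open U -> CCk 2 U F -> z \in U -> dz i (dzb j F) z = dzb j (dz i F) z.
Proof. by move=> oU cF Uz; rewrite !dzE !dzbE; exact: wirt_comm oU cF Uz. Qed.

Lemma dz_dz U i j F z : open U -> CCk 2 U F -> z \in U -> dz i (dz j F) z = dz j (dz i F) z.
Proof. by move=> oU cF Uz; rewrite !dzE; exact: wirt_comm oU cF Uz. Qed.

Lemma dzb_dzb U i j F z : open U -> CCk 2 U F -> z \in U -> dzb i (dzb j F) z = dzb j (dzb i F) z.
Proof. by move=> oU cF Uz; rewrite !dzbE; exact: wirt_comm oU cF Uz. Qed.

Lemma dzJ U i F z : CCk 1 U F -> z \in U ->
  dz i (fun y => Num.conj (F y)) z = Num.conj (dzb i F z).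
Proof. by move=> cF Uz; rewrite dzE (wirtJ _ _ _ cF Uz) rmorphN /= conjCi opprK. Qed.

Lemma dzbJ U i F z : CCk 1 U F -> z \in U ->
  dzb i (fun y => Num.conj (F y)) z = Num.conj (dz i F z).
Proof. by move=> cF Uz; rewrite dzbE (wirtJ _ _ _ cF Uz) conjCi dzE. Qed.

End WirtingerDerivatives.

Section DefiningFunctionTensors.
Context {R : realType} {n : nat}.
Local Notation V := (Cn R n).
Local Notation C := R[i].
Variables (U : set V) (r : V -> R).
Hypotheses (oU : open U) (cr : Ck 4 U r).
Implicit Types (z : V) (i j k l : 'I_n).
Local Notation rC := (fun z : V => (r z)%:C%C).

Let c4 : CCk 4 U rC. Proof. exact: CCk_real. Qed.
Let c3 i : CCk 3 U (r_i r i). Proof. exact: (CCk_dz i oU c4). Qed.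
Let c3b j : CCk 3 U (r_jb r j). Proof. exact: (CCk_dzb j oU c4). Qed.
Let c2 i j : CCk 2 U (r_ijb r i j). Proof. exact: (CCk_dzb j oU (c3 i)). Qed.
Let c2s i j : CCk 2 U (dz i (r_i r j)). Proof. exact: (CCk_dz i oU (c3 j)). Qed.
Let c4_1 : CCk 1 U rC. Proof. exact: (CCk_le (isT : (1 <= 4)%N) c4). Qed.
Let c4_2 : CCk 2 U rC. Proof. exact: (CCk_le (isT : (2 <= 4)%N) c4). Qed.
Let c3_1 i : CCk 1 U (r_i r i). Proof. exact: (CCk_le (isT : (1 <= 3)%N) (c3 i)). Qed.
Let c3_2 i : CCk 2 U (r_i r i). Proof. exact: CCkW (c3 i). Qed.
Let c3b_1 i : CCk 1 U (r_jb r i). Proof. exact: (CCk_le (isT : (1 <= 3)%N) (c3b i)). Qed.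
Let c2_1 i j : CCk 1 U (r_ijb r i j). Proof. exact: CCkW (c2 i j). Qed.
Let c2s_1 i j : CCk 1 U (dz i (r_i r j)). Proof. exact: CCkW (c2s i j). Qed.
Let c1 i j k : CCk 1 U (r_ijbk r i j k). Proof. exact: (CCk_dz k oU (c2 i j)). Qed.

Lemma r_jbE j z : z \in U -> r_jb r j z = Num.conj (r_i r j z).
Proof.
move=> Uz; rewrite -(dzbJ _ c4_1 Uz).
by apply: (@dzb_in _ _ U _ _ _ z oU _ Uz) => y _; rewrite conj_real.
Qed.

Lemma r_ijb_dz i j z : z \in U -> dz i (r_jb r j) z = r_ijb r i j z.
Proof. by move=> Uz; exact: (dz_dzb i j oU c4_2 Uz). Qed.

Lemma r_ijb_conj i j z : z \in U -> Num.conj (r_ijb r i j z) = r_ijb r j i z.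
Proof.
move=> Uz; rewrite -(dzJ _ (c3_1 i) Uz).
rewrite -(r_ijb_dz j i Uz); apply: (@dz_in _ _ U _ _ _ z oU _ Uz) => y Uy.
by rewrite (r_jbE i Uy).
Qed.

Lemma dzb_r_jb j l z : z \in U -> dzb l (r_jb r j) z = Num.conj (dz l (r_i r j) z).
Proof.
move=> Uz; rewrite -(dzbJ _ (c3_1 j) Uz).
by apply: (@dzb_in _ _ U _ _ _ z oU _ Uz) => y Uy; rewrite (r_jbE j Uy).
Qed.

Lemma dz_r_i_sym i k z : z \in U -> dz k (r_i r i) z = dz i (r_i r k) z.
Proof. by move=> Uz; exact: (dz_dz k i oU c4_2 Uz). Qed.

Lemma r_ijblb_conj i j l z : z \in U -> Num.conj (r_ijbk r j i l z) = r_ijblb r i j l z.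
Proof.
move=> Uz; rewrite -(dzbJ _ (c2_1 j i) Uz).
by apply: (@dzb_in _ _ U _ _ _ z oU _ Uz) => y Uy; rewrite (r_ijb_conj j i Uy).
Qed.

Lemma dzb_dz_r_i i k l z : z \in U -> dzb l (dz k (r_i r i)) z = r_ijbk r i l k z.
Proof. by move=> Uz; rewrite -(dz_dzb k l oU (c3_2 i) Uz). Qed.

Lemma r_ijbk_laplace i j k z : z \in U -> dzb j (dz i (r_i r k)) z = r_ijbk r i j k z.
Proof.
move=> Uz; rewrite -(dzb_dz_r_i i k j Uz); apply: (@dzb_in _ _ U _ _ _ z oU _ Uz) => y Uy.
exact: (dz_r_i_sym k i Uy).
Qed.

Lemma r_ijblb_laplace i j l z : z \in U -> dzb j (dz i (r_jb r l)) z = r_ijblb r i j l z.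
Proof.
move=> Uz; apply: etrans (dzb_dzb j l oU (c3_2 i) Uz).
apply: (@dzb_in _ _ U _ _ _ z oU _ Uz) => y Uy; exact: (r_ijb_dz i l Uy).
Qed.

(** Derivatives are exchanged two neighbours at a time, always on a function of class C^2; class C^4
    of [r] is just enough for the exchange of the two barred ones. *)
Lemma fourth_laplace i j k l z : z \in U ->
  dzb j (dz i (r_ijb r k l)) z = dzb l (r_ijbk r i j k) z.
Proof.
move=> Uz.
have e1 : {in U, dz i (r_ijb r k l) =1 dzb l (dz i (r_i r k))}.
  by move=> y Uy; exact: (dz_dzb i l oU (c3_2 k) Uy).
rewrite (dzb_in j oU e1 Uz) (dzb_dzb j l oU (c2s i k) Uz).
apply: (@dzb_in _ _ U _ _ _ z oU _ Uz) => y Uy.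
exact: (r_ijbk_laplace i j k Uy).
Qed.

Definition gradT z : 'cV[C]_n := \col_i r_i r i z.
Definition symT z : 'M[C]_n := \matrix_(i, k) dz k (r_i r i) z.
Definition thirdT z k : 'M[C]_n := \matrix_(i, j) r_ijbk r i j k z.
Definition fourthT z k l : 'M[C]_n := \matrix_(i, j) dzb l (r_ijbk r i j k) z.

Lemma adj_gradT z : z \in U -> adjmx (gradT z) = \row_j r_jb r j z.
Proof. by move=> Uz; apply/matrixP => i j; rewrite !mxE r_jbE. Qed.

Lemma adj_hessian z : z \in U -> adjmx (hessian r z) = hessian r z.
Proof. by move=> Uz; apply/matrixP => i j; rewrite !mxE (r_ijb_conj j i Uz). Qed.

Lemma trmx_symT z : z \in U -> (symT z)^T = symT z.
Proof. by move=> Uz; apply/matrixP => i j; rewrite !mxE; exact: (dz_r_i_sym j i Uz). Qed.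

Lemma adj_thirdT z l : z \in U -> adjmx (thirdT z l) = \matrix_(i, j) r_ijblb r i j l z.
Proof. by move=> Uz; apply/matrixP => i j; rewrite !mxE; exact: (r_ijblb_conj i j l Uz). Qed.

Lemma adj_col_symT z l : z \in U -> adjmx (col l (symT z)) = \row_j dzb l (r_jb r j) z.
Proof. by move=> Uz; apply/matrixP => i j; rewrite !mxE; exact/esym/(dzb_r_jb j l Uz). Qed.

Definition bordered z : 'M[C]_(1 + n) :=
  block_mx ((r z)%:C%C)%:M (\row_j r_jb r j z) (\col_i r_i r i z) (hessian r z).

Definition bordered_dz z k : 'M[C]_(1 + n) :=
  block_mx (r_i r k z)%:M (\row_j r_ijb r k j z) (\col_i dz k (r_i r i) z) (thirdT z k).

Definition bordered_dzb z l : 'M[C]_(1 + n) :=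
  block_mx (r_jb r l z)%:M (\row_j dzb l (r_jb r j) z) (\col_i r_ijb r i l z)
    (\matrix_(i, j) r_ijblb r i j l z).

Definition bordered_dzdzb z k l : 'M[C]_(1 + n) :=
  block_mx (r_ijb r k l z)%:M (\row_j r_ijblb r k j l z) (\col_i r_ijbk r i l k z)
    (fourthT z k l).

Lemma CMk_bordered : CMk 2 U bordered.
Proof.
apply: CMk_block => i j.
- rewrite !ord1; apply: (CCk_eq oU (F := rC)); last exact: c4_2.
  by move=> z _; rewrite mxE.
- apply: (CCk_eq oU (F := r_jb r j)); last exact: CCkW (c3b j).
  by move=> z _; rewrite mxE.
- apply: (CCk_eq oU (F := r_i r i)); last exact: CCkW (c3 i).
  by move=> z _; rewrite mxE.
- apply: (CCk_eq oU (F := r_ijb r i j)); last exact: c2.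
  by move=> z _; rewrite mxE.
Qed.

Lemma is_wirt_dz F z k : CCk 1 U F -> z \in U ->
  is_wirt (ex k) (ey k) (- 'i) F z (dz k F z).
Proof. by move=> cF Uz; rewrite dzE; exact: CCk_is_wirt cF Uz. Qed.

Lemma is_wirt_dzb F z k : CCk 1 U F -> z \in U ->
  is_wirt (ex k) (ey k) 'i F z (dzb k F z).
Proof. by move=> cF Uz; rewrite dzbE; exact: CCk_is_wirt cF Uz. Qed.

Lemma is_mwirt_bordered_dz z k : z \in U ->
  is_mwirt (ex k) (ey k) (- 'i) bordered z (bordered_dz z k).
Proof.
move=> Uz; apply: is_mwirt_block.
- by apply: is_mwirt_scalar; exact: is_wirt_dz c4_1 Uz.
- move=> i j; rewrite mxE; under eq_fun do rewrite mxE.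
  rewrite -(r_ijb_dz k j Uz); exact: is_wirt_dz (c3b_1 j) Uz.
- move=> i j; rewrite mxE; under eq_fun do rewrite mxE.
  by exact: is_wirt_dz (c3_1 i) Uz.
- move=> i j; rewrite mxE; under eq_fun do rewrite mxE.
  by exact: is_wirt_dz (c2_1 i j) Uz.
Qed.

Lemma is_mwirt_bordered_dzb z l : z \in U ->
  is_mwirt (ex l) (ey l) 'i bordered z (bordered_dzb z l).
Proof.
move=> Uz; apply: is_mwirt_block.
- by apply: is_mwirt_scalar; exact: is_wirt_dzb c4_1 Uz.
- move=> i j; rewrite mxE; under eq_fun do rewrite mxE.
  by exact: is_wirt_dzb (c3b_1 j) Uz.
- move=> i j; rewrite mxE; under eq_fun do rewrite mxE.
  by exact: is_wirt_dzb (c3_1 i) Uz.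
- move=> i j; rewrite mxE; under eq_fun do rewrite mxE.
  by exact: is_wirt_dzb (c2_1 i j) Uz.
Qed.

Lemma is_mwirt_bordered_dzdzb z k l : z \in U ->
  is_mwirt (ex l) (ey l) 'i (bordered_dz^~ k) z (bordered_dzdzb z k l).
Proof.
move=> Uz; apply: is_mwirt_block.
- by apply: is_mwirt_scalar; exact: is_wirt_dzb (c3_1 k) Uz.
- move=> i j; rewrite mxE; under eq_fun do rewrite mxE.
  by exact: is_wirt_dzb (c2_1 k j) Uz.
- move=> i j; rewrite mxE; under eq_fun do rewrite mxE.
  rewrite -(dzb_dz_r_i i k l Uz); exact: is_wirt_dzb (c2s_1 k i) Uz.
- move=> i j; rewrite mxE; under eq_fun do rewrite mxE.
  exact: is_wirt_dzb (c1 i j k) Uz.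
Qed.

Lemma det_adjmx m (X : 'M[C]_m) : \det (adjmx X) = Num.conj (\det X).
Proof. by rewrite /adjmx det_map_mx det_tr. Qed.

(** The bordered matrix is Hermitian on [U], so the real part taken in [feffermanJ] loses
    nothing. *)
Lemma feffermanJE z : z \in U -> - \det (bordered z) = ((feffermanJ r z)%:C)%C.
Proof.
move=> Uz; have adjB : adjmx (bordered z) = bordered z.
  rewrite /adjmx tr_block_mx map_block_mx; congr block_mx.
  - by rewrite tr_scalar_mx map_scalar_mx /= conj_real.
  - by apply/matrixP => i j; rewrite !mxE (r_jbE j Uz).
  - by apply/matrixP => i j; rewrite !mxE (r_jbE i Uz) conjCK.
  - exact: (adj_hessian Uz).
have := det_adjmx (bordered z); rewrite adjB /feffermanJ.
rewrite -[block_mx _ _ _ _]/(bordered z); case: (\det (bordered z)) => a b /=.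
move=> [] /eqP; rewrite -subr_eq0 opprK -mulr2n mulrn_eq0 /= => /eqP ->.
by apply: complex_eq => //=; rewrite oppr0.
Qed.

End DefiningFunctionTensors.

Fact cancel_common_summand (K : comPzRingType) (a b c d : K) : a + b - (a + c - d) = b - c + d.
Proof. by ring. Qed.

(** * Evaluation of log J, of L_2 and of the criterion at a boundary point *)

Section BoundaryFormula.
Context {R : realType} {n : nat}.
Local Notation V := (Cn R n).
Local Notation C := R[i].
Variables (U : set V) (r : V -> R) (z0 : V).
Hypotheses (oU : open U) (cr : Ck 4 U r) (Uz0 : z0 \in U) (rz0 : r z0 = 0).
Local Notation H := (hessian r z0).
Local Notation p := (gradT r z0).
Hypotheses (pH : posdef H) (p0 : p != 0).
Implicit Types (z : V) (i j k l : 'I_n).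
Local Notation G := (invmx H).
Local Notation p' := (adjmx p).
Local Notation N := (bnorm G p p').
Local Notation u := (bup G p').
Local Notation w := (bdown G p).
Local Notation A := (bcoef G p p').
Local Notation S := (symT r z0).
Local Notation M := (thirdT r z0).
Local Notation F := (fourthT r z0).
Local Notation B := (bordered r).

Let HG : H *m G = 1%:M. Proof. by rewrite mulmxV// posdef_unit. Qed.
Let GH : G *m H = 1%:M. Proof. by rewrite mulVmx// posdef_unit. Qed.
Let N0 : N != 0. Proof. exact: bnorm_neq0. Qed.

Lemma borderedE : B z0 = block_mx 0 p' p H.
Proof.
rewrite /bordered rz0 (adj_gradT oU cr Uz0); congr block_mx.
by rewrite raddf0.
Qed.

Lemma inv_bordered : invmx (B z0) = bordered_inv G p p'.
Proof.
have E : B z0 *m bordered_inv G p p' = 1%:M by rewrite borderedE mul_bordered_inv.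
have [uB _] := mulmx1_unit E.
by rewrite -[RHS]mul1mx -(mulVmx uB) -mulmxA E mulmx1.
Qed.

(** Column elimination with [w] clears [p], since H w = p, and leaves - N in the corner. *)
Lemma det_bordered : - \det (B z0) = N * \det H.
Proof.
have E : B z0 *m block_mx 1%:M 0 (- w) 1%:M = block_mx (- N)%:M p' 0 H.
  rewrite borderedE mulmx_block !mul0mx !mulmx1 !add0r !mulmx0 !add0r.
  rewrite !mulmxN (mul_bdown p HG) subrr (p'_bdown G p p') raddfN //.
have := congr1 determinant E; rewrite det_mulmx det_lblock !det1 !mulr1 => ->.
by rewrite det_ublock det_scalar expr1 mulNr opprK.
Qed.

Lemma feffermanJ_gt0 : 0 < feffermanJ r z0.
Proof.
have : 0 < ((feffermanJ r z0)%:C)%C.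
  rewrite -(feffermanJE oU cr Uz0) det_bordered mulr_gt0//; first exact: bnorm_gt0.
  exact: posdef_det_gt0.
by rewrite ltcR.
Qed.

Lemma feffermanJ_Ck : Ck 2 U (feffermanJ r).
Proof.
have [h _] := CCkN oU (CCk_det oU (CMk_bordered oU cr)).
exact: h.
Qed.

(** Two derivatives of log J are taken, so positivity of J is needed around [z0] and not only at
    it. *)
Lemma positive_nbhs : exists W, [/\ open W, W `<=` U, z0 \in W &
  {in W, forall z, 0 < feffermanJ r z}].
Proof.
have [d d0 Hd] := Ck_ball oU feffermanJ_Ck Uz0 feffermanJ_gt0.
exists (ball z0 d); split.
- exact: ball_open.
- move=> z; rewrite -ball_normE /= distrC => /Hd[/set_mem]; exact.
- by apply/mem_set; exact: ballxx.
- move=> z /set_mem; rewrite -ball_normE /= distrC => /Hd[_].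
  by rewrite ltr_norml => /andP[+ _]; rewrite ltrBrDr addNr.
Qed.

Section LogDerivative.
Variables (v w' : V) (c : C).

Lemma wirt_log_J W z dB : open W -> W `<=` U -> {in W, forall z, 0 < feffermanJ r z} ->
  z \in W -> is_mwirt v w' c B z dB ->
  wirt v w' c (log_J r) z = \tr (invmx (B z) *m dB).
Proof.
move=> oW WU J0 Wz dBz; have Uz : z \in U by apply/mem_set/WU/set_mem.
have cJ : Ck 1 U (feffermanJ r) := CkW feffermanJ_Ck.
rewrite /log_J (wirt_ln v w' c oU cJ Uz (J0 z Wz)).
have dnz : \det (B z) != 0.
  have : ((feffermanJ r z)%:C)%C != 0 :> C by rewrite eq_complex /= negb_and gt_eqF// J0.
  by rewrite -(feffermanJE oU cr Uz) oppr_eq0.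
have -> : wirt v w' c (fun z => (feffermanJ r z)%:C%C) z = - \tr (\adj (B z) *m dB).
  apply: is_wirtE; have := is_wirtN (is_wirt_det dBz).
  apply: is_wirt_near; apply: filterS (near_in oU Uz) => y Uy.
  exact: (feffermanJE oU cr Uy).
rewrite -(feffermanJE oU cr Uz) invrN mulrNN /invmx unitmxE unitfE dnz.
by rewrite -scalemxAl mxtraceZ mulrC.
Qed.

End LogDerivative.

Lemma dz_log_J k : dz k (log_J r) z0 = tensor_L H S p M k.
Proof.
have [W [oW WU Wz J0]] := positive_nbhs.
rewrite dzE (wirt_log_J oW WU J0 Wz (is_mwirt_bordered_dz oU cr k Uz0)).
rewrite inv_bordered trace_bordered_inv /tensor_L /tensor_T; congr (_ * _ + _).
have -> : \row_j r_ijb r k j z0 = row k H by apply/matrixP => i j; rewrite !mxE.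
(* As H w = p, this term cancels the corner entry r_k. *)
have -> : \tr (row k H *m w) = r_i r k z0.
  by rewrite -row_mul (mul_bdown p HG) /mxtrace big_ord1 !mxE.
rewrite addrK.
have -> : \col_i dz k (r_i r i) z0 = col k S by apply/matrixP => i j; rewrite !mxE.
by rewrite -col_mulmx /mxtrace big_ord1 mxE.
Qed.

Lemma log_J_Ck W : open W -> W `<=` U -> {in W, forall z, 0 < feffermanJ r z} ->
  CCk 2 W (log_J r).
Proof.
move=> oW WU J0; apply: CCk_real => //; apply: Ck_ln => //.
exact: Ck_subset WU feffermanJ_Ck.
Qed.

Lemma dzb_log_J k : dzb k (log_J r) z0 = Num.conj (tensor_L H S p M k).
Proof.
have [W [oW WU Wz J0]] := positive_nbhs.
rewrite -dz_log_J -(dzbJ _ (CCkW (log_J_Ck oW WU J0)) Wz).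
have -> // : (fun y => Num.conj (log_J r y)) = log_J r.
by apply/funext => z; rewrite /log_J conj_real.
Qed.

(** The trace formula for the first derivative is differentiated on a neighbourhood, where [r] does
    not vanish identically; the explicit inverse of the bordered matrix is inserted only afterwards,
    at [z0]. *)
Lemma dzb_dz_log_J k l : dzb l (dz k (log_J r)) z0 = tensor_D H S p M F k l.
Proof.
have [W [oW WU Wz J0]] := positive_nbhs.
have WinU z : z \in W -> z \in U by move=> /set_mem/WU/mem_set.
have E : {in W, dz k (log_J r) =1 (fun z => \tr (invmx (B z) *m bordered_dz r z k))}.
  by move=> z Wz'; rewrite dzE (wirt_log_J oW WU J0 Wz' (is_mwirt_bordered_dz oU cr k (WinU z Wz'))).
rewrite (dzb_in l oW E Wz) dzbE.
have nz : {in W, forall z, \det (B z) != 0}.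
  move=> z Wz'; have : ((feffermanJ r z)%:C)%C != 0 :> C by rewrite eq_complex /= negb_and gt_eqF// J0.
  by rewrite -(feffermanJE oU cr (WinU z Wz')) oppr_eq0.
have cB : CMk 1 W B by move=> i j; apply: (CCk_subset WU); apply: CCkW; exact: (CMk_bordered oU cr).
rewrite (is_wirtE (is_wirt_trace_inv oW Wz nz cB (is_mwirt_bordered_dzb oU cr l Uz0)
  (is_mwirt_bordered_dzdzb oU cr k l Uz0))).
rewrite inv_bordered trace_bordered_inv /tensor_D /tensor_Q.
have -> : bordered_dzb r z0 l = block_mx (p' 0 l)%:M (adjmx (col l S)) (col l H) (adjmx (M l)).
  rewrite /bordered_dzb (adj_col_symT oU cr l Uz0) (adj_thirdT oU cr l Uz0).
  congr block_mx; first by rewrite (adj_gradT oU cr Uz0) mxE.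
  by apply/matrixP => i j; rewrite !mxE.
have -> : bordered_dz r z0 k = block_mx (p k 0)%:M (row k H) (col k S) (M k).
  rewrite /bordered_dz; congr block_mx; first by rewrite mxE.
    by apply/matrixP => i j; rewrite !mxE.
  by apply/matrixP => i j; rewrite !mxE.
rewrite (@trace_bordered_inv2 _ _ H G p p' GH HG).
have -> : \tr (u *m \col_i r_ijbk r i l k z0) = (u *m M k) 0 l.
  have -> : \col_i r_ijbk r i l k z0 = col l (M k) by apply/matrixP => i j; rewrite !mxE.
  by rewrite -col_mulmx /mxtrace big_ord1 mxE.
have -> : \tr (\row_j r_ijblb r k j l z0 *m w) = (adjmx (M l) *m w) k 0.
  have -> : \row_j r_ijblb r k j l z0 = row k (adjmx (M l)).
    by rewrite (adj_thirdT oU cr l Uz0); apply/matrixP => i j; rewrite !mxE.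
  by rewrite -row_mul /mxtrace big_ord1 mxE.
have -> : r_ijb r k l z0 = H k l by rewrite mxE.
exact: cancel_common_summand.
Qed.

Lemma rupE i : rup r i z0 = u 0 i.
Proof.
rewrite /bup mxE; apply: eq_bigr => j _.
by rewrite /rinv mxE (adj_gradT oU cr Uz0) mxE mulrC.
Qed.

Lemma rupbE j : rupb r j z0 = w j 0.
Proof. by rewrite /bdown mxE; apply: eq_bigr => i _; rewrite /rinv !mxE. Qed.

Lemma dr_norm2E : dr_norm2 r z0 = complex.Re N.
Proof.
rewrite /dr_norm2 /bnorm -mulmxA -/(bdown G p) /mxtrace big_ord1 mxE exchange_big /=.
congr complex.Re; apply: eq_bigr => j _; rewrite -rupbE /rupb mulr_sumr.
by apply: eq_bigr => i _; rewrite (adj_gradT oU cr Uz0) mxE mulrC.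
Qed.

Lemma acoefE i j : acoef r i j z0 = A j i.
Proof.
have -> : A j i = G j i - N^-1 * (w j 0 * u 0 i).
  by rewrite /bcoef; move: w u => w1 u1; rewrite !mxE big_ord1.
rewrite /acoef rz0 oppr0 add0r rupE rupbE dr_norm2E -(bnormE pH p0) /rinv mxE.
by congr (_ - _); rewrite mulrC (mulrC (u 0 i)).
Qed.

Lemma L2E : L2 r z0 = L2_tensor H S p M F.
Proof.
rewrite /L2 /L2_tensor dr_norm2E /tlaplace /Rfield /tgrad_norm2.
congr (1 + _ * complex.Re _ - 2 * complex.Re _ / _ - _ * complex.Re _).
- by apply: eq_bigr => k _; apply: eq_bigr => l _; rewrite acoefE dzb_dz_log_J.
- by apply: eq_bigr => k _; rewrite rupE dz_log_J.
- by apply: eq_bigr => k _; apply: eq_bigr => l _; rewrite acoefE dz_log_J dzb_log_J.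
Qed.

Lemma trace_acoef (X : 'M[C]_n) : \tr (A *m X) = \sum_i \sum_j acoef r i j z0 * X i j.
Proof.
rewrite mxtrace_mulC; apply: eq_bigr => i _; rewrite mxE; apply: eq_bigr => j _.
by rewrite acoefE mulrC.
Qed.

Lemma tlaplace_r_i k : tlaplace r (r_i r k) z0 = tensor_T H p M k.
Proof.
rewrite /tensor_T trace_acoef; apply: eq_bigr => i _; apply: eq_bigr => j _.
by rewrite (r_ijbk_laplace oU cr i j k Uz0) mxE.
Qed.

Lemma tlaplace_r_jb l : tlaplace r (r_jb r l) z0 = Num.conj (tensor_T H p M l).
Proof.
rewrite /tensor_T -trace_adjmx adjmxM (adj_bcoef pH p0) mxtrace_mulC trace_acoef.
apply: eq_bigr => i _; apply: eq_bigr => j _.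
by rewrite (r_ijblb_laplace oU cr i j l Uz0) (adj_thirdT oU cr l Uz0) mxE.
Qed.

Lemma cubic_termE k l :
  \sum_i \sum_q \sum_p1 \sum_j acoef r i q z0 * rinv r p1 j z0 * r_ijbk r i j k z0 * r_ijblb r p1 q l z0
  = \tr (G *m adjmx (M l) *m A *m M k).
Proof.
rewrite -mulmxA mxtrace_mulC -mulmxA trace_acoef; apply: eq_bigr => i _; apply: eq_bigr => q _.
rewrite mxE exchange_big mulr_sumr /=; apply: eq_bigr => j _.
rewrite [(G *m _) j q]mxE mulr_sumr mulr_sumr; apply: eq_bigr => p1 _.
rewrite (adj_thirdT oU cr l Uz0) [(\matrix_(_, _) _) p1 q]mxE [M k i j]mxE /rinv [G^T _ _]mxE.
by rewrite -mulrA -mulrA [X in _ * X]mulrCA.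
Qed.

Lemma convex_criterionE : convex_criterion r z0 = criterion_tensor H p M F.
Proof.
rewrite /convex_criterion /criterion_tensor dr_norm2E.
congr (_ - 1 + _ * complex.Re _ - 2 * complex.Re _).
- apply: eq_bigr => k _; apply: eq_bigr => l _.
  rewrite acoefE tlaplace_r_i tlaplace_r_jb cubic_termE; congr (_ * (_ - _ - _)).
  rewrite trace_acoef; apply: eq_bigr => i _; apply: eq_bigr => j _.
  by rewrite (fourth_laplace oU cr i j k l Uz0) mxE.
- by apply: eq_bigr => k _; rewrite rupE tlaplace_r_i.
Qed.

End BoundaryFormula.

Fact hermitian_regroup (K : comPzRingType) (e e' a b d d' : K) :
  e * (d + b) + e' * (a + d') = e * d + e' * d' + (e' * a + e * b).
Proof. by ring. Qed.

(** * The real Hessian in complex coordinates *)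

Section RealHessian.
Context {R : realType} {n : nat}.
Local Notation V := (Cn R n).
Local Notation C := R[i].
Implicit Types (z v : V) (i j k l : 'I_n).

Definition cvec v : 'rV[C]_n := \row_i (v.1 0 i +i* v.2 0 i)%C.

Lemma Cn_basis v : v = \sum_i (v.1 0 i *: ex i + v.2 0 i *: ey i).
Proof.
have pD (a b : V) : a + b = (a.1 + b.1, a.2 + b.2) by [].
have pZ (c : R) (a : V) : c *: a = (c *: a.1, c *: a.2) by [].
case: v => x y; rewrite big_split /=.
have -> : \sum_i x 0 i *: @ex R n i = (x, 0).
  rewrite [in RHS](row_sum_delta x) (big_morph (fun w : 'rV[R]_n => (w, 0) : V)
    (id1 := 0) (op1 := +%R)) //; last by move=> a b; rewrite pD /= addr0.
  by apply: eq_bigr => i _; rewrite pZ /= scaler0.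
have -> : \sum_i y 0 i *: @ey R n i = (0, y).
  rewrite [in RHS](row_sum_delta y) (big_morph (fun w : 'rV[R]_n => (0, w) : V)
    (id1 := 0) (op1 := +%R)) //; last by move=> a b; rewrite pD /= addr0.
  by apply: eq_bigr => i _; rewrite pZ /= scaler0.
by rewrite pD /= addr0 add0r.
Qed.

Lemma Ck1_derive_basis (U : set V) (f : V -> R) z v : open U -> Ck 1 U f -> z \in U ->
  'D_v f z = \sum_i (v.1 0 i * 'D_(ex i) f z + v.2 0 i * 'D_(ey i) f z).
Proof.
move=> oU cf Uz; rewrite [in LHS](Cn_basis v).
have D0 : 'D_0 f z = 0 by rewrite -(scale0r 0) (Ck1_deriveZ _ _ cf Uz) mul0r.
elim/big_rec2: _ => [|i a b _ <-]; first exact: D0.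
by rewrite !(Ck1_deriveD _ _ oU cf Uz) !(Ck1_deriveZ _ _ cf Uz).
Qed.

(** This is a d/dx + b d/dy = zeta d/dz + \bar zeta d/d\bar z with zeta = a + i b. *)
Fact wirt_pair_algebra (a b : R) (x y : C) :
  (a%:C * x + b%:C * y)%C =
  (a +i* b)%C * ((x - 'i * y) / 2) + Num.conj (a +i* b)%C * ((x + 'i * y) / 2).
Proof.
have -> : (a +i* b)%C = a%:C%C + 'i * b%:C%C.
  by apply: complex_eq; rewrite ?(ReD, ImD, ReM, ImM) Re_i Im_i /=; ring.
rewrite rmorphD rmorphM /= conjCi !conj_real.
have i2 : 'i * 'i = -1 :> C by rewrite -expr2 sqrCi.
move: (a%:C%C) (b%:C%C) 'i i2 => {}a {}b e i2.
rewrite !mulrA -mulrDl.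
have -> : (a + e * b) * (x - e * y) + (a + - e * b) * (x + e * y) = (a * x - (e * e) * (b * y)) * 2.
  by ring.
by rewrite i2 mulN1r opprK mulfK// pnatr_eq0.
Qed.

Fact complex_pair_algebra (a b x x' y y' s t : R) :
  ((a * x + b * y + s) +i* (a * x' + b * y' + t))%C =
  a%:C%C * (x +i* x')%C + b%:C%C * (y +i* y')%C + (s +i* t)%C.
Proof. by apply: complex_eq; rewrite !(ReD, ImD, ReM, ImM) /=; ring. Qed.

Lemma CderE (U : set V) (F : V -> C) z v : open U -> CCk 1 U F -> z \in U ->
  Cder v F z = \sum_i (cvec v 0 i * dz i F z + Num.conj (cvec v 0 i) * dzb i F z).
Proof.
move=> oU [cF1 cF2] Uz.
have -> : Cder v F z =
    \sum_i ((v.1 0 i)%:C%C * Cder (ex i) F z + (v.2 0 i)%:C%C * Cder (ey i) F z).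
  rewrite /Cder (Ck1_derive_basis _ oU cF1 Uz) (Ck1_derive_basis _ oU cF2 Uz).
  by elim/big_rec3: _ => // i a b c _ <-; exact: complex_pair_algebra.
by apply: eq_bigr => i _; rewrite mxE wirt_pair_algebra.
Qed.

Section Expansion.
Variables (U : set V) (r : V -> R) (z0 : V).
Hypotheses (oU : open U) (cr : Ck 4 U r) (Uz0 : z0 \in U).
Local Notation rC := (fun z : V => (r z)%:C%C).

Let c4 : CCk 4 U rC. Proof. exact: CCk_real. Qed.
Let c3 i : CCk 3 U (r_i r i). Proof. exact: (CCk_dz i oU c4). Qed.
Let c3b j : CCk 3 U (r_jb r j). Proof. exact: (CCk_dzb j oU c4). Qed.

Lemma Cder_real v z : Cder v rC z = ('D_v r z)%:C%C.
Proof. by rewrite /Cder derive_cst. Qed.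

Lemma derive_gradT v z : z \in U ->
  ('D_v r z)%:C%C = \tr (cvec v *m gradT r z) + Num.conj (\tr (cvec v *m gradT r z)).
Proof.
move=> Uz; rewrite -Cder_real (CderE _ oU (CCk_le (isT : (1 <= 4)%N) c4) Uz).
rewrite /mxtrace !big_ord1 mxE rmorph_sum -big_split /=; apply: eq_bigr => i _.
by rewrite [gradT _ _ _ _]mxE rmorphM /= -(r_jbE oU cr i Uz).
Qed.

Lemma derive2_tangential_form v :
  ('D_v ('D_v r) z0)%:C%C = tangential_form (hessian r z0) (symT r z0) (cvec v).
Proof.
set c := cvec v.
pose K z := \sum_i (c 0 i * r_i r i z + Num.conj (c 0 i) * r_jb r i z).
have EK : {in U, (fun z => ('D_v r z)%:C%C) =1 K}.
  by move=> z Uz; rewrite -Cder_real (CderE _ oU (CCk_le (isT : (1 <= 4)%N) c4) Uz).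
have -> : ('D_v ('D_v r) z0)%:C%C = Cder v K z0.
  rewrite -(@Cder_near _ _ _ (fun z => ('D_v r z)%:C%C)); first by rewrite /Cder derive_cst.
  by apply: filterS (near_in oU Uz0) => y; exact: EK.
(* With both directions equal to [v] and c = 1, [wirt] is the directional derivative, so its sum and
   product rules can be reused. *)
have wE F : wirt v v 1 F z0 = Cder v F z0.
  by rewrite /wirt mul1r -mulr2n -(mulr_natr (Cder v F z0)) mulfK// pnatr_eq0.
have h1 i : is_wirt v v 1 (r_i r i) z0 (Cder v (r_i r i) z0).
  by rewrite -wE; apply: CCk_is_wirt (c3 i) Uz0.
have h2 i : is_wirt v v 1 (r_jb r i) z0 (Cder v (r_jb r i) z0).
  by rewrite -wE; apply: CCk_is_wirt (c3b i) Uz0.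
rewrite -wE (is_wirtE (is_wirt_sum _ (fun i (_ : true) => is_wirtD (is_wirtZ (c 0 i) (h1 i))
   (is_wirtZ (Num.conj (c 0 i)) (h2 i))))).
have S1 : \sum_i c 0 i * (\sum_k c 0 k * symT r z0 i k) = \tr (c *m symT r z0 *m c^T).
  rewrite /mxtrace big_ord1 -mulmxA mxE; apply: eq_bigr => i _; congr (_ * _); rewrite [in RHS]mxE.
  by apply: eq_bigr => k _; rewrite [c^T _ _]mxE mulrC.
have H1 : \sum_i c 0 i * (\sum_k Num.conj (c 0 k) * hessian r z0 i k) =
    \tr (c *m hessian r z0 *m adjmx c).
  rewrite /mxtrace big_ord1 -mulmxA mxE; apply: eq_bigr => i _; congr (_ * _); rewrite [in RHS]mxE.
  by apply: eq_bigr => k _; rewrite [adjmx c _ _]mxE [c^T _ _]mxE mulrC.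
have c1 i : CCk 1 U (r_i r i) := CCk_le (isT : (1 <= 3)%N) (c3 i).
have c1b i : CCk 1 U (r_jb r i) := CCk_le (isT : (1 <= 3)%N) (c3b i).
have Hr : \sum_i Num.conj (c 0 i) * (\sum_k c 0 k * hessian r z0 k i) =
    \tr (c *m hessian r z0 *m adjmx c).
  rewrite /mxtrace big_ord1 mxE; apply: eq_bigr => i _.
  by rewrite [adjmx c _ _]mxE [c^T _ _]mxE mulrC; congr (_ * _); rewrite mxE.
rewrite /tangential_form mulr2n -{1}Hr -S1 -H1 rmorph_sum -!big_split /=; apply: eq_bigr => i _.
rewrite (CderE _ oU (c1 i) Uz0) (CderE _ oU (c1b i) Uz0) -/c !big_split /=.
have -> : \sum_k c 0 k * dz k (r_i r i) z0 = \sum_k c 0 k * symT r z0 i k.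
  by apply: eq_bigr => k _; rewrite [symT _ _ _ _]mxE.
have -> : \sum_k Num.conj (c 0 k) * dzb k (r_i r i) z0 = \sum_k Num.conj (c 0 k) * hessian r z0 i k.
  by apply: eq_bigr => k _; rewrite [hessian _ _ _ _]mxE.
have -> : \sum_k c 0 k * dz k (r_jb r i) z0 = \sum_k c 0 k * hessian r z0 k i.
  by apply: eq_bigr => k _; rewrite [hessian _ _ _ _]mxE (r_ijb_dz oU cr k i Uz0).
have -> : \sum_k Num.conj (c 0 k) * dzb k (r_jb r i) z0 = Num.conj (\sum_k c 0 k * symT r z0 i k).
  rewrite rmorph_sum; apply: eq_bigr => k _.
  by rewrite [RHS]rmorphM /= (dzb_r_jb oU cr i k Uz0) [symT _ _ _ _]mxE.
rewrite rmorphM /=; move: (\sum_k _) (\sum_k _) (\sum_k _) (c 0 i) => a b d e.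
exact: hermitian_regroup.
Qed.

End Expansion.
End RealHessian.

(** * Pointwise properties of strictly plurisubharmonic defining functions *)

Section SpshDefiningFunction.
Context {R : realType} {n : nat}.
Local Notation V := (Cn R n).
Local Notation C := R[i].
Implicit Types (D U : set V) (r : V -> R) (z v : V).

Lemma cvec_surj (w : 'rV[C]_n) : exists v, cvec v = w.
Proof.
exists (\row_i complex.Re (w 0 i), \row_i complex.Im (w 0 i)).
by apply/matrixP => i j; rewrite ord1 !mxE /= -complexE.
Qed.

Lemma cvec_eq0 v : cvec v = 0 -> v = 0.
Proof.
move=> e; have h j : ((v.1 0 j) +i* (v.2 0 j))%C = 0 :> C.
  by have := congr1 (fun M : 'rV[C]_n => M 0 j) e; rewrite !mxE.
rewrite [LHS]surjective_pairing; congr (_, _); apply/matrixP => i j; rewrite ord1 mxE.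
  exact: (congr1 (fun x => complex.Re x) (h j)).
exact: (congr1 (fun x => complex.Im x) (h j)).
Qed.

Lemma cvec0 : cvec (0 : V) = 0.
Proof. by apply/matrixP => i j; rewrite !mxE. Qed.

Lemma levi_formE r z (w : 'I_n -> C) :
  levi_form r z w = \tr ((\row_i w i) *m hessian r z *m adjmx (\row_i w i)).
Proof.
rewrite /levi_form -mulmxA /mxtrace big_ord1 mxE; apply: eq_bigr => i _.
rewrite [in RHS]mxE [in RHS]mxE mulr_sumr; apply: eq_bigr => j _.
by rewrite [hessian _ _ _ _]mxE [adjmx _ _ _]mxE [_^T _ _]mxE [(\row_i w i) _ _]mxE mulrCA mulrA.
Qed.

Lemma spsh_posdef D r z : spsh_defining_function D r -> closure D z -> posdef (hessian r z).
Proof.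
move=> [[[U [oU DU cr]] _ _] levi] Dz; split.
  exact: (adj_hessian oU cr (mem_set (DU z Dz))).
move=> v v0; have := levi z (fun i => v 0 i) Dz.
rewrite levi_formE; have -> : \row_i v 0 i = v by apply/matrixP => i j; rewrite ord1 mxE.
apply; apply/existsP; apply: contraNT v0 => /existsPn h.
apply/eqP/matrixP => i j; rewrite ord1 mxE; apply/eqP; have := h j; by rewrite negbK.
Qed.

Lemma gradT_neq0 U r z v : open U -> Ck 4 U r -> z \in U -> 'D_v r z != 0 -> gradT r z != 0.
Proof.
move=> oU cr Uz; apply: contra_neq => p0; have := derive_gradT oU cr v Uz.
by rewrite p0 mulmx0 mxtrace0 rmorph0 addr0 => -[].
Qed.

Lemma defining_gradT_neq0 D r z : defining_function (Ck 4) D r -> boundary D z ->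
  gradT r z != 0.
Proof.
move=> [[U [oU DU cr]] _ h] bz; have [_ [v]] := h z bz.
by apply: (gradT_neq0 oU cr); apply/mem_set/DU; case: bz.
Qed.

Lemma defining_function_le k m D r : (k <= m)%N -> defining_function (Ck m) D r ->
  defining_function (Ck k) D r.
Proof.
by move=> km [[U [oU DU cr]] h1 h2]; split => //; exists U; split => //; exact: Ck_le cr.
Qed.

Lemma pseudoconvex_of_spsh D r : spsh_defining_function D r -> pseudoconvex D.
Proof.
move=> sr; exists r; split; first exact: (defining_function_le (isT : (2 <= 4)%N) sr.1).
by move=> z w bz _; rewrite levi_formE; exact: (posdef_psd (spsh_posdef sr bz.1)).2.
Qed.

Lemma convex_tangential_form D r z (w : 'rV[C]_n) : open D -> convex_set D ->
  defining_function (Ck 4) D r -> boundary D z ->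
  \tr (w *m gradT r z) + Num.conj (\tr (w *m gradT r z)) = 0 ->
  0 <= tangential_form (hessian r z) (symT r z) w.
Proof.
move=> oD cD dr bz; have [[U [oU DU cr]] _ _] := dr.
have Uz : z \in U by apply/mem_set/DU; case: bz.
have [v <-] := cvec_surj w.
rewrite -(derive_gradT oU cr v Uz) -(derive2_tangential_form oU cr Uz v) lecR => -[v0].
exact: (convex_hessian_ge0 oD cD (defining_function_le (isT : (2 <= 4)%N) dr) bz v0).
Qed.

Lemma convex_L2_gt0 D r z : (0 < n)%N -> open D -> convex_set D ->
  spsh_defining_function D r -> boundary D z -> 0 < convex_criterion r z -> 0 < L2 r z.
Proof.
move=> n0 oD cD sr bz crit; have [[U [oU DU cr]] _ h] := sr.1.
have Uz : z \in U by apply/mem_set/DU; case: bz.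
have [rz _] := h z bz.
have pH := spsh_posdef sr bz.1; have p0 := defining_gradT_neq0 sr.1 bz.
have := criterion_le_L2_tensor (thirdT r z) (fourthT r z) pH p0 (trmx_symT oU cr Uz)
  (fun w => convex_tangential_form oD cD sr.1 bz) n0.
rewrite -(L2E oU cr Uz rz pH p0) -(convex_criterionE oU cr Uz rz pH p0) => /(lt_le_trans crit).
by rewrite pmulr_rgt0// ltr_wpDl.
Qed.

End SpshDefiningFunction.

(** * Tangential Hessian and L_2 in dimension one *)

Section DimensionOne.
Context {R : realType}.
Local Notation V := (Cn R 1).
Local Notation C := R[i].
Variables (D : set V) (r : V -> R) (z : V).
Hypotheses (sr : spsh_defining_function D r) (bz : boundary D z).
Local Notation G := (invmx (hessian r z)).
Local Notation p' := (adjmx (gradT r z)).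

(** For v = i t u the second derivative is 2 t^2 (N - Re S(R, R)), while L_2 = 1 - Re S(R, R) / N,
    whence the factor 2 t^2 N. *)
Lemma hessian_L2_dim1 (v : V) : v != 0 -> 'D_v r z = 0 ->
  exists2 c : R, 0 < c & 'D_v ('D_v r) z = c * L2 r z.
Proof.
move=> v0 dv; have [[U [oU DU cr]] _ h] := sr.1.
have Uz : z \in U by apply/mem_set/DU; case: bz.
have [rz _] := h z bz.
have pH := spsh_posdef sr bz.1; have p0 := defining_gradT_neq0 sr.1 bz.
have vp : \tr (cvec v *m gradT r z) + Num.conj (\tr (cvec v *m gradT r z)) = 0.
  by rewrite -(derive_gradT oU cr v Uz) dv.
have [t [vE tE]] := tangential_form_dim1 (symT r z) pH p0 vp.
have t0 : t != 0.
  apply: contra_neq v0 => t0; apply: cvec_eq0.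
  by rewrite vE t0 mul0r scale0r.
have N0 := Nr_gt0 pH p0.
exists (t ^+ 2 * (2 * complex.Re (bnorm G (gradT r z) p'))).
  by apply: mulr_gt0; [rewrite exprn_even_gt0|exact: mulr_gt0].
rewrite (L2E oU cr Uz rz pH p0) (L2_tensor_dim1 _ _ _ pH p0).
have := derive2_tangential_form oU cr Uz v; rewrite tE => -[->].
rewrite -(mulrA (t ^+ 2)); congr (_ * _); rewrite [RHS]mulrBr mulr1 -[in RHS]mulrA; congr (_ - 2 * _).
by rewrite mulrC divfK// gt_eqF.
Qed.

Lemma exists_tangent_dim1 : exists2 v : V, v != 0 & 'D_v r z = 0.
Proof.
have [[U [oU DU cr]] _ h] := sr.1.
have Uz : z \in U by apply/mem_set/DU; case: bz.
have pH := spsh_posdef sr bz.1; have p0 := defining_gradT_neq0 sr.1 bz.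
(* The vector i u is tangent because u p = N is real. *)
have [v vE] := cvec_surj ('i *: bup G p').
have NE' : \tr (bup G p' *m gradT r z) = bnorm G (gradT r z) p'.
  by [].
exists v.
  apply/negP => /eqP v0; move: vE; rewrite v0 cvec0 => /esym/eqP.
  rewrite scaler_eq0 (negbTE (neq0Ci _)) /= => /eqP u0.
  by have := bnorm_neq0 pH p0; rewrite -NE' u0 mul0mx mxtrace0 eqxx.
have := derive_gradT oU cr v Uz; rewrite vE -scalemxAl mxtraceZ NE' rmorphM /= (bnorm_conj pH p0).
by rewrite conjCi mulNr subrr => -[].
Qed.

End DimensionOne.

(** * Strictly plurisubharmonic defining functions in the plane *)

Section Coordinates.
Context {R : realType} {n : nat}.
Local Notation V := (Cn R n).
Implicit Types (U : set V) (z v : V) (i : 'I_n) (k : nat).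

Definition xco i z : R := z.1 0 i.
Definition yco i z : R := z.2 0 i.

Lemma xco_continuous i : continuous (xco i).
Proof. by move=> z; apply: (@continuous_comp _ _ _ fst (fun M : 'rV[R]_n => M 0 i)); [exact: cvg_fst|exact: coord_continuous]. Qed.

Lemma yco_continuous i : continuous (yco i).
Proof. by move=> z; apply: (@continuous_comp _ _ _ snd (fun M : 'rV[R]_n => M 0 i)); [exact: cvg_snd|exact: coord_continuous]. Qed.

Lemma xco_linear i a v w : xco i (a *: v + w) = a * xco i v + xco i w.
Proof. by rewrite /xco /= !mxE. Qed.

Lemma yco_linear i a v w : yco i (a *: v + w) = a * yco i v + yco i w.
Proof. by rewrite /yco /= !mxE. Qed.

Lemma Ck_xco k U i : open U -> Ck k U (xco i).
Proof. by move=> oU; apply: Ck_linear oU (@xco_continuous i) _; exact: xco_linear. Qed.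

Lemma Ck_yco k U i : open U -> Ck k U (yco i).
Proof. by move=> oU; apply: Ck_linear oU (@yco_continuous i) _; exact: yco_linear. Qed.

Lemma is_derive_xco i z v : is_derive z v (xco i) (xco i v).
Proof.
rewrite -(derive_linear z v (@xco_continuous i) (xco_linear i)).
by apply: (Ck_is_derive v (Ck_xco 1 i openT)); rewrite inE.
Qed.

Lemma is_derive_yco i z v : is_derive z v (yco i) (yco i v).
Proof.
rewrite -(derive_linear z v (@yco_continuous i) (yco_linear i)).
by apply: (Ck_is_derive v (Ck_yco 1 i openT)); rewrite inE.
Qed.

Lemma Cn_compact (K : set V) : bounded_set K -> closed K -> compact K.
Proof.
move=> bK cK; have [M [_ /(_ (M + 1)) h]] := bK.
have {}h z : K z -> `|z| <= M + 1 by apply: h; rewrite ltrDl.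
pose B := [set x : 'rV[R]_n | `|x| <= M + 1].
have cB : compact B.
  apply: bounded_closed_compact.
    by exists (M + 1); split; [exact: num_real|move=> t /ltW tM x /= /le_trans; apply].
  by apply: (@closed_comp _ _ (fun x : 'rV[R]_n => `|x|) [set t | t <= M + 1]);
    [move=> x _; exact: norm_continuous|exact: closed_le].
apply: (subclosed_compact cK (compact_setX cB cB)) => z /h; rewrite prod_normE ge_max.
by case/andP.
Qed.

Lemma derive_in U (f g : V -> R) z v : open U -> {in U, f =1 g} -> z \in U ->
  'D_v f z = 'D_v g z.
Proof.
move=> oU e Uz; apply: near_eq_derive; apply: filterS (near_in oU Uz) => y.
exact: e.
Qed.

Lemma derive2M U (f g : V -> R) z v : open U -> Ck 2 U f -> Ck 2 U g -> z \in U ->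
  'D_v ('D_v (f \* g)) z =
  g z * 'D_v ('D_v f) z + 2 * 'D_v f z * 'D_v g z + f z * 'D_v ('D_v g) z.
Proof.
move=> oU cf cg Uz.
have df y : y \in U -> is_derive y v f ('D_v f y) by exact: Ck_is_derive cf.
have dg y : y \in U -> is_derive y v g ('D_v g y) by exact: Ck_is_derive cg.
have ddf := Ck_is_derive v (Ck_derive v cf) Uz.
have ddg := Ck_is_derive v (Ck_derive v cg) Uz.
have E : {in U, 'D_v (f \* g) =1 (f \* 'D_v g) \+ (g \* 'D_v f)}.
  by move=> y Uy; have [_ ->] := is_deriveM (df y Uy) (dg y Uy).
rewrite (derive_in v oU E Uz).
have [_ ->] := is_deriveD (is_deriveM (df z Uz) ddg) (is_deriveM (dg z Uz) ddf).
rewrite /GRing.scale /=.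
move: ('D_v ('D_v f) z) ('D_v ('D_v g) z) ('D_v f z) ('D_v g z) (f z) (g z) => a b c d e h.
by ring.
Qed.

Lemma derive_expM U (f : V -> R) (A : R) z v : open U -> Ck 1 U f -> z \in U ->
  'D_v (fun y => expR (A * f y)) z = expR (A * f z) * (A * 'D_v f z).
Proof.
move=> oU cf Uz; have df := Ck_is_derive v (CkZ A oU cf) Uz.
have [_ ->] := is_derive_comp1 (f := fun y => A * f y) (is_derive_expR (A * f z)) df.
by rewrite deriveZ; [|exact: Ck_derivable cf Uz].
Qed.

Lemma derive2_expM U (f : V -> R) (A : R) z v : open U -> Ck 2 U f -> z \in U ->
  'D_v ('D_v (fun y => expR (A * f y))) z =
  expR (A * f z) * (A * 'D_v ('D_v f) z + A ^+ 2 * 'D_v f z ^+ 2).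
Proof.
move=> oU cf Uz; have cf1 := CkW cf.
have E : {in U, 'D_v (fun y => expR (A * f y)) =1
    (fun y => expR (A * f y)) \* (fun y => A * 'D_v f y)}.
  by move=> y Uy; exact: derive_expM oU cf1 Uy.
rewrite (derive_in v oU E Uz).
have h1 := Ck_is_derive v (Ck_expR oU (CkZ A oU cf)) Uz.
have h2 := Ck_is_derive v (CkZ A oU (Ck_derive v cf)) Uz.
have [_ ->] := is_deriveM h1 h2.
rewrite (derive_expM A v oU cf1 Uz) (_ : 'D_v _ z = A * 'D_v ('D_v f) z); last first.
  by rewrite deriveZ; [|exact: Ck_derivable (Ck_derive v cf) Uz].
rewrite /GRing.scale /=.
move: (expR _) ('D_v ('D_v f) z) ('D_v f z) => e a b; ring.
Qed.

(* Rotating w by i changes the sign of the part in S and fixes the Hermitian part. *)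
Lemma tangential_form_rotate (H S : 'M[R[i]]_n) w :
  tangential_form H S w + tangential_form H S ('i *: w) = \tr (w *m H *m adjmx w) *+ 4.
Proof.
have e1 : \tr ('i *: w *m S *m ('i *: w)^T) = - \tr (w *m S *m w^T).
  have -> : ('i *: w)^T = 'i *: w^T by apply/matrixP => i j; rewrite !mxE.
  by rewrite -scalemxAl -scalemxAl -scalemxAr mxtraceZ mxtraceZ mulrA -expr2 sqrCi mulN1r.
have e2 : \tr ('i *: w *m H *m adjmx ('i *: w)) = \tr (w *m H *m adjmx w).
  rewrite adjmxZ -scalemxAl -scalemxAl -scalemxAr mxtraceZ mxtraceZ mulrA conjCi mulrN -expr2 sqrCi.
  by rewrite opprK mul1r.
have -> : tangential_form H S ('i *: w) = - \tr (w *m S *m w^T) + Num.conj (- \tr (w *m S *m w^T)) +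
    \tr (w *m H *m adjmx w) *+ 2 by congr (_ + Num.conj _ + _ *+ 2).
rewrite /tangential_form [Num.conj (- _)]rmorphN -opprD.
move: (\tr (w *m S *m w^T) + _) (\tr (w *m H *m _)) => a b.
by rewrite addrACA subrr add0r -mulrnDr.
Qed.

(** [ey i] corresponds to i times [ex i], so the rotation identity leaves only the Hermitian part,
    counted four times. *)
Lemma laplacian_r_ijb U (r : V -> R) z i : open U -> Ck 4 U r -> z \in U ->
  ('D_(ex i) ('D_(ex i) r) z + 'D_(ey i) ('D_(ey i) r) z)%:C%C = r_ijb r i i z *+ 4.
Proof.
move=> oU cr Uz; have h v := derive2_tangential_form oU cr Uz v.
apply: etrans (rmorphD _ _ _) _; apply: etrans (congr2 +%R (h (ex i)) (h (ey i))) _.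
have -> : cvec (ey i : V) = 'i *: cvec (ex i).
  apply/matrixP => a b; rewrite ord1 !mxE /=.
  by apply: complex_eq; rewrite ?(ReM, ImM) Re_i Im_i /=; ring.
rewrite tangential_form_rotate; congr (_ *+ 4).
have -> : cvec (ex i : V) = delta_mx 0 i.
  by apply/matrixP => a b; apply: complex_eq; rewrite !mxE /= ord1 eqxx /=; case: (b == i).
rewrite -rowE /mxtrace big_ord1 mxE (bigD1 i)//= big1 ?addr0 => [|j ji].
  by rewrite !mxE !eqxx rmorph1 mulr1.
by rewrite !mxE eqxx (negbTE ji) rmorph0 mulr0.
Qed.

End Coordinates.

(* Either rho is close to 0 and the gradient term A^2 g dominates, or
   exp (A rho) is exponentially small and 4 (1 - exp (A rho)) dominates. *)
Fact exp_barrier_inequality (R : realType) (A B c q g rho lap dot : R) :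
  0 < A -> 0 < c -> 4 * B < A * c ^+ 2 -> 2 * B <= A * c ->
  1 <= q -> 0 <= g -> rho <= 0 -> c <= g - rho -> - B <= q * lap + 2 * dot -> 0 <= B ->
  0 < expR (A * rho) * (q * (A * lap + A ^+ 2 * g) + 2 * A * dot) + 4 * (1 - expR (A * rho)).
Proof.
move=> A0 c0 h1 h2 q1 g0 rho0 hc hB B0.
have E0 := expR_gt0 (A * rho); have E1 : expR (A * rho) <= 1.
  by rewrite -expR0 ler_expR pmulr_rle0.
have k1 : A ^+ 2 * g - A * B <= q * (A * lap + A ^+ 2 * g) + 2 * A * dot.
  have : 0 <= A * (q * lap + 2 * dot + B) by apply: mulr_ge0; [exact: ltW|lra].
  have : 0 <= (q - 1) * (A ^+ 2 * g) by rewrite mulr_ge0 ?subr_ge0// mulr_ge0// sqr_ge0.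
  by lra.
have [small|big] := ltP (- rho) (c / 2).
  have g2 : c / 2 < g by lra.
  have : 0 < A ^+ 2 * g - A * B.
    have : A * (A * (c / 2)) < A * (A * g) by rewrite !ltr_pM2l.
    have : A * (2 * B) <= A * (A * c) by rewrite ler_pM2l.
    by lra.
  move=> k2; rewrite ltr_pwDl//; last by rewrite mulr_ge0// subr_ge0.
  by rewrite mulr_gt0// (lt_le_trans k2).
have k3 : expR (A * rho) * (- (A * B)) <=
    expR (A * rho) * (q * (A * lap + A ^+ 2 * g) + 2 * A * dot).
  rewrite ler_pM2l//; apply: le_trans k1; rewrite lerDr.
  by apply: mulr_ge0 => //; exact: sqr_ge0.
(* exp(A rho) = exp(x)^-2, and squaring exp(x) >= 1 + x gives 4 (exp(x)^2 - 1) >= 4 x^2 >= A^2 c^2 /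
   4 > A B when B > 0; the linear term in x is nonnegative, and in general 4 B < A c^2 supplies the
   strictness. *)
pose x : R := - (A * rho) / 2.
have x0 : A * c / 4 <= x by rewrite /x -mulrN -!mulrA ler_pM2l//; lra.
have ex2 : expR (A * rho) = (expR x ^+ 2)^-1.
  by rewrite -expRM_natr /x divfK// expRN invrK.
have xx : A * B < 4 * (expR x ^+ 2 - 1).
  have ge : (1 + x) ^+ 2 <= expR x ^+ 2.
    have xpos : 0 <= x by apply: le_trans x0; apply: divr_ge0 => //; apply: mulr_ge0; exact: ltW.
    by apply: lerXn2r; rewrite ?nnegrE ?expR_ge0 ?addr_ge0//; exact: expR_ge1Dx.
  have k4 : (A * c / 4) ^+ 2 <= x ^+ 2.
    have y0 : 0 <= A * c / 4 by apply: divr_ge0 => //; apply: mulr_ge0; exact: ltW.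
    by apply: lerXn2r; rewrite ?nnegrE// (le_trans y0).
  have k5 : A * (4 * B) < A * (A * c ^+ 2) by rewrite ltr_pM2l.
  have xpos : 0 <= x by apply: le_trans x0; apply: divr_ge0 => //; apply: mulr_ge0; exact: ltW.
  move: k4 k5 ge xpos; clear; move: (expR x ^+ 2) => e; nra.
apply: lt_le_trans (lerD k3 (lexx _)).
move: xx; rewrite ex2; have : 0 < expR x ^+ 2 by rewrite exprn_gt0 ?expR_gt0.
move: (expR x ^+ 2) => e e0 xx.
have -> : e^-1 * - (A * B) + 4 * (1 - e^-1) = e^-1 * (4 * (e - 1) - A * B).
  by field; rewrite gt_eqF.
by rewrite mulr_gt0 ?invr_gt0// subr_gt0.
Qed.

Fact barrier_laplacian (R : realFieldType) (A e q p1 p2 d1 d2 s1 s2 : R) :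
  0 < e * (q * (A * (p1 + p2) + A ^+ 2 * (d1 ^+ 2 + d2 ^+ 2)) + 2 * A * (d1 * s1 + d2 * s2))
    + 4 * (1 - e) ->
  0 < q * (e * (A * p1 + A ^+ 2 * d1 ^+ 2)) + 2 * (e * (A * d1)) * s1
      + (e - 1) * (- 2 * (1 ^+ 2 + 0 ^+ 2))
    + (q * (e * (A * p2 + A ^+ 2 * d2 ^+ 2)) + 2 * (e * (A * d2)) * s2
      + (e - 1) * (- 2 * (0 ^+ 2 + 1 ^+ 2))).
Proof. by congr (is_true (0 < _)); ring. Qed.

Fact barrier_constant (R : realFieldType) (B c : R) : 0 <= B -> 0 < c ->
  let A := 4 * B / c ^+ 2 + 2 * B / c + 1 in
  [/\ 0 < A, 4 * B < A * c ^+ 2 & 2 * B <= A * c].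
Proof.
move=> B0 c0 /=.
have h1 : 0 <= 4 * B / c ^+ 2 by apply: divr_ge0; [exact: mulr_ge0|exact: sqr_ge0].
have h2 : 0 <= 2 * B / c by rewrite divr_ge0 ?mulr_ge0// ltW.
have e1 : 4 * B / c ^+ 2 * c ^+ 2 = 4 * B by rewrite divfK// expf_neq0// gt_eqF.
have e2 : 2 * B / c * c = 2 * B by rewrite divfK// gt_eqF.
split; first by rewrite ltr_wpDl// addr_ge0.
  move: h2 e1; move: (_ / _) (_ / _) => x y y0 e1.
  have -> : (x + y + 1) * c ^+ 2 = x * c ^+ 2 + (y * c ^+ 2 + c ^+ 2) by ring.
  by rewrite e1 ltrDl ltr_wpDl ?exprn_gt0// mulr_ge0// sqr_ge0.
move: h1 e2; move: (_ / _) (_ / _) => y x y0 {}e1.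
have -> : (x + y + 1) * c = y * c + (x * c + c) by ring.
by rewrite e1 lerDl addr_ge0 ?mulr_ge0// ltW.
Qed.

Section Derivatives.
Context {R : realType} {V : normedModType R}.
Implicit Types (U : set V) (f g : V -> R) (z v : V).

Lemma Ck_deriveB U f g z v : Ck 1 U f -> Ck 1 U g -> z \in U ->
  'D_v (f \- g) z = 'D_v f z - 'D_v g z.
Proof.
move=> cf cg Uz.
by have [_ ->] := is_deriveB (Ck_is_derive v cf Uz) (Ck_is_derive v cg Uz).
Qed.

Lemma Ck_derive2B U f g z v : open U -> Ck 2 U f -> Ck 2 U g -> z \in U ->
  'D_v ('D_v (f \- g)) z = 'D_v ('D_v f) z - 'D_v ('D_v g) z.
Proof.
move=> oU cf cg Uz.
have E : {in U, 'D_v (f \- g) =1 'D_v f \- 'D_v g}.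
  by move=> y Uy; exact: Ck_deriveB (CkW cf) (CkW cg) Uy.
rewrite -(Ck_deriveB v (Ck_derive v cf) (Ck_derive v cg) Uz); apply: near_eq_derive.
by apply: filterS (near_in oU Uz) => y; exact: E.
Qed.

Lemma bounded_closure (D : set V) : bounded_set D -> bounded_set (closure D).
Proof.
move=> [M [_ h]]; exists (M + 1); split; first exact: num_real.
move=> t /ltW tM z Dz /=; apply: le_trans tM.
have cl : closed [set x : V | `|x| <= M + 1].
  by apply: (@closed_comp _ _ (fun x : V => `|x|) [set t | t <= M + 1]);
    [move=> x _; exact: norm_continuous|exact: closed_le].
suff : closure [set x : V | `|x| <= M + 1] z by rewrite -(closure_id _).1.
by apply: closure_subset Dz => x Dx; apply: h => //; rewrite ltrDl.
Qed.

Lemma continuous_within U (K : set V) f : {in U, continuous f} -> K `<=` U ->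
  {within K, continuous f}.
Proof.
move=> cf KU; apply: continuous_in_subspaceT => x /set_mem Kx.
by apply: cf; exact/mem_set/KU.
Qed.

End Derivatives.

Section SpshDim1.
Context {R : realType}.
Local Notation V := (Cn R 1).
Variable D : set V.
Hypothesis sbD : smoothly_bounded_domain D.

Definition sqdist (M : R) (z : V) : R :=
  M - (xco 0 z * xco 0 z + yco 0 z * yco 0 z).

Lemma is_derive_sqdist M z v :
  is_derive z v (sqdist M) (- 2 * (xco 0 z * xco 0 v + yco 0 z * yco 0 v)).
Proof.
have hx := is_derive_xco 0 z v; have hy := is_derive_yco 0 z v.
have := is_deriveB (is_derive_cst M z v) (is_deriveD (is_deriveM hx hx) (is_deriveM hy hy)).
by congr is_derive; rewrite /GRing.scale /=; ring.
Qed.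

Lemma Ck_sqdist M k : Ck k setT (sqdist M).
Proof.
apply: (@CkB _ _ k setT (cst M) _ openT); first exact: Ck_cst openT.
by apply: (CkD openT); apply: (CkM openT); (exact: Ck_xco openT || exact: Ck_yco openT).
Qed.

Lemma derive2_sqdist M z v :
  'D_v ('D_v (sqdist M)) z = - 2 * (xco 0 v ^+ 2 + yco 0 v ^+ 2).
Proof.
have -> : 'D_v (sqdist M) = (fun z => - 2 * (xco 0 z * xco 0 v + yco 0 z * yco 0 v)).
  by apply/funext => y; have [_ ->] := is_derive_sqdist M y v.
have hx := is_derive_xco 0 z v; have hy := is_derive_yco 0 z v.
suff [] : is_derive z v (fun z => - 2 * (xco 0 z * xco 0 v + yco 0 z * yco 0 v))
   (- 2 * (xco 0 v ^+ 2 + yco 0 v ^+ 2)) by [].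
have := is_deriveZ (- 2) (is_deriveD (is_deriveM hx (is_derive_cst (xco 0 v) z v))
  (is_deriveM hy (is_derive_cst (yco 0 v) z v))).
by congr is_derive; rewrite /GRing.scale /=; ring.
Qed.

(** Where d rho vanishes, exp (A rho) alone need not be subharmonic; such points of the closure have
    rho < 0, and there the second factor adds 4 (1 - exp (A rho)) > 0 to the Laplacian. In dimension
    one the Levi form has the single coefficient r_{1 \bar 1}, a quarter of the Laplacian. *)
Lemma exists_spsh_dim1 : exists r, spsh_defining_function D r.
Proof.
have [[z1 Dz1] oD _ bD [rho [[U [oU DU crho]] neg bd]]] := sbD.
set K := closure D.
have KU z : K z -> z \in U by move=> Kz; exact/mem_set/DU.
have K0 : K !=set0 by exists z1; exact: subset_closure.
have cK : compact K by apply: Cn_compact (bounded_closure bD) _; exact: closed_closure.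
have KT : K `<=` setT by [].
have [cM _ HM] := compact_EVT_max K0 cK (continuous_within (Ck_continuous (CkN openT (Ck_sqdist 0 0))) KT).
(* [sqdist 0] is - |z|^2, so [M] exceeds by one the maximum of |z|^2 on the closure, and [sqdist M]
   is at least 1 there. *)
pose M : R := - sqdist 0 cM + 1.
have q1 z : K z -> 1 <= sqdist M z.
  by move=> /mem_set/HM; rewrite /M /sqdist /=; lra.
pose lap z := 'D_(ex 0) ('D_(ex 0) rho) z + 'D_(ey 0) ('D_(ey 0) rho) z.
pose gr z := 'D_(ex 0) rho z ^+ 2 + 'D_(ey 0) rho z ^+ 2.
pose dot z := 'D_(ex 0) rho z * 'D_(ex 0) (sqdist M) z + 'D_(ey 0) rho z * 'D_(ey 0) (sqdist M) z.
have crhok v k : Ck k U ('D_v rho) := Ck_derive v (crho k.+1).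
have cq v k : Ck k U ('D_v (sqdist M)).
  exact: Ck_subset (subsetT U) (Ck_derive v (Ck_sqdist M k.+1)).
have cgr : Ck 0 U (gr \- rho).
  by apply: (CkB oU _ (crho 0)); apply: (CkD oU); exact: CkX oU (crhok _ 0).
have ch : Ck 0 U (fun z => sqdist M z * lap z + 2 * dot z).
  apply: (CkD oU); last apply: (CkZ _ oU).
    apply: (CkM oU); first exact: Ck_subset (subsetT U) (Ck_sqdist M 0).
    by apply: (CkD oU); exact: Ck_derive (crhok _ 1).
  by apply: (CkD oU); apply: (CkM oU).
have [cB /set_mem KB HB] := compact_EVT_min K0 cK (continuous_within (Ck_continuous ch) DU).
have [cc /set_mem Kc Hc] := compact_EVT_min K0 cK (continuous_within (Ck_continuous cgr) DU).
pose B : R := `|sqdist M cB * lap cB + 2 * dot cB|.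
(* Minimum of |grad rho|^2 - rho on the closure. It is positive: inside because rho < 0, on the
   boundary because d rho does not vanish. *)
pose c : R := gr cc - rho cc.
have gr0 z : 0 <= gr z by rewrite addr_ge0// sqr_ge0.
have rho0 z : K z -> rho z <= 0.
  by apply: (@closure_le0 _ _ D rho oD neg) => y /bd[].
have gr_gt0 z : boundary D z -> 0 < gr z.
  move=> bz; have Uz : z \in U by apply: KU; case: bz.
  have [_ [v]] := bd z bz; rewrite (Ck1_derive_basis v oU (crho 1) Uz) big_ord1.
  apply: contra_neqT; rewrite -leNgt => le0.
  have /eqP : gr z = 0 by apply/eqP; rewrite eq_le le0 gr0.
  rewrite /gr paddr_eq0 ?sqr_ge0// !sqrf_eq0 => /andP[/eqP -> /eqP ->].
  by rewrite !mulr0 addr0.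
have c0 : 0 < c.
  have [Dc|nD] := pselect (D cc).
    by rewrite /c subr_gt0; exact: lt_le_trans (neg _ Dc) (gr0 _).
  have bc : boundary D cc by apply/boundaryE.
  by rewrite /c (bd cc bc).1 subr0; exact: gr_gt0.
pose A : R := 4 * B / c ^+ 2 + 2 * B / c + 1.
have B0 : 0 <= B := normr_ge0 _.
have [A0 A1 A2] : [/\ 0 < A, 4 * B < A * c ^+ 2 & 2 * B <= A * c] := barrier_constant B0 c0.
pose E z := expR (A * rho z).
pose r z := E z * sqdist M z - sqdist M z.
have cE k : Ck k U E := Ck_expR oU (CkZ A oU (crho k)).
have cqU k : Ck k U (sqdist M) := Ck_subset (subsetT U) (Ck_sqdist M k).
have cr k : Ck k U r := CkB oU (CkM oU (cE k) (cqU k)) (cqU k).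
have dr : defining_function (Ck 4) D r.
  split; first by exists U.
    move=> z Dz; have q := q1 z (subset_closure Dz).
    have : E z < 1 by rewrite -expR0 ltr_expR pmulr_rlt0// neg.
    rewrite /r -{2}(mul1r (sqdist M z)) -mulrBl pmulr_llt0 ?subr_lt0//; exact: lt_le_trans q.
  move=> z bz; have [rz [v dv]] := bd z bz.
  have Uz : z \in U by apply: KU; case: bz.
  have Ez : E z = 1 by rewrite /E rz mulr0 expR0.
  split; first by rewrite /r Ez mul1r subrr.
  exists v; rewrite (Ck_deriveB v (CkM oU (cE 1) (cqU 1)) (cqU 1) Uz).
  have [_ ->] := is_deriveM (Ck_is_derive v (cE 1) Uz) (Ck_is_derive v (cqU 1) Uz).
  (* On the boundary exp (A rho) = 1, so the derivatives of [sqdist M] cancel and dr is A [sqdist M]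
     times d rho. *)
  rewrite /GRing.scale /= Ez mul1r addrAC subrr add0r (derive_expM A v oU (crho 1) Uz).
  rewrite -/(E z) Ez mul1r !mulf_neq0//; first by rewrite gt_eqF// (lt_le_trans _ (q1 z _))//; case: bz.
  by rewrite gt_eqF.
exists r; split=> // z w Kz [i wi].
have Uz := KU z Kz.
have pos : 0 < 'D_(ex 0) ('D_(ex 0) r) z + 'D_(ey 0) ('D_(ey 0) r) z.
  have D2 v : 'D_v ('D_v r) z = sqdist M z * (E z * (A * 'D_v ('D_v rho) z + A ^+ 2 * 'D_v rho z ^+ 2))
    + 2 * (E z * (A * 'D_v rho z)) * 'D_v (sqdist M) z + (E z - 1) * (- 2 * (xco 0 v ^+ 2 + yco 0 v ^+ 2)).
    rewrite (Ck_derive2B v oU (CkM oU (cE 2) (cqU 2)) (cqU 2) Uz).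
    have dE : 'D_v E z = E z * (A * 'D_v rho z) := derive_expM A v oU (crho 1) Uz.
    have ddE : 'D_v ('D_v E) z = E z * (A * 'D_v ('D_v rho) z + A ^+ 2 * 'D_v rho z ^+ 2)
      := derive2_expM A v oU (crho 2) Uz.
    rewrite (derive2M v oU (cE 2) (cqU 2) Uz) ddE dE !derive2_sqdist.
    by move: (- 2 * _) => X; rewrite (mulrBl X (E z) 1) mul1r addrA.
  have hB : - B <= sqdist M z * lap z + 2 * dot z.
    by apply: le_trans (HB z (mem_set Kz)); rewrite lerNl ler_normr lexx orbT.
  have := exp_barrier_inequality A0 c0 A1 A2 (q1 z Kz) (gr0 z) (rho0 z Kz) (Hc z (mem_set Kz)) hB B0.
  have [e1 e2 e3 e4] : [/\ xco 0 (ex 0 : V) = 1, yco 0 (ex 0 : V) = 0, xco 0 (ey 0 : V) = 0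
    & yco 0 (ey 0 : V) = 1] by rewrite /xco /yco /= !mxE.
  rewrite (D2 (ex 0)) (D2 (ey 0)) e1 e2 e3 e4; exact: barrier_laplacian.
rewrite (_ : levi_form r z w = r_ijb r 0 0 z * (w 0 * (w 0)^*)); last first.
  by rewrite /levi_form !big_ord1 mulrA.
rewrite (ord1 i) in wi; apply: mulr_gt0; last by rewrite -normCK exprn_gt0// normr_gt0.
have : 0 < r_ijb r 0 0 z *+ 4 by rewrite -(laplacian_r_ijb 0 oU (cr 4) Uz) ltcR.
by rewrite pmulrn_lgt0.
Qed.

End SpshDim1.

(** * The two equivalences in dimension one *)

Section DimensionOneEquivalences.
Context {R : realType}.
Local Notation V := (Cn R 1).
Variable D : set V.
Hypothesis sbD : smoothly_bounded_domain D.

Let oD : open D. Proof. by case: sbD. Qed.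

Let def2 r : spsh_defining_function D r -> defining_function (Ck 2) D r.
Proof. by case=> dr _; exact: (defining_function_le (isT : (2 <= 4)%N) dr). Qed.

Lemma strictly_super_iff_strictly_convex : strictly_super_pseudoconvex D <-> strictly_convex D.
Proof.
split=> [[_ _ [r [sr L2r]]]|[rho [drho hess]]].
  exists r; split; first exact: def2.
  move=> z v bz v0 dv; have [c c0 ->] := hessian_L2_dim1 sr bz v0 dv.
  by rewrite mulr_gt0// L2r.
have [r sr] := exists_spsh_dim1 sbD.
split=> //; first exact: pseudoconvex_of_spsh sr.
exists r; split=> // z bz.
have [v v0 dv] := exists_tangent_dim1 sr bz.
(* Strict convexity is witnessed by [rho], whereas L_2 is computed from [r]; the sign of the Hessian
   is carried from one to the other. *)
have [c c0 /(_ v dv)[drhov le]] := tangent_transfer oD drho (def2 sr) bz.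
have [e e0 E] := hessian_L2_dim1 sr bz v0 dv.
have := lt_le_trans (hess z v bz v0 drhov) le.
by rewrite E pmulr_rgt0// pmulr_rgt0.
Qed.

Lemma super_iff_convex : super_pseudoconvex D <-> convex_set D.
Proof.
split=> [[_ _ [r [sr L2r]]]|cD].
  have [_ _ conD _ _] := sbD.
  apply: (convex_of_hessian oD (def2 sr) _ conD) => z v bz dv.
  have [v0|v0] := eqVneq v 0.
    have [[U [oU DU cr]] _ _] := sr.1.
    have Uz : z \in U by apply/mem_set/DU; case: bz.
    rewrite v0; have -> : (0 : V) = 0 *: 0 by rewrite scale0r.
    by rewrite (Ck1_deriveZ _ _ (Ck_derive _ (Ck_le (isT : (2 <= 4)%N) cr)) Uz) mul0r.
  have [c c0 ->] := hessian_L2_dim1 sr bz v0 dv.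
  by rewrite mulr_ge0// ?L2r// ltW.
have [r sr] := exists_spsh_dim1 sbD.
split=> //; first exact: pseudoconvex_of_spsh sr.
exists r; split=> // z bz.
have [v v0 dv] := exists_tangent_dim1 sr bz.
have [e e0 E] := hessian_L2_dim1 sr bz v0 dv.
have := convex_hessian_ge0 oD cD (def2 sr) bz dv.
by rewrite E pmulr_rge0.
Qed.

End DimensionOneEquivalences.

(** * Convexity versus super-pseudoconvexity in higher dimension *)

Section SublevelDomain.
Context {R : realType} {n : nat}.
Local Notation V := (Cn R n).
Variable rho : V -> R.
Hypothesis crho : Cinfty setT rho.
Local Notation D := [set z | rho z < 0].

Let rho_continuous : continuous rho.
Proof. by move=> z; apply: (Ck_continuous (crho 0)); rewrite inE. Qed.

Lemma sublevel_open : open D.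
Proof.
apply: (@open_comp _ _ rho [set t | t < 0]); last exact: open_lt.
by move=> z _; exact: rho_continuous.
Qed.

Lemma sublevel_boundary z : boundary D z -> rho z = 0.
Proof.
move=> /(boundaryE _ sublevel_open)[cz nDz]; apply/eqP; rewrite eq_le; apply/andP; split.
  have cl : closed [set z | rho z <= 0].
    apply: (@closed_comp _ _ rho [set t | t <= 0]); last exact: closed_le.
    by move=> y _; exact: rho_continuous.
  suff : closure [set z | rho z <= 0] z by rewrite -(closure_id _).1.
  by apply: closure_subset cz => y /ltW.
by rewrite leNgt; apply/negP.
Qed.

Lemma sublevel_bounded (M : R) : (forall z j, D z -> `|xco j z| <= M /\ `|yco j z| <= M) ->
  bounded_set D.
Proof.
move=> h; exists (Num.max M 0); split; first exact: num_real.
move=> t Mt z Dz /=; apply: le_trans (ltW Mt).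
rewrite prod_normE ge_max; apply/andP; split.
  rewrite /Num.norm /= mx_normrE; apply/bigmax_leP; split; first by rewrite le_max lexx orbT.
  by case=> a j _ /=; rewrite ord1 le_max (h z j Dz).1.
rewrite /Num.norm /= mx_normrE; apply/bigmax_leP; split; first by rewrite le_max lexx orbT.
by case=> a j _ /=; rewrite ord1 le_max (h z j Dz).2.
Qed.

(** Each point is joined to 0 by an arc t a + t^2 b. Segments, with b = 0, suffice for the quartic
    domain; the quadratic term accommodates the images of rays under the inverse of a quadratic
    shear. *)
Lemma sublevel_connected : D 0 ->
  (forall z, D z -> exists a b : V, a + b = z /\
    forall t : R, 0 <= t <= 1 -> D (t *: a + t ^+ 2 *: b)) -> connected D.
Proof.
move=> D0 arc.
have h z : exists C : set V, [/\ connected C, C 0, D z -> C z & C `<=` D].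
  have [/arc[a [b [abz inD]]]|nD] := pselect (D z); last first.
    by exists [set 0]; split=> //; [exact: connected1|move=> y ->].
  exists ((fun t : R => t *: a + t ^+ 2 *: b) @` `[0, 1]); split.
  - apply: connected_continuous_connected; first exact: segment_connected.
    apply: continuous_subspaceT => t; apply: cvgD.
      by apply: cvgZ; [exact: cvg_id|exact: cvg_cst].
    by apply: cvgZ; [exact: exprn_continuous|exact: cvg_cst].
  - by exists 0; rewrite /= ?in_itv /= ?lexx ?ler01// expr0n /= !scale0r addr0.
  - by move=> _; exists 1; rewrite /= ?in_itv /= ?lexx ?ler01// expr1n !scale1r.
  - by move=> _ [t + <-]; rewrite /= in_itv /=; exact: inD.
pose C z := projT1 (cid (h z)).
have -> : D = \bigcup_z C z.
  apply/seteqP; split=> z.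
    by move=> Dz; exists z => //; rewrite /C; case: cid => /= X [_ _ + _]; exact.
  by case=> y _; rewrite /C; case: cid => /= X [_ _ _ +]; exact.
apply: bigcup_connected.
  by exists 0 => z _; rewrite /C; case: cid => /= X [].
by move=> z _; rewrite /C; case: cid => /= X [].
Qed.

Hypothesis grad : forall z, rho z = 0 -> exists v, 'D_v rho z != 0.

Lemma sublevel_defining (reg : set V -> (V -> R) -> Prop) : reg setT rho ->
  defining_function reg D rho.
Proof.
move=> h; split=> //; first by exists setT; split=> //; exact: openT.
by move=> z /sublevel_boundary rz; split=> //; exact: grad.
Qed.

End SublevelDomain.

Fact convex_sqr (R : realFieldType) (a b t : R) : 0 <= t <= 1 ->
  (a + t * (b - a)) ^+ 2 <= a ^+ 2 + t * (b ^+ 2 - a ^+ 2).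
Proof.
case/andP => t0 t1; rewrite -subr_ge0.
have -> : a ^+ 2 + t * (b ^+ 2 - a ^+ 2) - (a + t * (b - a)) ^+ 2 = t * (1 - t) * (b - a) ^+ 2.
  by ring.
by rewrite mulr_ge0 ?sqr_ge0// mulr_ge0// subr_ge0.
Qed.

Fact convex_quartic (R : realFieldType) (a b t : R) : 0 <= t <= 1 ->
  (a + t * (b - a)) ^+ 4 <= a ^+ 4 + t * (b ^+ 4 - a ^+ 4).
Proof.
move=> t01; rewrite !(exprM _ 2 2); apply: le_trans (convex_sqr (a ^+ 2) (b ^+ 2) t01).
by rewrite lerXn2r ?nnegrE ?convex_sqr ?sqr_ge0// (le_trans (sqr_ge0 (a + t * (b - a)))) ?convex_sqr.
Qed.

(* A quartic point of contact in the z_{i0} direction: at e_{i1} the boundary is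
   Levi-flat in that direction, so no strictly plurisubharmonic defining function
   exists. *)
Section QuarticDomain.
Context {R : realType} {n : nat}.
Local Notation V := (Cn R n).
Variables (i0 i1 : 'I_n).
Hypothesis i01 : i0 != i1.
Implicit Types (z v : V) (j : 'I_n).

(** One less than the degree in the j-th coordinate, that is, the power that appears in the first
    derivative; the degree is 4 for [i0] and 2 otherwise. *)
Definition quartic_exp j : nat := if j == i0 then 3%N else 1%N.
Local Notation e := quartic_exp.

Definition quartic_term j z : R := xco j z ^+ (e j).+1 + yco j z ^+ (e j).+1.
Definition quartic_fun z : R := \sum_j quartic_term j z - 1.
Definition quartic_domain : set V := [set z | quartic_fun z < 0].

Let ev j (x : R) : 0 <= x ^+ (e j).+1.
Proof. by rewrite exprn_even_ge0// /e; case: eqP. Qed.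

Lemma quartic_term_ge0 j z : 0 <= quartic_term j z.
Proof. by rewrite addr_ge0. Qed.

Lemma Ck_quartic_fun k : Ck k setT quartic_fun.
Proof.
apply: (@CkB _ _ k setT (fun z => \sum_j quartic_term j z) (cst 1) openT); last exact: Ck_cst openT.
apply: (Ck_sum (P := xpredT) _ openT) => j _; apply: (CkD openT); apply: (CkX _ openT).
  exact: Ck_xco openT.
exact: Ck_yco openT.
Qed.

Lemma is_derive_quartic_term j z v : is_derive z v (quartic_term j)
  ((e j).+1%:R * xco j z ^+ e j * xco j v + (e j).+1%:R * yco j z ^+ e j * yco j v).
Proof.
have := is_deriveD (is_deriveX (e j).+1 (is_derive_xco j z v)) (is_deriveX (e j).+1 (is_derive_yco j z v)).
by congr is_derive; apply/funext => y; rewrite /quartic_term /= !exprfctE.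
Qed.

Lemma derive_quartic_fun z v : 'D_v quartic_fun z =
  \sum_j ((e j).+1%:R * xco j z ^+ e j * xco j v + (e j).+1%:R * yco j z ^+ e j * yco j v).
Proof.
have := is_deriveB (is_derive_sum (fun j => is_derive_quartic_term j z v)) (is_derive_cst (1 : R) z v).
rewrite subr0 => -[_ <-]; congr ('D_v _ z); apply/funext => y.
by rewrite /quartic_fun /= fct_sumE.
Qed.

Lemma quartic_fun_grad z : quartic_fun z = 0 -> exists v, 'D_v quartic_fun z != 0.
Proof.
(* Euler's identity for the radial direction: the derivative is at least the sum of the terms, which
   equals 1 on the zero set. *)
move=> rz; exists z; rewrite gt_eqF// derive_quartic_fun.
have : \sum_j quartic_term j z <= \sum_j
    ((e j).+1%:R * xco j z ^+ e j * xco j z + (e j).+1%:R * yco j z ^+ e j * yco j z).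
  apply: ler_sum => j _; rewrite -!mulrA -!exprSr -mulrDr ler_peMl ?quartic_term_ge0//.
  by rewrite ler1n.
by apply: lt_le_trans; move/eqP: rz; rewrite subr_eq0 => /eqP ->.
Qed.

Lemma quartic_convex : convex_set quartic_domain.
Proof.
apply/convex_set_segmentP => z w t Dz Dw t01.
have h (a b : R) j : (a + t * (b - a)) ^+ (e j).+1 <=
    a ^+ (e j).+1 + t * (b ^+ (e j).+1 - a ^+ (e j).+1).
  by rewrite /e; case: eqP => _; [exact: convex_quartic|exact: convex_sqr].
have : quartic_fun (z + t *: (w - z)) <= quartic_fun z + t * (quartic_fun w - quartic_fun z).
  have -> : quartic_fun w - quartic_fun z = \sum_j (quartic_term j w - quartic_term j z).
    by rewrite /quartic_fun sumrB opprB addrA subrK.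
  rewrite /quartic_fun addrAC lerD2r mulr_sumr -big_split /=; apply: ler_sum => j _.
  rewrite /quartic_term /xco /yco /= !mxE.
  apply: le_trans (lerD (h _ _ j) (h _ _ j)) _.
  move: (_ ^+ _) (_ ^+ _) (_ ^+ _) (_ ^+ _) => a b c d; rewrite addrACA -mulrDr.
  by rewrite opprD addrACA.
move=> /le_lt_trans; apply.
case/andP: t01 => t0 t1; move: Dz Dw; rewrite /quartic_domain /=.
move: (quartic_fun z) (quartic_fun w) => a b a0 b0; clear h.
have -> : a + t * (b - a) = (1 - t) * a + t * b by ring.
have [->|tn0] := eqVneq t 0; first by rewrite subr0 mul1r mul0r addr0.
rewrite -(addr0 0) ler_ltD//; last by rewrite pmulr_rlt0// lt_def tn0.
by rewrite mulr_ge0_le0 ?subr_ge0// ltW.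
Qed.

Lemma quartic_term0 j : quartic_term j 0 = 0.
Proof. by rewrite /quartic_term /xco /yco /= !mxE !expr0n /= addr0. Qed.

Lemma quartic_smoothly_bounded : smoothly_bounded_domain quartic_domain.
Proof.
have D0 : quartic_domain 0.
  by rewrite /quartic_domain /= /quartic_fun big1 ?sub0r ?oppr_lt0// => j _; exact: quartic_term0.
have cr : Cinfty setT quartic_fun by move=> k; exact: Ck_quartic_fun.
split; first by exists 0.
- exact: sublevel_open cr.
- apply: sublevel_connected => // z Dz; exists z, 0; split; first exact: addr0.
  move=> t t01; rewrite scaler0 addr0.
  by have := (convex_set_segmentP _).1 quartic_convex 0 z t D0 Dz t01; rewrite add0r subr0.
- apply: (@sublevel_bounded _ _ _ 1) => z j Dz.
  have lt1 : quartic_term j z < 1.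
    move: Dz; rewrite /= subr_lt0; apply: le_lt_trans; rewrite (bigD1 j)//= lerDl.
    by apply: sumr_ge0 => k _; exact: quartic_term_ge0.
  split; rewrite -(@expr_le1 _ (e j).+1)// -normrX ger0_norm ?ev//; apply: le_trans (ltW lt1).
    by rewrite lerDl.
  by rewrite lerDr.
- by exists quartic_fun; apply: sublevel_defining => // z; exact: quartic_fun_grad.
Qed.

Let p : V := ex i1.

Let xp j : xco j p = (j == i1)%:R. Proof. by rewrite /xco /= mxE. Qed.
Let yp j : yco j p = 0. Proof. by rewrite /yco /= mxE. Qed.

Lemma quartic_fun_scale (t : R) : quartic_fun (t *: p) = t ^+ 2 - 1.
Proof.
have xs j : xco j (t *: p) = t * xco j p by rewrite /xco /= mxE.
have ys j : yco j (t *: p) = t * yco j p by rewrite /yco /= mxE.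
have E j : quartic_term j (t *: p) = (t * (j == i1)%:R) ^+ (e j).+1.
  by rewrite /quartic_term xs ys xp yp mulr0 expr0n addr0.
rewrite /quartic_fun (bigD1 i1)//= big1 ?addr0 => [|j ji1]; rewrite E.
  by rewrite eqxx mulr1 /e eq_sym (negbTE i01).
by rewrite (negbTE ji1) mulr0 expr0n.
Qed.

Lemma quartic_boundary : boundary quartic_domain p.
Proof.
apply/boundaryE; first exact: sublevel_open (fun k => Ck_quartic_fun k).
split; last first.
  by rewrite /quartic_domain /= -(scale1r p) quartic_fun_scale expr1n subrr ltxx.
(* The points t p with t < 1 close to 1 lie in the domain and tend to [p]. *)
move=> B Bp; have /(_ B) := @line_continuous R V 0 p 1.
rewrite scale1r add0r => /(_ Bp) /nbhs_ballP[d /= d0 Hd]; pose t : R := 1 - Num.min (d / 2) 1.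
have m0 : 0 < Num.min (d / 2) 1 by rewrite lt_min ltr01 divr_gt0.
exists (t *: p); split; last first.
  rewrite -[X in B X]add0r; apply: Hd; rewrite -ball_normE /= /t opprB addrCA subrr addr0 gtr0_norm//.
  by rewrite gt_min ltr_pdivrMr// ltr_pMr// ltr1n.
have t0 : 0 <= t by rewrite subr_ge0 ge_min lexx orbT.
by rewrite /quartic_domain /= quartic_fun_scale subr_lt0 expr_lt1// ltrBlDr ltrDl.
Qed.

Lemma quartic_flat v : (forall j, j != i0 -> xco j v = 0 /\ yco j v = 0) ->
  'D_v quartic_fun p = 0 /\ 'D_v ('D_v quartic_fun) p = 0.
Proof.
move=> v0.
have E z : 'D_v quartic_fun z =
    4 * xco i0 z ^+ 3 * xco i0 v + 4 * yco i0 z ^+ 3 * yco i0 v.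
  rewrite derive_quartic_fun (bigD1 i0)//= big1 ?addr0 ?/e ?eqxx// => j ji0.
  by have [-> ->] := v0 j ji0; rewrite !mulr0 addr0.
split; first by rewrite E xp yp (negbTE i01) !expr0n /= !mulr0 !mul0r addr0.
rewrite (funext E).
have hx := is_deriveX 3 (is_derive_xco i0 p v); have hy := is_deriveX 3 (is_derive_yco i0 p v).
suff [] : is_derive p v
  (fun z => 4 * xco i0 z ^+ 3 * xco i0 v + 4 * yco i0 z ^+ 3 * yco i0 v) 0 by [].
have := is_deriveD (is_deriveZ (4 * xco i0 v) hx) (is_deriveZ (4 * yco i0 v) hy).
congr is_derive; first by apply/funext => z /=; rewrite !exprfctE; congr (_ + _); exact: mulrAC.
by rewrite xp yp (negbTE i01) !expr0n /= !mulr0 !scale0r !scaler0 addr0.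
Qed.

Lemma quartic_not_super : ~ super_pseudoconvex quartic_domain.
Proof.
move=> [sb _ [r [sr _]]].
have oD : open quartic_domain by case: sb.
have cr0 : Cinfty setT quartic_fun by move=> k; exact: Ck_quartic_fun.
have drho : defining_function (Ck 2) quartic_domain quartic_fun.
  by apply: sublevel_defining => // z; exact: quartic_fun_grad.
have bp := quartic_boundary.
(* Flatness of [quartic_fun] passes to every defining function with the right sign: the second
   derivatives of [r] along both real [i0] directions are at most 0, whereas their sum is 4 r_{i0
   \bar i0}, positive by strict plurisubharmonicity. *)
have [c c0 Hc] := tangent_transfer oD (defining_function_le (isT : (2 <= 4)%N) sr.1) drho bp.
have flat v : (forall j, j != i0 -> xco j v = 0 /\ yco j v = 0) -> 'D_v ('D_v r) p <= 0.
  by move=> /quartic_flat[d1 d2]; have [_] := Hc v d1; rewrite d2 mulr0.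
have hx : 'D_(ex i0) ('D_(ex i0) r) p <= 0.
  by apply: flat => j ji0; rewrite /xco /yco /= !mxE (negbTE ji0) andbF.
have hy : 'D_(ey i0) ('D_(ey i0) r) p <= 0.
  by apply: flat => j ji0; rewrite /xco /yco /= !mxE (negbTE ji0) andbF.
have [[U [oU DU cr]] _ _] := sr.1.
have Up : p \in U by apply/mem_set/DU; case: bp.
have := sr.2 p (fun j => (j == i0)%:R) bp.1 _.
rewrite (_ : levi_form r p _ = r_ijb r i0 i0 p); last first.
  rewrite /levi_form (bigD1 i0)//= [X in _ + X]big1 ?addr0; last first.
    by move=> j ji0; rewrite big1// => k _; rewrite (negbTE ji0) mulr0 mul0r.
  rewrite (bigD1 i0)//= big1 ?addr0; last first.
    by move=> j ji0; rewrite (negbTE ji0) rmorph0 mulr0.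
  by rewrite eqxx conjC1 !mulr1.
move=> h; have : 0 < r_ijb r i0 i0 p.
  by apply: h; exists i0; rewrite eqxx oner_neq0.
rewrite -(pmulrn_lgt0 _ (isT : (0 < 4)%N)) -(laplacian_r_ijb i0 oU cr Up) ltcR.
have le0 := lerD hx hy; rewrite addr0 in le0.
by move=> /lt_le_trans/(_ le0); rewrite ltxx.
Qed.

End QuarticDomain.

Fact coordinate_bound (R : realFieldType) (x y : R) : x ^+ 2 + y ^+ 2 <= 1 ->
  `|x| <= 1 /\ `|y| <= 1.
Proof. by move=> h; rewrite !ler_norml; split; apply/andP; split; nra. Qed.

(** Real and imaginary parts of z_{i0}^2 are at most 1 in absolute value, whence 1 + 4 = 5. *)
Fact sheared_coordinate_bound (R : realFieldType) (x0 y0 x y : R) : x0 ^+ 2 + y0 ^+ 2 <= 1 ->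
  (x + 4 * (x0 * x0 - y0 * y0)) ^+ 2 + (y + 4 * (x0 * y0 + y0 * x0)) ^+ 2 <= 1 ->
  `|x| <= 5 /\ `|y| <= 5.
Proof.
move=> h0; set a := x0 * x0 - _; set b := x0 * y0 + _ => h.
have ha : `|a| <= 1 by rewrite /a ler_norml; apply/andP; split; nra.
have hb : `|b| <= 1.
  have := sqr_ge0 (x0 + y0); have := sqr_ge0 (x0 - y0).
  by clear h ha; rewrite /b ler_norml => ? ?; apply/andP; split; lra.
have [hx hy] := coordinate_bound h.
move: ha hb hx hy; rewrite !ler_norml => /andP[? ?] /andP[? ?] /andP[? ?] /andP[? ?].
by split; apply/andP; split; lra.
Qed.

(* The image of the unit ball under the inverse of the polynomial automorphism
   F(z) = z + 4 z_{i0}^2 e_{i1}.  As F has Jacobian determinant 1, |F|^2 - 1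
   satisfies J = 1 identically. *)
Section ShearedBall.
Context {R : realType} {n : nat}.
Local Notation V := (Cn R n).
Local Notation C := R[i].
Variables (i0 i1 : 'I_n).
Hypothesis i01 : (i0 < i1)%N.
Implicit Types (z v : V) (i j k : 'I_n).

Definition zco j z : C := (xco j z +i* yco j z)%C.

Definition shear j z : C := zco j z + (if j == i1 then 4 * (zco i0 z * zco i0 z) else 0).
Local Notation F := shear.

Definition shear_fun z : R := \sum_j complex.Re (F j z * Num.conj (F j z)) - 1.
Definition shear_domain : set V := [set z | shear_fun z < 0].
Local Notation r := shear_fun.

(** The entry (i, j) is the derivative of F_j in z_i; the derivative of 4 z_{i0}^2 is left in the
    form given by the product rule. *)
Definition shear_jac z : 'M[C]_n :=
  \matrix_(i, j) ((i == j)%:R + (if j == i1 then 4 * ((i == i0)%:R * zco i0 z + zco i0 z * (i == i0)%:R) else 0)).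
Local Notation P := shear_jac.

Lemma CCk_zco m j : CCk m setT (zco j).
Proof. by split; [exact: Ck_xco openT|exact: Ck_yco openT]. Qed.

Lemma CCk_shear m j : CCk m setT (F j).
Proof.
rewrite /shear; apply: (CCkD openT (CCk_zco m j)); case: eqP => _; last exact: CCk_cst openT.
by apply: (CCkZ _ openT); apply: (CCkM openT); exact: CCk_zco.
Qed.

Lemma Ck_shear_fun m : Ck m setT r.
Proof.
apply: (@CkB _ _ m setT (fun z => \sum_j complex.Re (F j z * Num.conj (F j z))) (cst 1) openT);
  last exact: Ck_cst openT.
apply: (Ck_sum (P := xpredT) _ openT) => j _.
by have [] := CCkM openT (CCk_shear m j) (CCkJ openT (CCk_shear m j)).
Qed.

Lemma shear_funE z : (r z)%:C%C = \sum_j F j z * Num.conj (F j z) - 1.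
Proof.
rewrite /shear_fun rmorphB rmorph1 rmorph_sum /=; congr (_ - _); apply: eq_bigr => j _.
by apply/esym/real_of_pos; rewrite -normCK exprn_ge0.
Qed.

Lemma is_cder_zco j z v : is_cder (zco j) z v (zco j v).
Proof. by split; [exact: is_derive_xco|exact: is_derive_yco]. Qed.

Let xex i j : xco j (ex i : V) = (i == j)%:R.
Proof. by rewrite /xco /= mxE /= eq_sym. Qed.
Let yex i j : yco j (ex i : V) = 0. Proof. by rewrite /yco /= mxE. Qed.
Let xey i j : xco j (ey i : V) = 0. Proof. by rewrite /xco /= mxE. Qed.
Let yey i j : yco j (ey i : V) = (i == j)%:R.
Proof. by rewrite /yco /= mxE /= eq_sym. Qed.

Let zex i j : zco j (ex i : V) = (i == j)%:R.
Proof. by rewrite /zco xex yex; case: eqP. Qed.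
Let zey i j : zco j (ey i : V) = 'i * (i == j)%:R.
Proof.
by rewrite /zco xey yey; case: (i == j); apply: complex_eq; rewrite ?(ReM, ImM) ?Re_i ?Im_i /=; ring.
Qed.

Lemma wirt_zco i j z : is_wirt (ex i) (ey i) (- 'i) (zco j) z (i == j)%:R.
Proof.
exists (zco j (ex i)), (zco j (ey i)); split; [exact: is_cder_zco|exact: is_cder_zco|].
by rewrite zex zey mulrA mulNr -expr2 sqrCi opprK mul1r -mulr2n -(mulr_natr (i == j)%:R 2) mulfK// pnatr_eq0.
Qed.

Lemma wirtb_zco i j z : is_wirt (ex i) (ey i) 'i (zco j) z 0.
Proof.
exists (zco j (ex i)), (zco j (ey i)); split; [exact: is_cder_zco|exact: is_cder_zco|].
by rewrite zex zey mulrA -expr2 sqrCi mulN1r subrr mul0r.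
Qed.

Lemma is_wirtJ v w (c : C) (f : V -> C) z d : is_wirt v w c f z d ->
  is_wirt v w (Num.conj c) (fun z => Num.conj (f z)) z (Num.conj d).
Proof.
case=> dv [dw [h1 h2 ->]]; exists (Num.conj dv), (Num.conj dw).
split; [exact: is_cderJ|exact: is_cderJ|].
by rewrite rmorphM rmorphD /= rmorphM /= fmorphV rmorph_nat.
Qed.

Lemma wirt_shear i j z : is_wirt (ex i) (ey i) (- 'i) (F j) z (P z i j).
Proof.
rewrite mxE; apply: is_wirtD; first exact: wirt_zco.
case: eqP => _; last exact: is_wirt_cst.
by apply: is_wirtZ; apply: is_wirtM; exact: wirt_zco.
Qed.

Lemma wirtb_shear i j z : is_wirt (ex i) (ey i) 'i (F j) z 0.
Proof.
rewrite -(addr0 0); apply: is_wirtD; first exact: wirtb_zco.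
case: eqP => _; last exact: is_wirt_cst.
rewrite -(mulr0 4); apply: is_wirtZ.
have := is_wirtM (wirtb_zco i i0 z) (wirtb_zco i i0 z).
by rewrite mul0r mulr0 addr0.
Qed.

Lemma wirt_shearJ i j z : is_wirt (ex i) (ey i) (- 'i) (fun z => Num.conj (F j z)) z 0.
Proof. by have := is_wirtJ (wirtb_shear i j z); rewrite conjCi rmorph0. Qed.

Lemma wirtb_shearJ i j z : is_wirt (ex i) (ey i) 'i (fun z => Num.conj (F j z)) z (Num.conj (P z i j)).
Proof. by have := is_wirtJ (wirt_shear i j z); rewrite rmorphN /= conjCi opprK. Qed.

Lemma wirtb_jac i j k z : is_wirt (ex k) (ey k) 'i (fun z => P z i j) z 0.
Proof.
have -> : (fun z => P z i j) = (fun z => (i == j)%:R +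
  (if j == i1 then 4 * ((i == i0)%:R * zco i0 z + zco i0 z * (i == i0)%:R) else 0)).
  by apply/funext => y; rewrite mxE.
rewrite -(addr0 0); apply: is_wirtD; first exact: is_wirt_cst.
case: eqP => _; last exact: is_wirt_cst.
rewrite -(mulr0 4); apply: is_wirtZ; rewrite -(addr0 0); apply: is_wirtD.
  by rewrite -(mulr0 (i == i0)%:R); apply: is_wirtZ; exact: wirtb_zco.
have := is_wirtM (wirtb_zco k i0 z) (is_wirt_cst (ex k) (ey k) 'i ((i == i0)%:R) z).
by rewrite mul0r mulr0 addr0.
Qed.

Let rCE : (fun z => (r z)%:C%C) = (fun z => \sum_j F j z * Num.conj (F j z) - 1).
Proof. by apply/funext => z; rewrite shear_funE. Qed.

Lemma shear_r_i i z : r_i r i z = \sum_j P z i j * Num.conj (F j z).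
Proof.
rewrite /r_i dzE rCE; apply: is_wirtE; rewrite -[X in is_wirt _ _ _ _ _ X]addr0.
apply: is_wirtD; last exact: is_wirt_cst.
apply: is_wirt_sum => j _; have := is_wirtM (wirt_shear i j z) (wirt_shearJ i j z).
by rewrite mulr0 addr0.
Qed.

Lemma shear_r_jb i z : r_jb r i z = \sum_j F j z * Num.conj (P z i j).
Proof.
rewrite /r_jb dzbE rCE; apply: is_wirtE; rewrite -[X in is_wirt _ _ _ _ _ X]addr0.
apply: is_wirtD; last exact: is_wirt_cst.
apply: is_wirt_sum => j _; have := is_wirtM (wirtb_shear i j z) (wirtb_shearJ i j z).
by rewrite mul0r add0r.
Qed.

(** F is holomorphic, hence so are the entries of its Jacobian matrix, and the barred derivative
    reaches only the conjugated factor. *)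
Lemma shear_r_ijb i k z : r_ijb r i k z = \sum_j P z i j * Num.conj (P z k j).
Proof.
rewrite /r_ijb (funext (shear_r_i i)) dzbE; apply: is_wirtE.
apply: is_wirt_sum => j _; have := is_wirtM (wirtb_jac i j k z) (wirtb_shearJ k j z).
by rewrite mul0r add0r.
Qed.

Definition shear_row z : 'rV[C]_n := \row_j F j z.

Lemma shear_hessian z : hessian r z = P z *m adjmx (P z).
Proof.
apply/matrixP => i j; rewrite [LHS]mxE [RHS]mxE shear_r_ijb; apply: eq_bigr => k _.
by rewrite [adjmx _ _ _]mxE [_^T _ _]mxE.
Qed.

Lemma shear_gradT z : gradT r z = P z *m adjmx (shear_row z).
Proof.
apply/matrixP => i j; rewrite [LHS]mxE [RHS]mxE shear_r_i; apply: eq_bigr => k _.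
by rewrite [adjmx _ _ _]mxE [_^T _ _]mxE [shear_row _ _ _]mxE.
Qed.

Lemma shear_gradTb z : \row_j r_jb r j z = shear_row z *m adjmx (P z).
Proof.
apply/matrixP => i j; rewrite [LHS]mxE [RHS]mxE shear_r_jb; apply: eq_bigr => k _.
by rewrite [adjmx _ _ _]mxE [_^T _ _]mxE [shear_row _ _ _]mxE.
Qed.

(** The only off-diagonal entry that can be nonzero sits at (i0, i1), above the diagonal because i0
    < i1; the diagonal consists of ones. *)
Lemma det_shear_jac z : \det (P z) = 1.
Proof.
rewrite -det_tr det_trig.
  rewrite big1// => i _; rewrite !mxE eqxx; case: eqP => [->|_]; last by rewrite addr0.
  by rewrite (gtn_eqF i01 : (i1 == i0) = false) mul0r mulr0 addr0 mulr0 addr0.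
apply/is_trig_mxP => i j ij; rewrite !mxE (gtn_eqF ij : (j == i) = false) add0r.
case: eqP => // ii; rewrite ii in ij.
have -> : (j == i0) = false by apply: gtn_eqF; exact: ltn_trans ij.
by rewrite mul0r mulr0 addr0 mulr0.
Qed.

Lemma shear_row_norm z : \tr (shear_row z *m adjmx (shear_row z)) = (r z)%:C%C + 1.
Proof.
rewrite shear_funE subrK /mxtrace big_ord1 mxE; apply: eq_bigr => j _.
by rewrite [adjmx _ _ _]mxE [_^T _ _]mxE [shear_row _ _ _]mxE.
Qed.

(** Congruence by diag(1, P), of determinant 1, reduces the bordered matrix to that of the unit ball
    at F(z), whose determinant is r - |F|^2 = -1. *)
Lemma feffermanJ_shear z : feffermanJ r z = 1.
Proof.
rewrite /feffermanJ.
have -> : block_mx ((r z)%:C)%C%:M (\row_j r_jb r j z) (\col_i r_i r i z) (hessian r z) =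
  block_mx 1%:M 0 0 (P z) *m block_mx ((r z)%:C)%C%:M (shear_row z) (adjmx (shear_row z)) 1%:M *m
  block_mx 1%:M 0 0 (adjmx (P z)).
  rewrite !mulmx_block !mul1mx !mul0mx !mulmx0 !mulmx1 !addr0 !add0r -shear_gradTb -shear_hessian.
  by rewrite -shear_gradT.
rewrite !det_mulmx !det_ublock !det1 !mul1r det_adjmx det_shear_jac conjC1 mulr1 mul1r.
have E : block_mx ((r z)%:C)%C%:M (shear_row z) (adjmx (shear_row z)) 1%:M *m
    block_mx 1%:M 0 (- adjmx (shear_row z)) 1%:M = block_mx (- 1)%:M (shear_row z) 0 1%:M.
  rewrite mulmx_block !mulmx1 !mul1mx !mulmx0 !add0r mulmxN subrr; congr block_mx.
  rewrite (mx11_scalar (shear_row z *m _)) -raddfB; congr (_%:M).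
  have := shear_row_norm z; rewrite /mxtrace big_ord1 => ->.
  by rewrite opprD addNKr.
have := congr1 determinant E; rewrite det_mulmx det_lblock !det1 !mulr1 => ->.
by rewrite det_ublock det1 det_scalar expr1 mulr1 opprK.
Qed.

Lemma shear_L2 z : L2 r z = 1.
Proof.
have E : log_J r = cst 0 by apply/funext => y; rewrite /log_J feffermanJ_shear ln1.
have d0 i : dz i (cst 0 : V -> C) = cst 0.
  by apply/funext => y; rewrite dzE; apply: is_wirtE; exact: is_wirt_cst.
have db0 i y : dzb i (cst 0 : V -> C) y = 0 by rewrite dzbE; apply: is_wirtE; exact: is_wirt_cst.
rewrite /L2 /tlaplace /Rfield /tgrad_norm2 E.
rewrite big1 => [|i _]; last by rewrite big1// => j _; rewrite d0 db0 mulr0.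
rewrite big1 => [|i _]; last by rewrite d0 mulr0.
rewrite big1 => [|i _]; last by rewrite big1// => j _; rewrite d0 mulr0 mul0r.
by rewrite /= !mulr0 addr0 mul0r !subr0.
Qed.

Let cr m : Ck m setT r. Proof. exact: Ck_shear_fun. Qed.
Let inT z : z \in setT. Proof. by rewrite inE. Qed.

Lemma shear_fun_grad z : r z = 0 -> exists v, 'D_v r z != 0.
Proof.
(* The radial direction pulled back by F, along which the derivative of |F|^2 is 2 |F|^2, equal to 2
   on the zero set. *)
move=> rz; have [v vE] := cvec_surj (shear_row z *m invmx (P z)).
have uP : P z \in unitmx by rewrite unitmxE det_shear_jac unitr1.
exists v; have := derive_gradT openT (cr 4) v (inT z).
rewrite vE shear_gradT -mulmxA (mulmxA (invmx _)) mulVmx// mul1mx shear_row_norm rz rmorph0 add0r.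
rewrite conjC1; apply: contra_eqN => /eqP ->; rewrite rmorph0 eq_sym.
by rewrite -mulr2n pnatr_eq0.
Qed.

Lemma shear_spsh : spsh_defining_function shear_domain r.
Proof.
split; first by apply: sublevel_defining => // z; exact: shear_fun_grad.
move=> z w _ [i wi]; rewrite levi_formE shear_hessian.
set W := \row_i w i; pose X := W *m P z.
have uP : P z \in unitmx by rewrite unitmxE det_shear_jac unitr1.
have X0 : X != 0.
  apply: contraNneq wi => X0; have : W = 0 by rewrite -(mulmxK uP W) -/X X0 mul0mx.
  by move/(congr1 (fun M : 'rV[C]_n => M 0 i)); rewrite !mxE => ->.
rewrite mulmxA -mulmxA -adjmxM -/X /mxtrace big_ord1 mxE.
have sq j : X 0 j * adjmx X j 0 = `|X 0 j| ^+ 2.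
  by rewrite [adjmx X _ _]mxE [X^T _ _]mxE normCK.
rewrite (eq_bigr _ (fun j _ => sq j)) lt_def sumr_ge0 ?andbT => [|j _]; last exact: exprn_ge0.
apply: contra X0; rewrite psumr_eq0 => [/allP h|j _]; last exact: exprn_ge0.
apply/eqP/matrixP => a j; rewrite ord1 [RHS]mxE; have := h j (mem_index_enum j).
by rewrite sqrf_eq0 normr_eq0 => /eqP.
Qed.

(** The arc is the preimage under F of the ray t F(z): with w = 4 z_{i0}^2 e_{i1} it reads t (z + w)
    - t^2 w, the shape asked for by [sublevel_connected]. *)
Lemma shear_at (t : R) z : F^~ (t *: (z + ((4 * (xco i0 z ^+ 2 - yco i0 z ^+ 2)) *: ex i1
    + (8 * (xco i0 z * yco i0 z)) *: ey i1))
  + t ^+ 2 *: - ((4 * (xco i0 z ^+ 2 - yco i0 z ^+ 2)) *: ex i1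
    + (8 * (xco i0 z * yco i0 z)) *: ey i1)) =1 (fun j => t%:C%C * F j z).
Proof.
set a := 4 * _; set b := 8 * _; set w := _ *: _ + _ *: _ => j.
have xw k : xco k w = a * (i1 == k)%:R by rewrite xco_linear xex -[b *: ey i1]addr0 xco_linear xey mulr0 add0r /xco /= mxE addr0.
have yw k : yco k w = b * (i1 == k)%:R by rewrite yco_linear yex mulr0 add0r -[b *: ey i1]addr0 yco_linear yey /yco /= mxE addr0.
set y := t *: _ + _.
have xy k : xco k y = t * (xco k z + xco k w) - t ^+ 2 * xco k w.
  by rewrite /y /xco /= !mxE mulrN.
have yy k : yco k y = t * (yco k z + yco k w) - t ^+ 2 * yco k w.
  by rewrite /y /yco /= !mxE mulrN.
have i10 : (i1 == i0) = false by apply: gtn_eqF; exact: i01.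
rewrite /shear /zco !xy !yy !xw !yw i10 (eq_sym j) /a /b.
move: (xco i0 z) (yco i0 z) (xco j z) (yco j z) => x0 y0 x1 y1.
by case: eqP => _; apply: complex_eq; rewrite !(ReD, ImD, ReM, ImM) /=; ring.
Qed.

Let D0 : shear_domain 0.
Proof.
rewrite /shear_domain /= /shear_fun big1 ?sub0r ?oppr_lt0// => j _.
have z0 k : zco k 0 = 0 by rewrite /zco /xco /yco /= !mxE.
by rewrite /shear !z0; case: eqP; rewrite ?mulr0 addr0 mul0r.
Qed.

Let sq_le (x : C) : complex.Re (x * Num.conj x) = complex.Re x ^+ 2 + complex.Im x ^+ 2.
Proof. by rewrite ReM ReJ ImJ mulrN opprK. Qed.

Lemma shear_bound z j : shear_domain z -> `|xco j z| <= 5 /\ `|yco j z| <= 5.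
Proof.
move=> Dz; have lt1 k : complex.Re (F k z) ^+ 2 + complex.Im (F k z) ^+ 2 <= 1.
  move: Dz; rewrite /shear_domain /= /shear_fun subr_lt0 => /ltW; apply: le_trans.
  rewrite (bigD1 k)//= sq_le lerDl sumr_ge0// => l _.
  by rewrite sq_le addr_ge0// sqr_ge0.
have [a1 b1] : xco i0 z ^+ 2 + yco i0 z ^+ 2 <= 1 /\ (j != i1 -> xco j z ^+ 2 + yco j z ^+ 2 <= 1).
  split; last by move=> ji; have := lt1 j; rewrite /shear (negbTE ji) addr0.
  have i10 : (i0 == i1) = false by apply: ltn_eqF; exact: i01.
  by have := lt1 i0; rewrite /shear i10 addr0.
have [ji|ji] := eqVneq j i1; last first.
  have [h1 h2] := coordinate_bound (b1 ji); have l5 : 1 <= 5 :> R by rewrite ler1n.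
  by split; [exact: le_trans h1 l5|exact: le_trans h2 l5].
rewrite ji; apply: (sheared_coordinate_bound a1); have := lt1 i1.
rewrite /shear eqxx !(ReD, ImD, ReM, ImM) /=; congr (is_true (_ <= 1)).
move: (xco i0 z) (yco i0 z) (xco i1 z) (yco i1 z) => x0 y0 x y.
by ring.
Qed.

Lemma shear_smoothly_bounded : smoothly_bounded_domain shear_domain.
Proof.
split; [by exists 0|exact: (sublevel_open (rho := r) cr)| | |].
- apply: sublevel_connected D0 _ => // z Dz.
  set w : V := (4 * (xco i0 z ^+ 2 - yco i0 z ^+ 2)) *: ex i1
    + (8 * (xco i0 z * yco i0 z)) *: ey i1.
  exists (z + w), (- w); split; first exact: addrK.
  move=> t /andP[t0 t1]; rewrite /= /shear_fun (eq_bigr (fun j => t ^+ 2 * complex.Re (F j z * Num.conj (F j z)))).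
    rewrite -mulr_sumr subr_lt0; move: Dz; rewrite /= /shear_fun subr_lt0.
    by apply: le_lt_trans; rewrite ler_piMl ?expr_le1// sumr_ge0// => j _; rewrite sq_le addr_ge0// sqr_ge0.
  move=> j _; have -> := shear_at t z j; rewrite rmorphM /= conj_real mulrACA -rmorphM /= -expr2.
  by rewrite Re_realM.
- by apply: sublevel_bounded => z j; exact: shear_bound.
- by exists r; apply: sublevel_defining => // z; exact: shear_fun_grad.
Qed.

Lemma shear_super : super_pseudoconvex shear_domain.
Proof.
split; [exact: shear_smoothly_bounded|exact: pseudoconvex_of_spsh shear_spsh|].
by exists r; split=> [|z _]; [exact: shear_spsh|rewrite shear_L2 ler01].
Qed.

Lemma shear_not_convex : ~ convex_set shear_domain.
Proof.
move=> /convex_set_segmentP cD.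
have i10 : (i0 == i1) = false by apply: ltn_eqF; exact: i01.
(* On the real slice z_{i0} = s, z_{i1} = -1, the function is s^2 + (4 s^2 - 1)^2 - 1: negative at s
   = 1/2 and s = -1/2, but zero at their midpoint s = 0. *)
pose q (s : R) : V := s *: ex i0 - ex i1.
have xq s k : xco k (q s) = s * (i0 == k)%:R - (i1 == k)%:R.
  by rewrite /q xco_linear xex; congr (_ + _); rewrite /xco /= !mxE /= eq_sym.
have yq s k : yco k (q s) = 0 by rewrite /q yco_linear yex mulr0 add0r /yco /= !mxE oppr0.
have rq s : r (q s) = s ^+ 2 + (4 * s ^+ 2 - 1) ^+ 2 - 1.
  rewrite /shear_fun (bigD1 i1)//= (bigD1 i0) ?i10//= big1 ?addr0; last first.
    move=> j /andP[ji1 ji0]; rewrite /shear (negbTE ji1) addr0 sq_le /= xq yq.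
    by rewrite eq_sym (negbTE ji0) eq_sym (negbTE ji1) mulr0 subrr expr0n addr0.
  rewrite !sq_le /shear eqxx i10 !(ReD, ImD, ReM, ImM) /= !xq !yq eqxx eqxx i10 eq_sym i10 /nat_of_bool.
  by ring.
have := cD (q (1 / 2)) (q (- (1 / 2))) (1 / 2).
rewrite /shear_domain /= !rq.
have -> : q (1 / 2) + (1 / 2) *: (q (- (1 / 2)) - q (1 / 2)) = q 0.
  rewrite /q opprB addrA addrNK -scalerBl scalerA addrAC -scalerDl.
  by congr (_ *: _ - _); field.
rewrite rq; have e1 : (1 / 2 : R) ^+ 2 + (4 * (1 / 2) ^+ 2 - 1) ^+ 2 - 1 < 0 by lra.
have e2 : (- (1 / 2) : R) ^+ 2 + (4 * (- (1 / 2)) ^+ 2 - 1) ^+ 2 - 1 < 0 by rewrite sqrrN.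
have t01 : 0 <= (1 / 2 : R) <= 1 by apply/andP; split; lra.
by move=> /(_ e1 e2 t01); rewrite expr0n /= mulr0 sub0r sqrrN expr1n add0r subrr ltxx.
Qed.

End ShearedBall.

Theorem theorem1p4 (R : realType) :
  (forall D : set (Cn R 1), smoothly_bounded_domain D ->
     (strictly_super_pseudoconvex D <-> strictly_convex D) /\
     (super_pseudoconvex D <-> convex_set D)) /\
  (forall (n : nat) (D : set (Cn R n)), (1 < n)%N ->
     smoothly_bounded_domain D -> convex_set D ->
     (exists r : Cn R n -> R, spsh_defining_function D r /\
        forall z : Cn R n, boundary D z -> 0 < convex_criterion r z) ->
     strictly_super_pseudoconvex D) /\
  (forall n : nat, (1 < n)%N ->
     (exists D : set (Cn R n),
        [/\ smoothly_bounded_domain D, convex_set D & ~ super_pseudoconvex D]) /\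
     (exists D : set (Cn R n),
        [/\ smoothly_bounded_domain D, super_pseudoconvex D & ~ convex_set D])).
Proof.
split; first by move=> D sbD; split;
  [exact: strictly_super_iff_strictly_convex|exact: super_iff_convex].
split=> [n D n1 sbD cD [r [sr crit]]|n n1].
  split=> //; first exact: pseudoconvex_of_spsh sr.
  exists r; split=> // z bz; have [_ oD _ _ _] := sbD.
  exact: (convex_L2_gt0 (ltnW n1) oD cD sr bz (crit z bz)).
pose i0 : 'I_n := Ordinal (ltnW n1); pose i1 : 'I_n := Ordinal n1.
split.
  exists (quartic_domain i0).
  split; [exact: quartic_smoothly_bounded|exact: quartic_convex|].
  exact: (@quartic_not_super R n i0 i1).
exists (shear_domain i0 i1).
by split; [exact: shear_smoothly_bounded|exact: shear_super|exact: shear_not_convex].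
Qed.
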